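(* Let $K$ be a number field of degree $d$ over $\mathbb{Q}$ with discriminant $\mathcal{D}_K$ and $r_2$ complex places. Let $N \geq 2$ be an integer, and let $W$ be a subspace of $K^N$ of dimension $w$, $1 \leq w \leq N$. Let $1 \leq s < w$ be an integer, and let $V_1,\dots,V_M$ be nonzero subspaces of $K^N$ of dimensions $l_1,\dots,l_M \geq 1$ respectively, with $\max_{1 \leq i \leq M} \{ l_i \} \leq s$. Define $$R_1 = \left( \left( \mathcal{C}^1_K(w)\, \mathcal{H}(W) \right)^{\frac{1}{w-s}} + 1 \right) \left\{ \left( \sum_{i=1}^M \frac{\mathcal{C}^2_{K,N}(l_i)}{\mathcal{H}(V_i)^d} \right)^{\frac{1}{(w-s)d}} + M^{\frac{1}{(w-s)d+1}} \right\},$$ where $$\mathcal{C}^1_K(w) = 4^{\frac{w(2d-r_2)+1}{2d}} (wd)^{w} |\mathcal{D}_K|^{\frac{w}{2d}},\qquad \mathcal{C}^2_{K,N}(l_i) = \frac{2^{l_i r_2} \binom{Nd}{l_i d}^{1/2}}{|\mathcal{D}_K|^{l_i/2}},$$ and $$R_2 = 2^{\frac{w(d-2r_2)}{2}}\, wd\, |\mathcal{D}_K|^{\frac{w}{2}}\, \mathcal{H}(W)^d.$$ Then there exists a point $\boldsymbol{x} \in W \setminus \bigcup_{i=1}^M V_i$ such that $H(\boldsymbol{x}) \leq \max \{ R_1, R_2 \}$.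
   Context: Heights. Let $M(K)$ be the set of places of $K$; for $v \in M(K)$ let $K_v$ be the completion and $d_v = [K_v:\mathbb{Q}_v]$ the local degree. Let $\|\cdot\|_v$ be the unique absolute value on $K_v$ extending the usual absolute value on $\mathbb{R}$ or $\mathbb{C}$ (if $v \mid \infty$) or the usual $p$-adic absolute value on $\mathbb{Q}_p$ (if $v \mid p$), and set $|a|_v = \|a\|_v^{d_v/d}$. For $\boldsymbol{x} \in K_v^N$ put $H_v(\boldsymbol{x}) = \max_{1\le i\le N} |x_i|_v$, and for $v \mid \infty$ put $\mathcal{H}_v(\boldsymbol{x}) = \left(\sum_{i=1}^N \|x_i\|_v^2\right)^{d_v/(2d)}$. For $\boldsymbol{x} \in K^N$ define $H(\boldsymbol{x}) = \prod_{v \in M(K)} H_v(\boldsymbol{x})$ and $\mathcal{H}(\boldsymbol{x}) = \prod_{v \nmid \infty} H_v(\boldsymbol{x}) \prod_{v \mid \infty} \mathcal{H}_v(\boldsymbol{x})$. For a subspace $V \subseteq K^N$ of dimension $J \geq 1$, choose a basis and let $X$ be the $N \times J$ basis matrix; let $Gr(X) \in K^{\binom{N}{J}}$ be the vector of all $J \times J$ minors of $X$ (Grassmann coordinates). The height of $V$ is $\mathcal{H}(V) = \mathcal{H}(Gr(X))$, which is independent of the choice of basis. *)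

(* Defs.v *)
From HB Require Import structures.
From mathcomp Require Import all_boot all_order all_algebra all_field.
From mathcomp Require Import all_classical all_reals all_analysis.
From mathcomp Require Import finmap ring_quotient.

Set Implicit Arguments.
Unset Strict Implicit.
Unset Printing Implicit Defensive.

Import Order.TTheory GRing.Theory Num.Theory.

Local Open Scope classical_set_scope.
Local Open Scope ring_scope.

Record absval (R : realType) (F : fieldType) := AbsVal {
  absval_fun :> F -> R;
  absval_ge0 : forall x, 0 <= absval_fun x;
  absval_eq0 : forall x, absval_fun x = 0 <-> x = 0;
  absvalM : {morph absval_fun : x y / x * y};
  absvalD : forall x y, absval_fun (x + y) <= absval_fun x + absval_fun y }.

Section Completion.
Variables (R : realType) (F : fieldType) (v : absval R F).
Implicit Types (u w : nat -> F).

Definition is_cauchy u : Prop := forall e : R, 0 < e ->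
  exists n0, forall m n, (n0 <= m)%N -> (n0 <= n)%N -> v (u m - u n) < e.

Definition is_null u : Prop := forall e : R, 0 < e ->
  exists n0, forall n, (n0 <= n)%N -> v (u n) < e.

Lemma absval0 : v 0 = 0. Proof. exact/absval_eq0. Qed.

Lemma absval1 : v 1 = 1.
Proof.
have v1 : v 1 != 0.
  by apply/eqP => /(absval_eq0 v)/eqP; rewrite oner_eq0.
by apply: (mulfI v1); rewrite -absvalM !mulr1.
Qed.

Lemma absvalN x : v (- x) = v x.
Proof.
have vN1 : v (- 1) = 1.
  apply/eqP; rewrite -(@eqrXn2 _ 2) ?absval_ge0// expr1n.
  by rewrite expr2 -absvalM mulrNN mulr1 absval1.
by rewrite -mulN1r absvalM vN1 mul1r.
Qed.

Lemma is_cauchy_bounded u :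
  is_cauchy u -> exists2 B : R, 0 < B & forall n, v (u n) < B.
Proof.
move=> /(_ 1 ltr01)[n0 hu].
exists (\sum_(i < n0.+1) v (u i) + 1).
  by rewrite ltr_wpDl// sumr_ge0// => i _; exact: absval_ge0.
have le_sum (i : 'I_n0.+1) : v (u i) <= \sum_(j < n0.+1) v (u j).
  rewrite (bigD1 i)//= lerDl sumr_ge0// => j _; exact: absval_ge0.
move=> n; have [ltn|len] := ltnP n n0.
  have := le_sum (Ordinal (leqW ltn)).
  by move=> /= /le_lt_trans; apply; rewrite ltrDl.
rewrite -[u n](subrK (u n0)) addrC.
apply: (le_lt_trans (absvalD v _ _)); apply: ler_ltD.
  exact: (le_sum ord_max).
exact: hu.
Qed.

Definition cauchy_seq : {pred nat -> F} := fun u => `[< is_cauchy u >].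

Lemma cauchy_seq_subring : subring_closed cauchy_seq.
Proof.
split.
- apply/asboolP => e e0; exists 0%N => m n _ _.
  by rewrite subrr absval0.
- move=> u w /asboolP hu /asboolP hw; apply/asboolP => e e0.
  have e20 : 0 < e / 2 by rewrite divr_gt0.
  have [n1 h1] := hu _ e20; have [n2 h2] := hw _ e20.
  exists (maxn n1 n2) => m n; rewrite !geq_max.
  move=> /andP[m1 m2] /andP[k1 k2].
  have -> : (u - w) m - (u - w) n = (u m - u n) + - (w m - w n).
    by rewrite !opprD !opprK; exact: addrACA.
  apply: (le_lt_trans (absvalD v _ _)); rewrite absvalN [ltRHS]splitr.
  by apply: ltrD; [exact: h1|exact: h2].
- move=> u w /asboolP hu /asboolP hw; apply/asboolP => e e0.
  have [A A0 hA] := is_cauchy_bounded hu.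
  have [B B0 hB] := is_cauchy_bounded hw.
  have eA : 0 < e / 2 / A by rewrite !divr_gt0.
  have eB : 0 < e / 2 / B by rewrite !divr_gt0.
  have [n1 h1] := hu _ eB; have [n2 h2] := hw _ eA.
  exists (maxn n1 n2) => m n; rewrite !geq_max.
  move=> /andP[m1 m2] /andP[k1 k2].
  have -> : (u * w) m - (u * w) n = (u m - u n) * w m + u n * (w m - w n).
    by rewrite /= mulrBl mulrBr addrA subrK.
  apply: (le_lt_trans (absvalD v _ _)); rewrite !absvalM [ltRHS]splitr.
  apply: ltrD.
    rewrite -[ltRHS](divfK (lt0r_neq0 B0)).
    by apply: ltr_pM; rewrite ?absval_ge0//; exact: h1.
  rewrite mulrC -[ltRHS](divfK (lt0r_neq0 A0)).
  by apply: ltr_pM; rewrite ?absval_ge0//; exact: h2.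
Qed.

HB.instance Definition _ :=
  GRing.isSubringClosed.Build (nat -> F) cauchy_seq cauchy_seq_subring.

Record cauchy_ring := CauchySeq {
  cauchy_val :> nat -> F;
  cauchy_valP : cauchy_val \in cauchy_seq }.

HB.instance Definition _ := [isSub for cauchy_val].
HB.instance Definition _ := [Choice of cauchy_ring by <:].
HB.instance Definition _ := [SubChoice_isSubComNzRing of cauchy_ring by <:].

Definition null_ideal : {pred cauchy_ring} := fun x => `[< is_null x >].

Lemma null_ideal_closed : idealr_closed null_ideal.
Proof.
split.
- by apply/asboolP => e e0; exists 0%N => n _; rewrite /= absval0.
- apply/asboolP => /(_ 1 ltr01)[n0 /(_ n0 (leqnn _))].
  by rewrite /= absval1 ltxx.
- move=> a u w /asboolP hu /asboolP hw; apply/asboolP => e e0.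
  have [B B0 hB] := is_cauchy_bounded (asboolW (cauchy_valP a)).
  have e20 : 0 < e / 2 by rewrite divr_gt0.
  have eB : 0 < e / 2 / B by rewrite !divr_gt0.
  have [n1 h1] := hu _ eB; have [n2 h2] := hw _ e20.
  exists (maxn n1 n2) => n; rewrite geq_max => /andP[k1 k2].
  apply: (le_lt_trans (absvalD v _ _)); rewrite [ltRHS]splitr.
  apply: ltrD; last exact: h2.
  rewrite /= absvalM mulrC -[ltRHS](divfK (lt0r_neq0 B0)).
  by apply: ltr_pM; rewrite ?absval_ge0//; exact: h1.
Qed.

HB.instance Definition _ :=
  isIdealr.Build cauchy_ring null_ideal null_ideal_closed.

Definition completion := {ideal_quot null_ideal}.

End Completion.

Definition padic_abs (R : realType) (p : nat) (q : rat) : R :=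
  if q == 0 then 0
  else p%:R ^+ logn p `|denq q|%N / p%:R ^+ logn p `|numq q|%N.

Section Places.
Variables (R : realType) (K : fieldExtType rat).

Definition archimedean (v : absval R K) : Prop :=
  forall q : rat, v q%:A = `|ratr q|.

Definition padic (p : nat) (v : absval R K) : Prop :=
  forall q : rat, v q%:A = padic_abs R p q.

(* Each place of K contains exactly one absolute value that restricts on Q to
   the usual absolute value or to a p-adic one; it represents the place, and
   it is the restriction to K of the normalized absolute value of K_v. *)
Record place := Place {
  place_abs :> absval R K;
  place_normalized :
    archimedean place_abs \/ exists2 p, prime p & padic p place_abs }.

HB.instance Definition _ := gen_eqMixin place.
HB.instance Definition _ := gen_choiceMixin place.

(* The image in K_v of the completion Q_v of Q: the classes of the Cauchy
   sequences of rationals. *)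
Definition rat_completion (v : absval R K) : set (completion v) :=
  [set x | exists2 u : cauchy_ring v,
    (forall n, exists q : rat, u n = q%:A) & x = \pi_(completion v)%qT u].

Definition completion_basis (v : absval R K) (n : nat)
    (b : 'I_n -> completion v) : Prop :=
  forall x : completion v, exists! c : {ffun 'I_n -> completion v},
    (forall i, rat_completion (c i)) /\ x = \sum_i c i * b i.

(* d_v = [K_v : Q_v] *)
Definition local_degree (v : absval R K) : nat :=
  xget 0%N [set n | exists b : 'I_n -> completion v, completion_basis b].

Definition degree : nat := \dim {:K}.

(* r_2; an archimedean K_v is C rather than R when its degree over R is 2. *)
Definition num_complex_places : nat :=
  #|` fset_set [set v : place | archimedean v /\ local_degree v = 2%N] |%fset.

End Places.

Arguments degree K : clear implicits.

Section Discriminant.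
Variable K : fieldExtType rat.

Definition field_trace (x : K) : rat :=
  \tr (passmx.mxof (vbasis {:K}) (vbasis {:K}) (amull x)).

Definition algebraic_integer (x : K) : Prop :=
  integralOver (intr : int -> K) x.

Definition integral_basis (b : 'I_(degree K) -> K) : Prop :=
  (forall i, algebraic_integer (b i)) /\
  forall x, algebraic_integer x ->
    exists! c : {ffun 'I_(degree K) -> int}, x = \sum_i b i *~ c i.

Definition discriminant : rat :=
  xget 0 [set D | exists2 b, integral_basis b &
                  D = \det (\matrix_(i, j) field_trace (b i * b j))].

End Discriminant.

Arguments discriminant K : clear implicits.

Section Heights.
Variables (R : realType) (K : fieldExtType rat).
Local Notation d := ((degree K)%:R : R).

Definition place_norm (v : place R K) (a : K) : R :=
  v a `^ ((local_degree v)%:R / d).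

Definition local_height n (v : place R K) (x : 'rV[K]_n) : R :=
  \big[Num.max/0]_(i < n) place_norm v (x 0 i).

Definition local_height2 n (v : place R K) (x : 'rV[K]_n) : R :=
  (\sum_(i < n) v (x 0 i) ^+ 2) `^ ((local_degree v)%:R / (2 * d)).

(* All but finitely many factors are 1 unless x = 0, when they are all 0 and
   the finitely supported product would not be the intended one. *)
Definition height n (x : 'rV[K]_n) : R :=
  if x == 0 then 0
  else \big[*%R/1]_(v \in [set: place R K]) local_height v x.

Definition height2 n (x : 'rV[K]_n) : R :=
  if x == 0 then 0
  else (\big[*%R/1]_(v \in [set v : place R K | ~ archimedean v])
          local_height v x)
     * (\big[*%R/1]_(v \in [set v : place R K | archimedean v])
          local_height2 v x).

(* The row sets of the J x J minors, as increasing J-tuples. *)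
Definition minor_rows N J : {set J.-tuple 'I_N} :=
  [set t : J.-tuple 'I_N | sorted ltn (map val t)].

Definition grassmann N J (X : 'M[K]_(N, J)) : 'rV[K]_#|minor_rows N J| :=
  \row_k \det (rowsub (tnth (enum_val k)) X).

Definition basis_mx N (V : {vspace 'rV[K]_N}) : 'M[K]_(N, \dim V) :=
  \matrix_(i, j) tnth (vbasis V) j 0 i.

Definition subspace_height N (V : {vspace 'rV[K]_N}) : R :=
  height2 (grassmann (basis_mx V)).

End Heights.

Section Constants.
Variables (R : realType) (K : fieldExtType rat).
Local Notation d := (degree K).
Local Notation r2 := (num_complex_places R K).
Local Notation absD := (`|ratr (discriminant K)| : R).

Definition const1 (w : nat) : R :=
  4 `^ ((w%:R * (2 * d%:R - r2%:R) + 1) / (2 * d%:R))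
  * (w%:R * d%:R) ^+ w * absD `^ (w%:R / (2 * d%:R)).

Definition const2 (N l : nat) : R :=
  2 ^+ (l * r2) * 'C(N * d, l * d)%:R `^ (1 / 2) / absD `^ (l%:R / 2).

Variables (N M : nat) (W : {vspace 'rV[K]_N}) (s : nat)
  (V : 'I_M -> {vspace 'rV[K]_N}).
Local Notation w := (\dim W).

Definition bound1 : R :=
  ((const1 w * subspace_height R W) `^ (1 / (w%:R - s%:R)) + 1)
  * ((\sum_(i < M) const2 N (\dim (V i)) / subspace_height R (V i) ^+ d)
       `^ (1 / ((w%:R - s%:R) * d%:R))
     + M%:R `^ (1 / ((w%:R - s%:R) * d%:R + 1))).

Definition bound2 : R :=
  2 `^ ((w%:R * (d%:R - 2 * r2%:R)) / 2) * w%:R * d%:R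
  * absD `^ (w%:R / 2) * subspace_height R W ^+ d.

End Constants.

(* Main.v *)
(** The points of [W] with algebraic integer coordinates all of whose conjugates
    are at most [T >= 1] in absolute value have height at most [T].  Take for [T]
    the right-hand side and suppose that all these points lie in the union of
    the [V i].

    Through a basis of the ring of integers, the integral points of an
    [l]-dimensional subspace [V] form a lattice of rank [l * d] in a Euclidean
    space, of covolume [|D|^(l/2) * H(V)^d].  The archimedean part of [H(V)] comes
    from a Gram determinant, by Cauchy-Binet; the finite part comes from an index,
    which is computed one prime at a time: if [p] annihilates [z] modulo the lattice
    [M], then replacing [M] by [M + O z] multiplies the largest value at [p] of the
    determinant of a tuple of [M] by the inverse of a uniformizer, and changes no
    other finite place.

    By pigeonhole [W] contains at least of the order of [T^(wd) / covol] such
    points.  If those in [V i] span [V i] over the rationals, choose a maximal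
    independent family among them; in orthogonal coordinates adapted to it, the
    successive widths of its lattice are at most the radius of the ball containing
    the points, so that each coset has few points there and all the cosets together
    at most of the order of [T^(ld) / covol].  If they do not span, there are at most
    [m^(ld - 1)] with [m > 2 T], because points that are congruent modulo [m]
    are equal.  Comparing the counts contradicts the choice of [T]. *)

From HB Require Import structures.
Require Import Defs.
From mathcomp Require Import all_boot all_order all_algebra all_fingroup all_field.
From mathcomp Require Import all_classical all_reals all_analysis.
From mathcomp Require Import complex ring lra zify.

Set Implicit Arguments.
Unset Strict Implicit.
Unset Printing Implicit Defensive.

Import Order.TTheory GRing.Theory Num.Theory.
Local Open Scope ring_scope.

(** * Determinants *)

(** The shape of the bound comes from one comparison. When its points span, a subspace of dimension
    at most [s] has at most [T^(sd)] of them up to a factor carrying its height, so it falls short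
    of [W] by [T^((w-s)d)]; this is the sum under the root of order [(w-s)d]. When they do not span,
    one more power of [T] is lost but the height disappears; these subspaces contribute 1 each, and
    [M] stands under a root of order [(w-s)d + 1].

    The obstacle is that the integral points of a subspace form a module over the ring of integers
    that need not be free, so no matrix over [K] presents them. They are reached from a sublattice
    [m O^l], which has an explicit integral basis: points become rational vectors, the sublattice
    becomes the integral vectors, and the covolume is the product of the diagonal of a triangular
    Gram factor divided by the index of the sublattice. The counting lemmas therefore take that
    index, or a map to [k] classes, as a datum. Volumes are replaced by floors in triangular
    coordinates; the resulting factors 2 and 4 are absorbed by the powers of 2 in [const1] and
    [const2]. *)

(** Multilinearity in the rows of the product expands the determinant over all functions [f]. A
    noninjective [f] repeats a row; the injective ones with the same sorted image differ by a
    permutation, and their signed sum is the determinant of the column submatrix. *)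
Lemma cauchy_binet (R : comNzRingType) (N l : nat) (A : 'M[R]_(l, N))
    (B : 'M[R]_(N, l)) :
  \det (A *m B) =
  \sum_(t in [set t : l.-tuple 'I_N | sorted ltn (map val t)])
    \det (colsub (tnth t) A) * \det (rowsub (tnth t) B).
Proof.
have -> : \det (A *m B) = \sum_(f : {ffun 'I_l -> 'I_N})
    (\prod_i A i (f i)) * \det (rowsub f B).
  transitivity (\sum_(s : 'S_l) \sum_(f : {ffun 'I_l -> 'I_N})
      (-1) ^+ s * \prod_i (A i (f i) * B (f i) (s i))).
    apply: eq_bigr => s _; rewrite -big_distrr /=; congr (_ * _).
    under eq_bigr => i _ do rewrite mxE.
    by rewrite bigA_distr_bigA.
  rewrite exchange_big; apply: eq_bigr => f _ /=.
  rewrite /determinant big_distrr /=; apply: eq_bigr => s _.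
  rewrite big_split /= mulrCA; congr (_ * (_ * _)).
  by apply: eq_bigr => i _; rewrite mxE.
pose leo := fun i j : 'I_N => (i <= j)%N.
pose sf (f : {ffun 'I_l -> 'I_N}) : l.-tuple 'I_N :=
  [tuple of sort leo [tuple f i | i < l]].
rewrite (bigID (fun f : {ffun 'I_l -> 'I_N} => injectiveb f)) /=.
rewrite [X in _ + X]big1 ?addr0; last first.
  move=> f /injectivePn [i [j nij fij]].
  rewrite (determinant_alternate nij) ?mulr0 // => k.
  by rewrite !mxE fij.
rewrite (partition_big sf (mem [set t : l.-tuple 'I_N | sorted ltn (map val t)])) /=.
  apply: eq_bigr => t; rewrite inE => st.
  have ut : uniq t.
    by rewrite -(map_inj_uniq val_inj); apply: (sorted_uniq ltn_trans ltnn).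
  have tI : injective (tnth t) by apply/tuple_uniqP.
  rewrite (reindex (fun s : 'S_l => [ffun i => tnth t (s i)])) /=; last first.
    (* The permutation sends [i] to the position of [f i] in [t]; the fallbacks [odflt i] and [1%g]
       are never reached when the sorted image of [f] is [t]. *)
    pose g (f : {ffun 'I_l -> 'I_N}) : 'S_l :=
      if injectiveP (fun i => odflt i [pick j | tnth t j == f i]) is ReflectT h
      then perm h else 1%g.
    exists g => [s _|f].
      rewrite /g; case: injectiveP => h.
        apply/permP => i; rewrite permE ffunE.
        case: pickP => [j /eqP/tI -> //|/(_ (s i))]; by rewrite eqxx.
      case: h => i j; rewrite !ffunE.
      case: pickP => [i' /eqP/tI -> |/(_ (s i))]; last by rewrite eqxx.
      case: pickP => [j' /eqP/tI -> |/(_ (s j))]; last by rewrite eqxx.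
      exact: perm_inj.
    rewrite inE => /andP[/injectiveP fI /eqP sft].
    have ft i : exists j, tnth t j = f i.
      have /tnthP[j ->] : f i \in t; last by exists j.
      by rewrite -sft mem_sort; apply/mapP; exists i; rewrite ?mem_enum.
    have hE i : tnth t (odflt i [pick j | tnth t j == f i]) = f i.
      case: pickP => [j /eqP //|] h.
      by have [j jE] := ft i; move: (h j); rewrite jE eqxx.
    rewrite /g; case: injectiveP => [h|[]].
      by apply/ffunP => i; rewrite ffunE permE hE.
    by move=> i j /(congr1 (tnth t)); rewrite !hE => /fI.
  rewrite [X in _ = X * _]/determinant big_distrl /=.
  rewrite (eq_bigl xpredT) => [|s]; last first.
    have -> : injectiveb [ffun i => tnth t (s i)].
      by apply/injectiveP => i j; rewrite !ffunE => /tI/perm_inj.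
    apply/eqP/val_inj => /=.
    apply: (@sorted_eq _ leo) => //.
    - by move=> x y z; apply: leq_trans.
    - by move=> x y xy; apply/val_inj/eqP; rewrite eqn_leq.
    - by apply: sort_sorted => x y; apply: leq_total.
    - have : sorted leq (map val t) by apply: sub_sorted st => x y; exact: ltnW.
      by rewrite sorted_map.
    rewrite perm_sort; apply/tuple_permP; exists s.
    by apply: eq_map => i; rewrite ffunE.
  apply: eq_bigr => s _.
  have -> : rowsub [ffun i => tnth t (s i)] B = row_perm s (rowsub (tnth t) B).
    by apply/matrixP => i j; rewrite !mxE ffunE.
  rewrite row_permE det_mulmx det_perm mulrCA mulrA; congr (_ * _ * _).
  by apply: eq_bigr => i _; rewrite !mxE ffunE.
move=> f /injectiveP fI; rewrite inE.
have uf : uniq (sf f).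
  by rewrite sort_uniq map_inj_uniq ?enum_uniq.
rewrite ltn_sorted_uniq_leq map_inj_uniq ?uf; last exact: val_inj.
rewrite sorted_map /=; apply: sort_sorted => x y; exact: leq_total.
Qed.

Lemma det_reindex (R : comNzRingType) (m n : nat) (f : 'I_n -> 'I_m)
    (A : 'M[R]_m) :
  bijective f -> \det (\matrix_(i, j) A (f i) (f j)) = \det A.
Proof.
move=> bf; have emn : n = m by have := bij_eq_card bf; rewrite !card_ord.
move: f bf; rewrite emn => f bf.
pose s := perm (bij_inj bf).
have -> : \matrix_(i, j) A (f i) (f j) = row_perm s (col_perm s A).
  by apply/matrixP => i j; rewrite !mxE !permE.
rewrite row_permE col_permE !det_mulmx !det_perm mulrCA.
by rewrite odd_permV -signr_addb addbb expr0 mulr1.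
Qed.

(** A block-diagonal matrix up to a simultaneous reindexing of rows and columns. Keeping the
    indexing abstract allows one pairing to be read in both ways, with blocks indexed by either
    projection. *)
Lemma det_blocks (R : comNzRingType) (n p q : nat) (f : 'I_n -> 'I_p)
    (g : 'I_n -> 'I_q) (B : 'I_p -> 'M[R]_q) :
  bijective (fun i => (f i, g i)) ->
  \det (\matrix_(i, j) ((f i == f j)%:R * B (f i) (g i) (g j))) =
  \prod_i \det (B i).
Proof.
elim: p n f g B => [|p IH] n f g B bfg.
  have n0 : n = 0%N.
    by have := bij_eq_card bfg; rewrite card_prod !card_ord.
  by move: f g bfg; rewrite n0 => f g _; rewrite det_mx00 big_ord0.
have nE : n = (q + p * q)%N.
  by have := bij_eq_card bfg; rewrite card_prod !card_ord mulSn.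
pose e (x : 'I_(q + p * q)) : 'I_p.+1 * 'I_q :=
  match fintype.split x with
  | inl j => (ord0, j)
  | inr y => let z := enum_val (cast_ord (esym (mxvec_cast p q)) y) in
             (lift ord0 z.1, z.2)
  end.
have be : bijective e.
  apply: inj_card_bij; last by rewrite card_prod !card_ord mulSn.
  move=> x y; rewrite /e -[x]fintype.splitK -[y]fintype.splitK.
  case: (fintype.split x) => a; case: (fintype.split y) => b; rewrite !unsplitK //=.
    by move=> h; rewrite (congr1 snd h : a = b).
  move=> h; have e1 := lift_inj (congr1 fst h); have e2 := congr1 snd h.
  move: e1 e2 => /= e1 e2; congr (rshift _ _).
  apply: (@cast_ord_inj _ _ (esym (mxvec_cast p q))); apply: enum_val_inj.
  by apply/eqP; rewrite -pair_eqE /= e1 e2 !eqxx.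
have [h hK Kh] := be.
pose M := \matrix_(x, y) (((e x).1 == (e y).1)%:R * B (e x).1 (e x).2 (e y).2).
transitivity (\det M).
  rewrite -(det_reindex (f := fun i => h (f i, g i)) M); last first.
    by apply: (bij_comp (f := h)) bfg; exists e.
  by congr (\det _); apply/matrixP => i j; rewrite !mxE !Kh.
rewrite -[M]submxK.
have -> : ursubmx M = 0.
  apply/matrixP => i j; rewrite !mxE /e (unsplitK (inl i)) (unsplitK (inr j)).
  by rewrite /= mul0r.
rewrite det_lblock big_ord_recl; congr (_ * _).
  congr (\det _); apply/matrixP => i j; rewrite !mxE /e.
  by rewrite (unsplitK (inl i)) (unsplitK (inl j)) /= mul1r.
pose z (y : 'I_(p * q)) : 'I_p * 'I_q :=
  enum_val (cast_ord (esym (mxvec_cast p q)) y).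
rewrite -(IH _ (fun y => (z y).1) (fun y => (z y).2) (fun i => B (lift ord0 i))).
  congr (\det _); apply/matrixP => i j; rewrite !mxE /e.
  rewrite (unsplitK (inr i)) (unsplitK (inr j)) /=.
  by rewrite (inj_eq (@lift_inj _ _)).
apply: inj_card_bij; last by rewrite card_prod !card_ord.
move=> x y /= [e1 e2]; apply: (@cast_ord_inj _ _ (esym (mxvec_cast p q))).
by apply: enum_val_inj; apply/eqP; rewrite -pair_eqE /= -/(z x) -/(z y) e1 e2 !eqxx.
Qed.

Lemma cholesky (R : rcfType) n (G : 'M[R]_n) :
  G^T = G -> (forall a : 'rV_n, a != 0 -> 0 < (a *m G *m a^T) 0 0) ->
  exists2 C : 'M[R]_n, is_trig_mx C /\ (forall i, 0 < C i i) & G = C *m C^T.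
Proof.
elim: n G => [|n IH] G sG pG.
  exists 0; last by apply/matrixP => -[].
  by split=> [|[]//]; apply/is_trig_mxP => -[].
move: G sG pG; rewrite -[n.+1]/(1 + n)%N => G sG pG.
have sGE : G = block_mx (ulsubmx G) (ursubmx G) (ursubmx G)^T (drsubmx G).
  by rewrite trmx_ursub sG submxK.
set g := ulsubmx G 0 0; set v := ursubmx G.
have gE : ulsubmx G = g%:M by rewrite [LHS]mx11_scalar.
have sG' : (drsubmx G)^T = drsubmx G by rewrite trmx_drsub sG.
have quad (c : R) (a : 'rV_n) :
    (row_mx c%:M a *m G *m (row_mx c%:M a)^T) 0 0 =
    c ^+ 2 * g + 2 * c * (a *m v^T) 0 0 + (a *m drsubmx G *m a^T) 0 0.
  have -> : row_mx c%:M a *m G *m (row_mx c%:M a)^T =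
    (c ^+ 2 * g)%:M + (2 * c) *: (a *m v^T) + a *m drsubmx G *m a^T.
    rewrite sGE mul_row_block tr_row_mx mul_row_col gE tr_scalar_mx -/v.
    rewrite !mulmxDl !mul_scalar_mx !mul_mx_scalar scale_scalar_mx.
    rewrite -scalemxAl -[v *m a^T]trmxK trmx_mul trmxK.
    rewrite [a *m v^T]mx11_scalar tr_scalar_mx !scale_scalar_mx addrA.
    rewrite block_mxKdr; congr (_ + _); rewrite -!raddfD /=; congr (_%:M); ring.
  by rewrite [LHS]mxE [X in X + _]mxE !mxE eqxx mulr1n.
have g0 : 0 < g.
  have := pG (row_mx 1%:M 0); rewrite quad !mul0mx !mxE mulr0 !addr0 expr1n mul1r.
  apply; apply/eqP => /(congr1 (fun M : 'M[R]_(1, 1 + n) => M 0 (lshift n 0))).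
  by rewrite row_mxEl !mxE => /eqP; rewrite oner_eq0.
pose G' := drsubmx G - g^-1 *: (v^T *m v).
have sG'' : G'^T = G'.
  by rewrite /G' linearB linearZ /= sG' trmx_mul trmxK.
case: (IH G' sG'').
  (* This first coordinate minimizes the form once the others are fixed to [a]; the minimum is the
     value at [a] of the Schur complement [G']. *)
  move=> a a0; have := pG (row_mx (- (g^-1 * (a *m v^T) 0 0))%:M a).
  rewrite quad /G' mulmxBr mulmxBl [X in _ -> 0 < X]mxE [X in _ -> 0 < _ + X]mxE.
  have -> : (a *m (g^-1 *: (v^T *m v)) *m a^T) 0 0 = g^-1 * (a *m v^T) 0 0 ^+ 2.
    rewrite -scalemxAr -scalemxAl mxE; congr (_ * _).
    rewrite mulmxA -[_ *m _ *m _ *m _]mulmxA [a *m v^T]mx11_scalar.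
    have -> : v *m a^T = (a *m v^T)^T by rewrite trmx_mul trmxK.
    by rewrite [a *m v^T]mx11_scalar tr_scalar_mx -scalar_mxM !mxE eqxx mulr1n.
  set u := (a *m v^T) 0 0 => h.
  suff -> : (a *m drsubmx G *m a^T) 0 0 - g^-1 * u ^+ 2 =
    (- (g^-1 * u)) ^+ 2 * g + 2 * - (g^-1 * u) * u + (a *m drsubmx G *m a^T) 0 0.
    apply: h; apply/eqP => /(congr1 (@rsubmx _ _ _ _)).
    by rewrite row_mxKr linear0 => /eqP; apply/negP.
  by field; apply: lt0r_neq0.
move=> C' [tC' pC'] eC'.
exists (block_mx (Num.sqrt g)%:M 0 ((Num.sqrt g)^-1 *: v^T) C'); [split|].
- by rewrite is_trig_block_mx // eqxx tC' scalar_mx_is_trig.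
- move=> k; rewrite -[k]fintype.splitK; case: (fintype.split k) => j /=.
    by rewrite block_mxEul !ord1 mxE eqxx mulr1n sqrtr_gt0.
  by rewrite block_mxEdr.
have sg0 : Num.sqrt g != 0 by rewrite sqrtr_eq0 -ltNge.
rewrite {1}sGE tr_block_mx mulmx_block !trmx0 !mulmx0 !mul0mx !addr0.
rewrite gE -/v tr_scalar_mx linearZ /= trmxK.
have gg : Num.sqrt g * Num.sqrt g = g by rewrite -expr2 sqr_sqrtr // ltW.
congr block_mx.
- by rewrite -scalar_mxM gg.
- by rewrite mul_scalar_mx scalerA mulfV // scale1r.
- by rewrite mul_mx_scalar scalerA mulfV // scale1r.
- rewrite -eC' /G' -scalemxAr -scalemxAl scalerA -invfM gg.
  by rewrite addrCA subrr addr0.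
Qed.

Section IntMx.
Variables (m n : nat).
Implicit Types x y : 'M[rat]_(m, n).

(** * Counting lattice points *)

Lemma intmxD x y : x \is a mxOver Num.int -> y \is a mxOver Num.int ->
  x + y \is a mxOver Num.int.
Proof.
by move=> /mxOverP hx /mxOverP hy; apply/mxOverP => i j; rewrite mxE rpredD.
Qed.

Lemma intmxN x : x \is a mxOver Num.int -> - x \is a mxOver Num.int.
Proof. by move=> /mxOverP hx; apply/mxOverP => i j; rewrite mxE rpredN. Qed.

Lemma intmxB x y : x \is a mxOver Num.int -> y \is a mxOver Num.int ->
  x - y \is a mxOver Num.int.
Proof. by move=> hx hy; apply/intmxD/intmxN. Qed.

Lemma intmx0 : (0 : 'M[rat]_(m, n)) \is a mxOver Num.int.
Proof. by apply/mxOverP => i j; rewrite mxE. Qed.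

Lemma intmxM p x (y : 'M[rat]_(n, p)) :
  x \is a mxOver Num.int -> y \is a mxOver Num.int ->
  x *m y \is a mxOver Num.int.
Proof.
move=> /mxOverP hx /mxOverP hy; apply/mxOverP => i j; rewrite mxE.
by apply: rpred_sum => k _; rewrite rpredM.
Qed.

Lemma intmxP x : x \is a mxOver Num.int ->
  exists z : 'M[int]_(m, n), x = map_mx intr z.
Proof.
move=> /mxOverP hx; exists (map_mx Num.floor x); apply/matrixP => i j.
by rewrite !mxE floorK.
Qed.

Lemma intmx_map (z : 'M[int]_(m, n)) : map_mx intr z \is a @mxOver m n rat Num.int.
Proof. by apply/mxOverP => i j; rewrite mxE intr_int. Qed.

End IntMx.

Section TriangularLattice.
Variables (R : realType) (n : nat) (C : 'M[R]_n).
Hypotheses (tC : is_trig_mx C) (pC : forall i, 0 < C i i).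

Notation toR := (map_mx (ratr : rat -> R)).

Lemma mul_trig_sum (x : 'rV[R]_n) j :
  (x *m C) 0 j = x 0 j * C j j + \sum_(i < n | (j < i)%N) x 0 i * C i j.
Proof.
rewrite mxE (bigD1 j) //=; congr (_ + _).
rewrite (bigID (fun i : 'I_n => (j < i)%N)) /= addrC big1 ?add0r.
  by apply: eq_bigl => i; rewrite andbC; rewrite -val_eqE; case: ltngtP.
move=> i /andP[ij]; rewrite -leqNgt leq_eqVlt val_eqE (negPf ij) /= => lt.
by rewrite (is_trig_mxP tC) ?mulr0.
Qed.

(** [C] is lower triangular, so coordinate [j] of the image involves only the entries of index at
    least [j]. At the last index where [x] and [y] differ, all other contributions cancel. *)
Lemma top_difference (x y : 'rV[rat]_n) : x != y ->
  exists j, x 0 j != y 0 j /\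
    (toR x *m C) 0 j - (toR y *m C) 0 j = ratr (x 0 j - y 0 j) * C j j.
Proof.
move=> nxy; have [i0 i0P] : exists i, x 0 i != y 0 i.
  apply/existsP; apply: contraNT nxy; rewrite negb_exists => /forallP h.
  by apply/eqP/rowP => i; apply/eqP; have := h i; rewrite negbK.
case: (@arg_maxnP _ i0 (fun i => x 0 i != y 0 i) (fun i : 'I_n => val i) i0P) => j jP jmax; exists j; split=> //.
rewrite !mul_trig_sum !mxE rmorphB /= mulrBl opprD addrACA.
rewrite [X in _ + X](_ : _ = 0) ?addr0 // -sumrB big1 // => i ij.
rewrite !mxE -mulrBl; have [->|/jmax] := eqVneq (x 0 i) (y 0 i).
  by rewrite subrr mul0r.
by rewrite /geq /= leqNgt ij.
Qed.

(** Measured in units of [C j j], the floors of the coordinates separate points of one coset: at the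
    last difference the coordinates differ by a nonzero integer number of units. *)
Lemma coset_count (s : seq 'rV[rat]_n) (r : R) :
  uniq s -> (forall x y, x \in s -> y \in s -> x - y \is a mxOver Num.int) ->
  (forall x j, x \in s -> `|(toR x *m C) 0 j| <= r) -> (forall j, C j j <= r) ->
  (size s)%:R <= \prod_j (4 * r / C j j).
Proof.
move=> us ds bs rs.
pose lo j := Num.floor (- r / C j j).
pose B j := `|Num.floor (r / C j j) - lo j|%N.
pose fl (x : 'rV[rat]_n) j := Num.floor ((toR x *m C) 0 j / C j j).
pose g (x : 'rV[rat]_n) : {dffun forall j : 'I_n, 'I_(B j).+1} :=
  [ffun j => inord `|fl x j - lo j|%N].
have flb x j : x \in s -> lo j <= fl x j <= Num.floor (r / C j j).
  move=> xs; have := bs x j xs; rewrite ler_norml => /andP[h1 h2].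
  by apply/andP; split; apply: le_floor; rewrite ler_pM2r ?invr_gt0.
have gI : {in s &, injective g}.
  move=> x y xs ys gxy; apply/eqP; apply/negPn/negP => nxy.
  have [j [nj dj]] := top_difference nxy.
  have := congr1 (fun h : {dffun forall j : 'I_n, 'I_(B j).+1} => val (h j)) gxy.
  have lt z : z \in s -> (`|fl z j - lo j| < (B j).+1)%N.
    by move=> /flb-/(_ j)/andP[h1 h2]; rewrite /B; lia.
  rewrite /= !ffunE !inordK ?lt // => e.
  have {}e : fl x j = fl y j.
    by move: (flb x j xs) (flb y j ys) e => /andP[h1 h2] /andP[h3 h4]; lia.
  have /mxOverP/(_ 0 j) := ds x y xs ys; rewrite !mxE => /intrP[z zE].
  move: dj; rewrite zE ratr_int => dj.
  have z0 : z != 0.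
    apply: contraNneq nj => z0; move: zE; rewrite z0 => /eqP.
    by rewrite subr_eq0.
  have : (toR x *m C) 0 j / C j j = (toR y *m C) 0 j / C j j + z%:~R.
    apply: (mulIf (lt0r_neq0 (pC j))).
    by rewrite mulrDl !divfK ?lt0r_neq0 // -dj addrC subrK.
  move=> /(congr1 Num.floor); rewrite -/(fl x j) floorDrz ?intr_int //.
  rewrite -/(fl y j) e intrKfloor => /eqP.
  by rewrite -[X in X == _]addr0 (inj_eq (addrI _)) eq_sym (negPf z0).
have : (size s <= #|{dffun forall j : 'I_n, 'I_(B j).+1}|)%N.
  rewrite -(size_map g) cardE; apply: uniq_leq_size; first by rewrite map_inj_in_uniq.
  by move=> z _; rewrite mem_enum.
rewrite card_dep_ffun foldrE big_map big_enum /= -(ler_nat R) => /le_trans -> //.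
rewrite natr_prod; apply: ler_prod => j _; rewrite ler0n /= card_ord.
(* With [rho = r / C j j] at least 1, the number of floors is at most [2 rho + 2], hence at most
   [4 rho]; this is the origin of the factor 4. *)
have rho1 : 1 <= r / C j j by rewrite ler_pdivlMr ?mul1r.
have h1 := floor_le (r / C j j).
have := floorD1_gt (- r / C j j); rewrite -/(lo j) intrD mulNr => h2.
have -> : ((B j).+1%:R : R) = (Num.floor (r / C j j))%:~R - (lo j)%:~R + 1.
  rewrite -natr1 -intrB; congr (_ + _).
  have -> : Num.floor (r / C j j) - lo j = (B j)%:Z; last by [].
  rewrite gez0_abs // subr_ge0; apply: le_floor.
  by rewrite mulNr; lra.
by rewrite -mulrA; lra.
Qed.

(** A box with sides [C j j] is a fundamental domain. Coordinates are adjusted from the last to the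
    first, since adding a multiple of row [j] of [C] leaves the later ones alone. *)
Lemma coset_point (u : 'rV[rat]_n) (w : 'I_n -> R) :
  exists x : 'rV[rat]_n, x - u \is a mxOver Num.int /\
    forall j, w j <= (toR x *m C) 0 j < w j + C j j.
Proof.
suff H m : (m <= n)%N -> exists x : 'rV[rat]_n, x - u \is a mxOver Num.int /\
    forall j : 'I_n, (n - m <= j)%N -> w j <= (toR x *m C) 0 j < w j + C j j.
  have [x [hx1 hx2]] := H n (leqnn n).
  by exists x; split=> // j; apply: hx2; rewrite subnn.
elim: m => [|m IH] lem.
  exists u; rewrite subrr; split=> [|j]; first exact: intmx0.
  by rewrite subn0 leqNgt ltn_ord.
have [x [hx1 hx2]] := IH (ltnW lem).
have lt : (n - m.+1 < n)%N by lia.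
pose j0 := Ordinal lt.
pose q := ((w j0 - (toR x *m C) 0 j0) / C j0 j0).
pose z := - Num.floor (- q).
have xE j : (toR (x + z%:~R *: delta_mx 0 j0) *m C) 0 j =
    (toR x *m C) 0 j + z%:~R * C j0 j.
  have -> : toR (x + z%:~R *: delta_mx 0 j0) = toR x + z%:~R *: delta_mx 0 j0.
    by apply/rowP => i; rewrite !mxE rmorphD rmorphM /= ratr_int rmorph_nat.
  by rewrite mulmxDl -scalemxAl -rowE mxE; congr (_ + _); rewrite !mxE.
exists (x + z%:~R *: delta_mx 0 j0); split.
  rewrite addrAC; apply: intmxD => //; apply/mxOverP => a b; rewrite !mxE.
  by case: (_ && _); rewrite ?mulr1 ?mulr0 // intr_int.
move=> j jge; rewrite xE; have [->|nj] := eqVneq j j0.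
  have h1 := floor_le (- q); have := floorD1_gt (- q); rewrite intrD => h2.
  have p0 := pC j0.
  have -> : w j0 = (toR x *m C) 0 j0 + q * C j0 j0.
    by rewrite divfK ?lt0r_neq0 // addrC subrK.
  have zE : z%:~R = - (Num.floor (- q))%:~R :> R by rewrite /z rmorphN.
  have h3 : q * C j0 j0 <= z%:~R * C j0 j0 by rewrite ler_pM2r // zE; lra.
  have h4 : z%:~R * C j0 j0 < (q + 1) * C j0 j0 by rewrite ltr_pM2r // zE; lra.
  by apply/andP; split; lra.
have lj : (j0 < j)%N.
  by rewrite ltn_neqAle jge andbT; apply: contraNneq nj => e; apply/eqP/val_inj.
rewrite (is_trig_mxP tC) // mulr0 addr0; apply: hx2.
by move: lj => /=; lia.
Qed.

End TriangularLattice.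

(** Taken at [y = 1 / (2 m)], it bounds [(1 + y) ^+ m] by 2, the total loss from rounding in [m]
    directions. *)
Lemma one_add_pow_le (R : realFieldType) (y : R) m : 0 <= y ->
  (1 + y) ^+ m * (1 - m%:R * y) <= 1.
Proof.
move=> y0; elim: m => [|m IH]; first by rewrite expr0 mul0r subr0 mulr1.
apply: le_trans IH; rewrite exprSr -mulrA ler_wpM2l ?exprn_ge0 ?addr_ge0 //.
rewrite -natr1; have : 0 <= m%:R * y * y by rewrite !mulr_ge0.
by nra.
Qed.

Lemma pigeonhole (T D : finType) (g : T -> D) : (0 < #|T|)%N ->
  exists d, (#|T| <= #|[set t | g t == d]| * #|D|)%N.
Proof.
case/card_gt0P => t0 _.
have D0 : (0 < #|D|)%N by apply/card_gt0P; exists (g t0).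
have [d dE] := bigop.eq_bigmax (fun d : D => #|[set t | g t == d]|) D0.
exists d; rewrite -dE -sum1_card (partition_big g xpredT) //= mulnC.
rewrite -sum_nat_const; apply: leq_sum => e _.
by rewrite sum1dep_card; apply: leq_bigmax.
Qed.

Section ManyPoints.
Variables (R : realType) (n k : nat) (C : 'M[R]_n) (u : 'I_k -> 'rV[rat]_n).
Hypotheses (tC : is_trig_mx C) (pC : forall i, 0 < C i i).
Hypothesis uI : forall a b, u a - u b \is a mxOver Num.int -> a = b.
Notation toR := (map_mx (ratr : rat -> R)).

(** Blichfeldt's argument made discrete. A box of [N] cells in each direction contains a point of
    each of the [k] cosets in every cell; once it is cut into cubes of side [sg], some cube holds at
    least the average number of them, and subtracting one of these brings the others near 0. *)
Lemma many_points (L : 'rV[rat]_n -> Prop) (sg : R) :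
  (forall x y, L x -> L y -> L (x - y)) -> (forall a, L (u a)) ->
  (forall x, x \is a mxOver Num.int -> L x) -> (0 < n)%N -> (0 < k)%N -> 0 < sg ->
  exists s : seq 'rV[rat]_n, [/\ uniq s, (forall x, x \in s -> L x),
    (forall x j, x \in s -> `|(toR x *m C) 0 j| <= sg) &
    k%:R * sg ^+ n / \prod_j C j j <= 2 * (size s)%:R].
Proof.
move=> LB Lu LZ n0 k0 sg0.
have LD x y : L x -> L y -> L (x + y).
  move=> Lx Ly; rewrite -[y]opprK; apply: (LB) => //; rewrite -sub0r.
  by apply: (LB) => //; apply: LZ; apply: intmx0.
(* [N] is large enough for the rounding of the number of cubes along an axis to cost at most a
   factor [1 + 1 / (2 n)]. *)
have [N N0 Nbig] : exists2 N : nat, (0 < N)%N &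
    forall j, N%:R^-1 <= C j j / sg / (2 * n%:R).
  pose M := \sum_j (C j j / sg / (2 * n%:R))^-1.
  exists (Num.truncn M).+1 => // j.
  have p0 i : 0 < C i i / sg / (2 * n%:R).
    by rewrite !divr_gt0 ?mulr_gt0 ?ltr0n.
  rewrite -[leRHS]invrK lef_pV2 ?posrE ?invr_gt0 ?p0 ?ltr0n //.
  apply: le_trans (ltW (truncnS_gt M)); rewrite /M (bigD1 j) //= lerDl.
  by apply: sumr_ge0 => i _; rewrite invr_ge0 ltW.
pose T := ('I_k * {ffun 'I_n -> 'I_N})%type.
have /choice[P Pprop] (t : T) : exists x : 'rV[rat]_n, x - u t.1 \is a mxOver Num.int /\
    forall j, (t.2 j)%:R * C j j <= (toR x *m C) 0 j < ((t.2 j)%:R + 1) * C j j.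
  have [x [h1 h2]] := coset_point tC pC (u t.1) (fun j => (t.2 j)%:R * C j j).
  by exists x; split=> // j; rewrite mulrDl mul1r.
have Pfl t j : Num.truncn ((toR (P t) *m C) 0 j / C j j) = t.2 j.
  have [_ /(_ j)/andP[h1 h2]] := Pprop t.
  by apply: truncn_def; rewrite ler_pdivlMr // ltr_pdivrMr // -natr1 h1.
have PI : injective P.
  move=> t t' tt; have e2 : t.2 = t'.2.
    by apply/ffunP => j; apply: val_inj; rewrite /= -!Pfl tt.
  have e1 : t.1 = t'.1.
    apply: uI; have -> : u t.1 - u t'.1 = (P t' - u t'.1) - (P t - u t.1).
      by rewrite tt opprB [RHS]addrC addrA subrK.
    by apply: intmxB; case: (Pprop t) (Pprop t') => ? _ [? _].
  by case: t t' e1 e2 {tt} => [? ?] [? ?] /= -> ->.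
pose K j := (Num.truncn (N%:R * C j j / sg)).+1.
pose g (t : T) : {dffun forall j : 'I_n, 'I_(K j)} :=
  [ffun j => inord (Num.truncn ((toR (P t) *m C) 0 j / sg))].
have T0 : (0 < #|{: T}|)%N.
  by rewrite card_prod card_ffun !card_ord muln_gt0 k0 expn_gt0 N0.
have [d dP] := pigeonhole g T0.
have [t0 t0P] : exists t0, t0 \in [set t | g t == d].
  apply/set0Pn; apply: contraTneq dP => ->.
  by rewrite cards0 mul0n leqNgt T0.
exists [seq P t - P t0 | t in [set t | g t == d]]; split.
- by rewrite map_inj_uniq ?enum_uniq // => x y /addIr/PI.
- move=> x /fintype.imageP[t _ ->]; have LP t' : L (P t').
    rewrite -[P t'](subrK (u t'.1)); apply: LD => //.
    by apply: LZ; case: (Pprop t').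
  exact: LB.
- move=> x j /fintype.imageP[t tP ->].
  have tlt t' : 0 <= (toR (P t') *m C) 0 j / sg < (K j)%:R.
    have [_ /(_ j)/andP[h1 h2]] := Pprop t'; apply/andP; split.
      rewrite divr_ge0 ?(ltW sg0) //; apply: le_trans h1.
      by rewrite mulr_ge0 // ltW.
    apply: le_lt_trans (truncnS_gt _); rewrite ler_pM2r ?invr_gt0 //.
    apply: le_trans (ltW h2) _; rewrite ler_pM2r // natr1 ler_nat.
    exact: ltn_ord.
  have fe : Num.truncn ((toR (P t) *m C) 0 j / sg) =
            Num.truncn ((toR (P t0) *m C) 0 j / sg).
    have gE t' : t' \in [set t | g t == d] ->
        Num.truncn ((toR (P t') *m C) 0 j / sg) = d j.
      rewrite inE => /eqP <-; rewrite ffunE inordK //.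
      have /andP[h1 h2] := tlt t'.
      by rewrite truncn_lt_nat.
    by rewrite !gE.
  have /andP[a1 _] := tlt t; have /andP[b1 _] := tlt t0.
  have /andP[a2 _] := truncn_itv a1; have /andP[b2 _] := truncn_itv b1.
  have a3 := truncnS_gt ((toR (P t) *m C) 0 j / sg).
  have b3 := truncnS_gt ((toR (P t0) *m C) 0 j / sg).
  rewrite raddfB /= mulmxBl mxE [X in _ + X]mxE -(ler_pM2r (x := sg^-1)) ?invr_gt0 //.
  rewrite divff ?lt0r_neq0 // -[sg^-1 in leLHS]ger0_norm ?invr_ge0 ?ltW //.
  rewrite -normrM mulrBl.
  move: a2 a3 b2 b3; rewrite -!natr1 fe => *.
  by rewrite ltr_norml; apply/andP; split; lra.
rewrite size_map -cardE.
set F := #|_| in dP *.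
have prodC0 : 0 < \prod_j C j j by apply: prodr_gt0.
have Nn0 : 0 < (N%:R : R) ^+ n by rewrite exprn_gt0 ?ltr0n.
move: dP; rewrite card_prod card_ffun !card_ord card_dep_ffun foldrE big_map big_enum /=.
rewrite -(ler_nat R) !natrM natrX natr_prod => dP.
have KE : \prod_(i < n) (#|'I_(K i)|%:R : R) <=
    N%:R ^+ n * (\prod_j C j j / sg ^+ n) * (1 + (2 * n%:R)^-1) ^+ n.
  have cst (c : R) : c ^+ n = \prod_(j < n) c by rewrite prodr_const card_ord.
  rewrite !cst -prodf_div -!big_split /=; apply: ler_prod => j _.
  rewrite ler0n card_ord /= /K -natr1.
  apply: le_trans (_ : N%:R * C j j / sg + 1 <= _).
    by rewrite lerD2r truncn_le divr_ge0 ?mulr_ge0 ?(ltW (pC j)) ?(ltW sg0).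
  rewrite mulrDr mulr1 mulrA lerD2l.
  have := Nbig j; rewrite -(ler_pM2l (x := N%:R)) ?ltr0n // divff ?pnatr_eq0 -?lt0n //.
  by move=> /le_trans; apply; rewrite !mulrA.
have F0 : 0 <= (F%:R : R) by [].
have := ler_wpM2l F0 KE => /(le_trans dP).
have := @one_add_pow_le R (2 * n%:R)^-1 n; rewrite invr_ge0 mulr_ge0 // => /(_ isT).
have -> : 1 - n%:R * (2 * n%:R)^-1 = 2^-1 :> R.
  by field; rewrite pnatr_eq0 -lt0n.
set X := (1 + _) ^+ n; set Pi := \prod_j C j j => hX.
rewrite [X in _ <= X -> _](_ : _ = N%:R ^+ n * (F%:R * (Pi / sg ^+ n) * X)); last by ring.
rewrite mulrC ler_pM2l // => h.
have sgn : 0 < sg ^+ n by rewrite exprn_gt0.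
have h2 : F%:R * (Pi / sg ^+ n) * X <= F%:R * (Pi / sg ^+ n) * 2.
  by apply: ler_wpM2l; [rewrite mulr_ge0 // divr_ge0 // ltW | lra].
rewrite ler_pdivrMr // -ler_pdivlMr //; apply: le_trans (le_trans h h2) _.
by rewrite [leLHS](_ : _ = 2 * F%:R * Pi / sg ^+ n) //; ring.
Qed.

End ManyPoints.

Lemma intmx_row m n (A : 'M[rat]_(m, n)) i :
  A \is a mxOver Num.int -> row i A \is a mxOver Num.int.
Proof. by move=> /mxOverP hA; apply/mxOverP => a b; rewrite mxE. Qed.

Lemma det_int n (A : 'M[rat]_n) : A \is a mxOver Num.int -> \det A \is a Num.int.
Proof.
move=> /mxOverP hA; apply: rpred_sum => s _.
by rewrite rpredM ?rpredX ?rpredN // rpred_prod.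
Qed.

Lemma norm_int_ge1 (x : rat) : x \is a Num.int -> x != 0 -> 1 <= `|x|.
Proof.
case/intrP => z ->; rewrite intr_eq0 => z0.
by rewrite -intr_norm ler1z; case: z z0 => [[|m]|m].
Qed.

Section Subgroup.
Variables (E : zmodType) (L : E -> Prop).
Hypotheses (L0 : L 0) (LB : forall x y, L x -> L y -> L (x - y)).

Lemma subgroupN x : L x -> L (- x).
Proof. by move=> Lx; rewrite -sub0r; apply: (LB). Qed.

Lemma subgroupD x y : L x -> L y -> L (x + y).
Proof. by move=> Lx Ly; rewrite -[y]opprK; apply: (LB) => //; apply: subgroupN. Qed.

Lemma subgroup_sum I (r : seq I) (P : pred I) (F : I -> E) :
  (forall i, P i -> L (F i)) -> L (\sum_(i <- r | P i) F i).
Proof. by move=> h; apply: big_ind => //; apply: subgroupD. Qed.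

Lemma subgroupMz x (z : int) : L x -> L (x *~ z).
Proof.
move=> Lx; have Mn m : L (x *+ m).
  by elim: m => [|m IH]; rewrite ?mulr0n // mulrS; apply: subgroupD.
by case: z => m; rewrite ?NegzE ?mulrNz; [|apply: subgroupN]; apply: Mn.
Qed.

End Subgroup.

Lemma subgroup_comb m n (L : 'rV[rat]_n -> Prop) (g : 'M[rat]_(m, n)) z :
  L 0 -> (forall x y, L x -> L y -> L (x - y)) -> (forall i, L (row i g)) ->
  z \is a mxOver Num.int -> L (z *m g).
Proof.
move=> L0 LB Lg /mxOverP hz; rewrite mulmx_sum_row.
apply: subgroup_sum => // i _; have /intrP[t ->] := hz 0 i.
by rewrite scaler_int; apply: subgroupMz.
Qed.

(* For independent g_i in L, the sublattice of their integer combinations that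
   are integral has a triangular basis whose determinant is its index. *)
Lemma det_index n k (L : 'rV[rat]_n -> Prop) (h : 'rV[rat]_n -> 'I_k)
    (g : 'M[rat]_n) :
  L 0 -> (forall x y, L x -> L y -> L (x - y)) ->
  (forall x y, L x -> L y -> h x = h y -> x - y \is a mxOver Num.int) ->
  (forall i, L (row i g)) -> \det g != 0 -> 1 <= k%:R * `|\det g|.
Proof.
move=> L0 LB hL Lg dg.
have Lc z : z \is a mxOver Num.int -> L (z *m g) by exact: subgroup_comb.
(* [c] is the leading coefficient, at index [i], of a combination with integral value. One exists
   because two of [k + 1] multiples of the [i]-th row of [g] fall in the same class. *)
pose P i (c : nat) (z : 'rV[rat]_n) := [/\ (0 < c)%N, z \is a mxOver Num.int,
  z 0 i = c%:R, forall j : 'I_n, (i < j)%N -> z 0 j = 0 &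
  z *m g \is a mxOver Num.int].
have exP i : exists c, `[< exists z, P i c z >].
  pose f (t : 'I_k.+1) := h (t%:R *: delta_mx 0 i *m g).
  have dI (t : nat) : (t%:R *: delta_mx 0 i : 'rV[rat]_n) \is a mxOver Num.int.
    apply/mxOverP => a b; rewrite !mxE rpredM ?rpred_nat //.
  have /injectivePn[t [t' ntt ftt]] : ~~ injectiveb f.
    by apply/negP => /injectiveP/leq_card; rewrite !card_ord ltnn.
  wlog lt : t t' ntt ftt / (t < t')%N.
    move=> H; case: (ltngtP t t') => [lt|lt|/val_inj e].
    - exact: (H t t').
    - by apply: (H t' t) => //; rewrite eq_sym.
    - by rewrite e eqxx in ntt.
  exists (t' - t)%N; apply/asboolP; exists ((t' - t)%:R *: delta_mx 0 i); split.
  - by rewrite subn_gt0.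
  - exact: dI.
  - by rewrite !mxE !eqxx mulr1.
  - move=> j ij; rewrite !mxE eqxx /= [j == i](_ : _ = false) ?mulr0 //.
    by apply/eqP => e; rewrite e ltnn in ij.
  rewrite natrB ?(ltnW lt) // scalerBl mulmxBl.
  by apply: hL => //; apply: Lc.
pose c i := ex_minn (exP i).
have cP i : exists z, P i (c i) z.
  by rewrite /c; case: ex_minnP => m /asboolP.
have cmin i m z : P i m z -> (c i <= m)%N.
  move=> h1; rewrite /c; case: ex_minnP => m' _; apply.
  by apply/asboolP; exists z.
have /choice[z zP] := cP.
have c0 i : (0 < c i)%N by case: (zP i).
(* Two such combinations in the same class would differ by one whose leading coefficient is below
   the minimal [c j]. So they occupy distinct classes, and the product of the [c i] is at most
   [k]. *)
pose q (e : {dffun forall i : 'I_n, 'I_(c i)}) : 'rV[rat]_n := \row_i (e i)%:R.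
have qint e : q e \is a mxOver Num.int.
  by apply/mxOverP => a b; rewrite mxE rpred_nat.
pose f e := h (q e *m g).
have fI : injective f.
  move=> e e' fee; apply/eqP; apply/negPn/negP => nee.
  have [i0 i0P] : exists i, e i != e' i.
    apply/existsP; apply: contraNT nee; rewrite negb_exists => /forallP hh.
    by apply/eqP/ffunP => i; apply/eqP; have := hh i; rewrite negbK.
  case: (@arg_maxnP _ i0 (fun i => e i != e' i) (fun i : 'I_n => val i) i0P) => j jP jmax.
  wlog lt : e e' fee nee i0P jP jmax / (e' j < e j)%N.
    move=> H; case: (ltngtP (e' j) (e j)) => [lt|lt|ee].
    - exact: (H e e').
    - apply: (H e' e) => //; rewrite 1?eq_sym // => i; rewrite eq_sym; exact: jmax.
    - by move/eqP: jP; apply; apply: val_inj.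
  have : P j (e j - e' j)%N (q e - q e').
    split.
    - by rewrite subn_gt0.
    - exact: intmxB.
    - by rewrite !mxE natrB // ltnW.
    - move=> i ij; rewrite !mxE; have [->|] := eqVneq (e i) (e' i).
        by rewrite subrr.
      by move=> /jmax; rewrite /geq /= leqNgt ij.
    - by rewrite mulmxBl; apply: hL => //; apply: Lc.
  move/cmin; have := ltn_ord (e j); lia.
have prodc : (\prod_i c i <= k)%N.
  have := leq_card f fI; rewrite card_ord card_dep_ffun foldrE big_map big_enum.
  by under eq_bigr do rewrite card_ord.
pose A := \matrix_(i, j) z i 0 j.
have rowA i : row i A = z i by apply/rowP => j; rewrite !mxE.
have tA : is_trig_mx A.
  by apply/is_trig_mxP => i j ij; rewrite mxE; case: (zP i) => _ _ _ ->.
have dA : \det A = (\prod_i c i)%:R.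
  rewrite det_trig // natr_prod; apply: eq_bigr => i _.
  by rewrite mxE; case: (zP i).
have Agint : A *m g \is a mxOver Num.int.
  apply/mxOverP => i j; have -> : (A *m g) i j = (z i *m g) 0 j.
    by rewrite -rowA -row_mul [RHS]mxE.
  by case: (zP i) => _ _ _ _ /mxOverP.
have := norm_int_ge1 (det_int Agint).
rewrite det_mulmx mulf_neq0 // ?dA ?pnatr_eq0 -?lt0n ?prodn_gt0 // => /(_ isT) h1.
apply: le_trans h1 _; rewrite normrM normr_nat ler_wpM2r //.
by rewrite ler_nat.
Qed.

Lemma common_denominator m n (S : 'M[rat]_(m, n)) :
  exists2 N : nat, (0 < N)%N & N%:R *: S \is a mxOver Num.int.
Proof.
exists (\prod_i \prod_j `|denq (S i j)|%N)%N.
  by apply: prodn_gt0 => i; apply: prodn_gt0 => j; rewrite absz_gt0 denq_neq0.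
apply/mxOverP => i j; rewrite mxE (bigD1 i) // (bigD1 j) //= -!mulnA natrM.
have E : `|denq (S i j)|%N%:R * S i j \is a Num.int.
  have -> : (`|denq (S i j)|%N%:R : rat) = (denq (S i j))%:~R.
    by rewrite -[in RHS](absz_denq (S i j)).
  by rewrite mulrC -numqE intr_int.
by rewrite mulrAC; apply: (rpredM E); rewrite rpred_nat.
Qed.

(** After clearing denominators, the Smith normal form gives an independent basis of the integer
    span of the rows; [U] and [V] certify the two inclusions. *)
Lemma zspan_basis p n (S : 'M[rat]_(p, n)) :
  exists r (g : 'M[rat]_(r, n)) (U : 'M[rat]_(p, r)) (V : 'M[rat]_(r, p)),
    [/\ U \is a mxOver Num.int, V \is a mxOver Num.int, S = U *m g,
        g = V *m S & row_free g].
Proof.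
have [N N0 /intmxP[Z ZE]] := common_denominator S.
have N0' : N%:R != 0 :> rat by rewrite pnatr_eq0 -lt0n.
have SE : S = N%:R^-1 *: map_mx intr Z by rewrite -ZE scalerA mulVf // scale1r.
have [L uL [Q uQ [d sd Zd]]] := int_Smith_normal_form Z.
pose D : 'M[int]_(p, n) := \matrix_(i, j) (d`_i *+ (i == j :> nat)).
(* The invariant factors divide one another in order, so those after the first zero all vanish and
   [r] is the rank. *)
pose r := minn (find (pred1 (0 : int)) d) (minn p n).
have rp : (r <= p)%N by rewrite /r; lia.
have rn : (r <= n)%N by rewrite /r; lia.
have d0 i : (i < r)%N -> d`_i != 0.
  rewrite /r leq_min => /andP[h _]; exact: negbT (before_find 0 h).
have d1 i : (r <= i)%N -> (i < p)%N -> (i < n)%N -> d`_i = 0.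
  move=> ri ip ii; have {}ri : (find (pred1 (0 : int)) d <= i)%N by move: ri; rewrite /r; lia.
  have [si|si] := ltnP i (size d); last by rewrite nth_default.
  have fs : (find (pred1 (0 : int)) d < size d)%N by apply: leq_ltn_trans si.
  have /eqP f0 : pred1 (0 : int) d`_(find (pred1 (0 : int)) d) by apply: nth_find; rewrite has_find.
  have := sorted_leq_nth dvdz_trans dvdzz 0 sd _ _ fs si ri.
  by rewrite f0 dvd0z => /eqP.
pose E : 'M[int]_(p, r) := \matrix_(i, j) (i == j :> nat)%:R.
pose G : 'M[int]_(r, n) := \matrix_(i, j) (d`_i * Q (widen_ord rn i) j).
have DQ : D *m Q = E *m G.
  apply/matrixP => a j; rewrite !mxE.
  have [ar|ra] := ltnP a r.
    rewrite (bigD1 (Ordinal (leq_trans ar rn))) //= big1 ?addr0; last first.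
      move=> b; rewrite -val_eqE /= mxE eq_sym => /negPf ->.
      by rewrite mulr0n mul0r.
    rewrite (bigD1 (Ordinal ar)) //= big1 ?addr0; last first.
      move=> b; rewrite -val_eqE /= mxE eq_sym => /negPf ->.
      by rewrite mul0r.
    rewrite !mxE !eqxx mul1r mulr1n; congr (_ * Q _ _); exact: val_inj.
  rewrite !big1 // => b _; rewrite !mxE.
    by rewrite (gtn_eqF (leq_trans (ltn_ord b) ra)) mul0r.
  case: eqP => [e|_]; last by rewrite mulr0n mul0r.
  by rewrite d1 // ?mul0rn ?mul0r // e.
have EE : E^T *m E = 1%:M.
  apply/matrixP => a b; rewrite !mxE (bigD1 (widen_ord rp a)) //= big1 ?addr0.
    by rewrite !mxE eqxx mul1r.
  by move=> i; rewrite -val_eqE !mxE /= => /negPf ->; rewrite mul0r.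
have ZG : Z = L *m E *m G by rewrite -mulmxA -DQ mulmxA.
have GZ : G = E^T *m invmx L *m Z.
  by rewrite ZG !mulmxA -[X in X *m E *m G]mulmxA mulVmx // mulmx1 EE mul1mx.
exists r, (N%:R^-1 *: map_mx intr G), (map_mx intr (L *m E)),
  (map_mx intr (E^T *m invmx L)); split.
- exact: intmx_map.
- exact: intmx_map.
- by rewrite -scalemxAr -map_mxM -ZG.
- by rewrite SE -scalemxAr -map_mxM -GZ.
apply/row_freeP.
exists (N%:R *: (map_mx intr (invmx Q) *m
  \matrix_(b < n, i < r) ((b == i :> nat)%:R / (d`_i)%:~R))).
rewrite -scalemxAl -scalemxAr scalerA mulVf // scale1r mulmxA -map_mxM.
have -> : G *m invmx Q = \matrix_(i < r, b < n) (d`_i *+ (b == i :> nat)).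
  have -> : G = (\matrix_(i < r, b < n) (d`_i *+ (b == i :> nat))) *m Q.
    apply/matrixP => i j; rewrite !mxE (bigD1 (widen_ord rn i)) //= big1 ?addr0.
      by rewrite !mxE eqxx mulr1n.
    by move=> b; rewrite -val_eqE !mxE /= => /negPf ->; rewrite mulr0n mul0r.
  by rewrite -mulmxA mulmxV // mulmx1.
apply/matrixP => i j; rewrite !mxE (bigD1 (widen_ord rn i)) //= big1 ?addr0.
  rewrite !mxE eqxx mulr1n /= mulrCA; case: eqP => [e|ne].
    have {}e : i = j by apply: val_inj.
    by rewrite e eqxx mulfV ?intr_eq0 ?d0 // mulr1.
  by rewrite mul0r; case: eqP => // e; case: ne; rewrite e.
by move=> b; rewrite -val_eqE !mxE /= => /negPf ->; rewrite mulr0n mul0r.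
Qed.

(** In the coordinates given by the Smith normal form the row lattice of [A] is the product of the
    ideals generated by the [d_i], so the residues of the coordinates label its cosets. *)
Lemma coset_class n (A : 'M[rat]_n) : A \is a mxOver Num.int -> \det A != 0 ->
  exists (T : finType) (h : 'rV[rat]_n -> T), #|T|%:R = `|\det A| /\
    forall x y, x \is a mxOver Num.int -> y \is a mxOver Num.int -> h x = h y ->
      exists2 z, z \is a mxOver Num.int & x - y = z *m A.
Proof.
move=> /intmxP[Z ->{A}]; rewrite det_map_mx intr_eq0 => dZ.
have [L uL [Q uQ [d _ Zd]]] := int_Smith_normal_form Z.
pose D : 'M[int]_n := \matrix_(i, j) (d`_i *+ (i == j :> nat)).
have DE : D = diag_mx (\row_i d`_i) by apply/matrixP => i j; rewrite !mxE.
have absdet (M : 'M[int]_n) : M \in unitmx -> `|\det M| = 1 :> int.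
  move=> uM; have : \det M * \det (invmx M) = 1 by rewrite -det_mulmx mulmxV // det1.
  move/(congr1 absz); rewrite abszM => /eqP; rewrite muln_eq1 => /andP[/eqP h _].
  by rewrite -abszE h.
have detD : `|\det Z| = \prod_(i < n) `|d`_i|.
  rewrite Zd !det_mulmx !normrM (absdet L) // (absdet Q) // mul1r mulr1 -/D DE det_diag normr_prod.
  by apply: eq_bigr => i _; rewrite mxE.
have d0 (i : 'I_n) : d`_i != 0.
  move: dZ; rewrite -normr_eq0 detD prodf_seq_neq0 => /allP/(_ i).
  by rewrite mem_index_enum /= normr_eq0 => /(_ isT).
pose T := {dffun forall i : 'I_n, 'I_(`|d`_i|.-1.+1)}.
pose fl (x : 'rV[rat]_n) := map_mx Num.floor x *m invmx Q.
pose hh (x : 'rV[rat]_n) : T := [ffun i : 'I_n => inord `|(fl x ord0 i %% d`_i)%Z|].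
exists T, hh; split.
  rewrite -intr_norm detD card_dep_ffun foldrE big_map big_enum /= natr_prod.
  rewrite rmorph_prod; apply: eq_bigr => i _; rewrite card_ord prednK ?absz_gt0 //.
move=> _ _ /intmxP[x ->] /intmxP[y ->] /ffunP hxy.
have flE (v : 'rV[int]_n) : map_mx Num.floor (map_mx (intr : int -> rat) v) = v.
  by apply/rowP => i; rewrite !mxE intrKfloor.
have dv (i : 'I_n) : (d`_i %| ((x - y) *m invmx Q)%R ord0 i)%Z.
  have := congr1 val (hxy i); rewrite /= !ffunE.
  have lt (v : int) : (`|(v %% (d`_i)%R)%Z| < `|(d`_i)%R|.-1.+1)%N.
    rewrite prednK ?absz_gt0 //; have := ltz_mod v (d0 i).
    have := modz_ge0 v (d0 i); lia.
  have -> : ((x - y) *m invmx Q) ord0 i =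
      (x *m invmx Q) ord0 i - (y *m invmx Q) ord0 i by rewrite mulmxBl !mxE.
  rewrite !inordK ?lt // /fl !flE => e.
  rewrite -eqz_mod_dvd; apply/eqP.
  by move: e (modz_ge0 ((x *m invmx Q) 0 i) (d0 i)) (modz_ge0 ((y *m invmx Q) 0 i) (d0 i)); lia.
exists (map_mx intr ((\row_i ((((x - y) *m invmx Q)%R ord0 i) %/ d`_i)%Z) *m invmx L)).
  exact: intmx_map.
rewrite -map_mxM -map_mxB; congr (map_mx _ _).
rewrite Zd -/D !mulmxA -[_ *m invmx L *m L]mulmxA mulVmx // mulmx1.
have -> : \row_i ((((x - y) *m invmx Q)%R ord0 i) %/ d`_i)%Z *m D = (x - y) *m invmx Q.
  by apply/rowP => i; rewrite DE mul_mx_diag [LHS]mxE [X in X * _]mxE [X in _ * X]mxE divzK.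
by rewrite -mulmxA mulVmx // mulmx1.
Qed.

Section UpperCount.
Variables (R : realType) (n k : nat) (C : 'M[R]_n).
Hypotheses (tC : is_trig_mx C) (pC : forall i, 0 < C i i).
Variables (L : 'rV[rat]_n -> Prop) (h : 'rV[rat]_n -> 'I_k).
Hypotheses (L0 : L 0) (LB : forall x y, L x -> L y -> L (x - y)).
Hypothesis (hL : forall x y, L x -> L y -> h x = h y ->
  x - y \is a mxOver Num.int).
Notation toR := (map_mx (ratr : rat -> R)).

Variable s : seq 'rV[rat]_n.
Hypotheses (us : uniq s) (Ls : forall x, x \in s -> L x).
Let S : 'M[rat]_(size s, n) := \matrix_(i, j) (tnth (in_tuple s) i) 0 j.

Lemma row_seqmx i : row i S = tnth (in_tuple s) i.
Proof. by apply/rowP => j; rewrite !mxE. Qed.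

Lemma seqmx_mem i : row i S \in s.
Proof. by rewrite row_seqmx mem_tnth. Qed.

Lemma seqmx_row_inj i j : row i S = row j S -> i = j.
Proof.
rewrite !row_seqmx => e; apply/val_inj/eqP.
rewrite -(nth_uniq 0 (ltn_ord i) (ltn_ord j) us).
by rewrite -!(tnth_nth _ (in_tuple s)) e.
Qed.

(** The points have integral coordinates in a basis of their own integer span, of rank below [n].
    Equal coordinates modulo [m] make two points differ by [m] times an element of [L], which the
    last hypothesis forces to vanish. *)
Lemma deficient_count (m : nat) : (0 < m)%N -> (0 < n)%N -> (\rank S < n)%N ->
  (forall x y z, x \in s -> y \in s -> L z -> x - y = m%:R *: z -> z = 0) ->
  (size s <= m ^ n.-1)%N.
Proof.
move=> m0 n0 rk sep; have [r [g [U [V [Ui Vi SE gE fg]]]]] := zspan_basis S.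
have rE : \rank S = r.
  apply/eqP; rewrite eqn_leq; apply/andP; split.
    by rewrite SE; apply: leq_trans (mulmx_max_rank _ _) _.
  by move: fg; rewrite /row_free => /eqP <-; rewrite {1}gE mxrankM_maxr.
have Lg z : z \is a mxOver Num.int -> L (z *m g).
  move=> zi; rewrite gE mulmxA; apply: subgroup_comb => //.
    by move=> i; apply/Ls/seqmx_mem.
  exact: intmxM.
pose f (i : 'I_(size s)) : {ffun 'I_r -> 'I_m.-1.+1} :=
  [ffun j => inord `|(Num.floor (U i j) %% m%:Z)%Z|].
have fI : injective f.
  move=> i i' fe; apply: seqmx_row_inj; apply/eqP; rewrite -subr_eq0.
  pose z : 'rV[rat]_r := m%:R^-1 *: (row i U - row i' U).
  have mq : m%:R != 0 :> rat by rewrite pnatr_eq0 -lt0n.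
  have rowE a : row a S = row a U *m g by rewrite {1}SE row_mul.
  have zi : z \is a mxOver Num.int.
    apply/mxOverP => a b; rewrite !mxE.
    have /mxOverP/(_ i b)/floorK <- := Ui; have /mxOverP/(_ i' b)/floorK <- := Ui.
    have := congr1 val ((ffunP (f i) (f i')).2 fe b); rewrite /= !ffunE.
    have m0' : m%:Z != 0 by rewrite -lt0n.
    have lt (v : int) : (`|(v %% m%:Z)%Z| < m.-1.+1)%N.
      by rewrite prednK //; have := ltz_mod v m0'; have := modz_ge0 v m0'; lia.
    rewrite !inordK ?lt // => e.
    have : (m%:Z %| Num.floor (U i b) - Num.floor (U i' b))%Z.
      rewrite -eqz_mod_dvd; apply/eqP.
      by move: e (modz_ge0 (Num.floor (U i b)) m0') (modz_ge0 (Num.floor (U i' b)) m0'); lia.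
    move/dvdzP => [q qE]; rewrite -rmorphB /= qE rmorphM /= mulrCA mulVf //.
    by rewrite mulr1 intr_int.
  have zE : row i S - row i' S = m%:R *: (z *m g).
    by rewrite !rowE -mulmxBl -scalemxAl scalerA mulfV // scale1r.
  by rewrite zE (sep _ _ _ (seqmx_mem i) (seqmx_mem i') (Lg _ zi) zE) scaler0.
have := leq_card f fI; rewrite card_ffun !card_ord prednK // => /leq_trans; apply.
by rewrite leq_pexp2l //; rewrite rE in rk; lia.
Qed.

(** The lattice spanned by [n] independent points of [s] may have large index in the one spanned by
    all of [s], but this index appears both in the number of cosets and in the determinant that
    bounds the points of each, and cancels. *)
Lemma full_count (r : R) : 0 < r -> \rank S = n ->
  (forall x, x \in s -> \sum_j (toR x *m C) 0 j ^+ 2 <= r ^+ 2) ->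
  (size s)%:R <= k%:R * (4 * r) ^+ n / \prod_j C j j.
Proof.
move=> r0 rk bs; have [r' [g [U [V [Ui Vi SE gE fg]]]]] := zspan_basis S.
have rE : r' = n.
  apply/eqP; rewrite -rk eqn_leq; apply/andP; split.
    by move: (fg); rewrite /row_free => /eqP <-; rewrite {1}gE mxrankM_maxr.
  by rewrite SE; apply: leq_trans (mulmx_max_rank _ _) _.
move: g U V Ui Vi SE gE fg; rewrite {}rE => g U V Ui Vi SE gE fg.
have ug : g \in unitmx by rewrite -row_free_unit.
have dg : \det g != 0 by move: ug; rewrite unitmxE unitfE.
have Lg i : L (row i g).
  rewrite gE row_mul; apply: subgroup_comb => //.
    by move=> a; apply/Ls/seqmx_mem.
  exact: intmx_row.
have fS : row_full S by rewrite /row_full rk.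
(* [Y] consists of [n] independent points of [s], and [A] of their coordinates in the basis [g]; the
   cosets of the lattice of [Y] number [|det A|]. *)
pose f := fullrankfun fS.
pose A := rowsub f U; pose Y := rowsub f S.
have YE : Y = A *m g by rewrite /Y SE mul_rowsub_mx.
have Ai : A \is a mxOver Num.int.
  by apply/mxOverP => i j; rewrite mxE; apply/mxOverP.
have uY : Y \in unitmx := fullrowsub_unit fS.
have dY : \det Y != 0 by move: uY; rewrite unitmxE unitfE.
have dA : \det A != 0 by move: dY; rewrite YE det_mulmx mulf_eq0 negb_or => /andP[].
have [T [hc [cT hT]]] := coset_class Ai dA.
have rowY i : row i Y = row (f i) S by rewrite row_rowsub.
pose YC := toR Y *m C.
have toRM p q t (A1 : 'M[rat]_(p, q)) (A2 : 'M[rat]_(q, t)) : toR (A1 *m A2) = toR A1 *m toR A2.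
  exact: map_mxM.
have sumsq (v : 'rV[R]_n) : (v *m v^T) 0 0 = \sum_j v 0 j ^+ 2.
  by rewrite mxE; apply: eq_bigr => j _; rewrite mxE expr2.
have uC : C \in unitmx.
  rewrite unitmxE unitfE det_trig //; apply/prodf_neq0 => i _.
  exact: lt0r_neq0.
have uYC : YC \in unitmx by rewrite unitmx_mul uC andbT map_unitmx.
have [|a a0|CY [tCY pCY] GE] := @cholesky R n (YC *m YC^T).
- by rewrite trmx_mul trmxK.
- rewrite mulmxA -[_ *m _ *m a^T]mulmxA -trmx_mul sumsq.
  rewrite lt_neqAle sumr_ge0 ?andbT => [|j _]; last exact: sqr_ge0.
  rewrite eq_sym psumr_eq0 => [|j _]; last exact: sqr_ge0.
  apply: contraNN a0 => /allP h0; rewrite -(mulmxK uYC a).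
  rewrite [a *m YC](_ : _ = 0) ?mul0mx //; apply/rowP => j; rewrite [RHS]mxE.
  by have := h0 j; rewrite mem_index_enum sqrf_eq0 => /(_ isT)/eqP.
have normCY (t : 'rV[rat]_n) : \sum_j (toR t *m CY) 0 j ^+ 2 =
    \sum_j (toR (t *m Y) *m C) 0 j ^+ 2.
  have qE p (v : 'rV[R]_p) (B : 'M[R]_(p, n)) : v *m B *m (v *m B)^T = v *m (B *m B^T) *m v^T.
    by rewrite trmx_mul !mulmxA.
  have E2 : toR (t *m Y) *m C = toR t *m YC by rewrite toRM mulmxA.
  by rewrite -!sumsq E2 !qE GE.
have sq_le (x r1 : R) : 0 <= r1 -> x ^+ 2 <= r1 ^+ 2 -> `|x| <= r1.
  by move=> r10; rewrite -real_normK ?num_real // ler_sqr ?nnegrE.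
have term_le (v : 'rV[R]_n) j : v 0 j ^+ 2 <= \sum_j v 0 j ^+ 2.
  by rewrite (bigD1 j) //= lerDl sumr_ge0 // => i _; apply: sqr_ge0.
(* The diagonal entry is one orthogonal coordinate of the [j]-th point of [Y], whose length is at
   most [r]. This is why the basis is taken among the points: [coset_count] needs every width to be
   at most [r]. *)
have CYr j : CY j j <= r.
  rewrite -[leLHS]gtr0_norm //; apply: sq_le; first exact: ltW.
  have := bs _ (seqmx_mem (f j)); rewrite -rowY; apply: le_trans.
  rewrite rowE -normCY; apply: le_trans (term_le _ j).
  rewrite (_ : toR (delta_mx 0 j) = delta_mx 0 j) -?rowE ?mxE //.
  by apply/rowP => i; rewrite !mxE rmorph_nat.
have detCY : \prod_j CY j j = `|\det (toR Y)| * \prod_j C j j.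
  have p1 : 0 < \prod_j CY j j by apply: prodr_gt0.
  have p2 : 0 < \prod_j C j j by apply: prodr_gt0.
  apply/eqP; rewrite -(@eqrXn2 _ 2) ?mulr_ge0 ?(ltW p1) ?(ltW p2) //.
  rewrite exprMn real_normK ?num_real // -!det_trig // !expr2.
  rewrite -[X in _ * X == _]det_tr -det_mulmx -GE det_mulmx det_tr det_mulmx.
  by apply/eqP; ring.
pose M : R := \prod_j (4 * r / CY j j).
have MCY : M = (4 * r) ^+ n / \prod_j CY j j.
  by rewrite /M prodf_div prodr_const card_ord.
pose cl (c : T) := [seq x <- s | hc (x *m invmx g) == c].
have xg x : x \in s -> x *m invmx g \is a mxOver Num.int.
  move=> xs; have [i ->] : exists i, x = row i S.
    by have /tnthP[i ->] : x \in in_tuple s by []; exists i; rewrite row_seqmx.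
  by rewrite {1}SE row_mul mulmxK //; apply: intmx_row.
have clM c : (size (cl c))%:R <= M.
  rewrite -(size_map (fun x => x *m invmx Y)).
  apply: (coset_count tCY pCY).
  - rewrite map_inj_uniq ?filter_uniq //; apply: (can_inj (g := fun x => x *m Y)).
    by move=> x; rewrite mulmxKV.
  - move=> _ _ /mapP[x xc ->] /mapP[y yc ->].
    move: xc yc; rewrite !mem_filter => /andP[/eqP hx xs] /andP[/eqP hy ys].
    have [|z zi zE] := hT _ _ (xg x xs) (xg y ys); first by rewrite hx hy.
    rewrite -mulmxBl; have -> : x - y = z *m Y.
      by rewrite YE mulmxA -zE -mulmxBl mulmxKV.
    by rewrite mulmxK.
  - move=> _ j /mapP[x xc ->]; apply: sq_le; first exact: ltW.
    apply: le_trans (term_le _ j) _; rewrite normCY mulmxKV //.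
    by apply: bs; move: xc; rewrite mem_filter => /andP[].
  - exact: CYr.
have sizeE : (size s = \sum_c size (cl c))%N.
  rewrite -sum1_size (partition_big (fun x => hc (x *m invmx g)) xpredT) //=.
  by apply: eq_bigr => c _; rewrite size_filter -sum1_count.
rewrite sizeE natr_sum; apply: le_trans (ler_sum _ (fun c _ => clM c)) _.
rewrite sumr_const MCY detCY -[X in X <= _]mulr_natl.
rewrite (_ : #|xpredT| = #|T|); last exact: eq_card.
have -> : #|T|%:R = `|\det (toR A)|.
  by rewrite det_map_mx -ratr_norm -cT ratr_nat.
rewrite YE toRM det_mulmx normrM.
have dAR : 0 < `|\det (toR A)| by rewrite normr_gt0 det_map_mx fmorph_eq0.
have dgR : 0 < `|\det (toR g)| by rewrite normr_gt0 det_map_mx fmorph_eq0.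
have p2 : 0 < \prod_j C j j by apply: prodr_gt0.
have h1 : 1 <= k%:R * `|\det (toR g)|.
  have := det_index L0 LB hL Lg dg.
  by rewrite -(ler_rat R) rmorphM rmorph1 /= ratr_nat ratr_norm -det_map_mx.
have X0 : 0 <= (4 * r) ^+ n by rewrite exprn_ge0 // mulr_ge0 // ltW.
move: dAR dgR p2 h1 X0; set a := `|\det (toR A)|; set b := `|\det (toR g)|.
set Pi := \prod_j _; set X := _ ^+ n; move=> a0 b0 Pi0 h1 X0.
(* The index [a] cancels, and [det_index] replaces [b^-1] by [k]. *)
have -> : a * (X / (a * b * Pi)) = X / Pi * b^-1 by field; rewrite !lt0r_neq0.
have -> : k%:R * X / Pi = X / Pi * k%:R by rewrite [RHS]mulrC mulrA.
by apply: ler_wpM2l; [rewrite divr_ge0 // ltW | rewrite -[b^-1]mul1r ler_pdivrMr].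
Qed.

End UpperCount.

(** * Embeddings and the discriminant *)

Section Embeddings.
Variables (R : realType) (K : fieldExtType rat).
Local Notation C := R[i].
Local Notation d := (degree K).

(* A nonzero determinant makes the [s k] linearly independent, hence distinct. *)
Definition all_embeddings (s : 'I_d -> {rmorphism K -> C}) : Prop :=
  (exists b : 'I_d -> K, \det (\matrix_(i, k) s k (b i)) != 0) /\
  (forall f : {rmorphism K -> C}, exists k, f =1 s k).

Lemma rmorphism_of (f : K -> C) : f 1 = 1 -> {morph f : x y / x - y} ->
  {morph f : x y / x * y} -> exists g : {rmorphism K -> C}, f =1 g.
Proof.
move=> f1 fB fM.
pose g := HB.pack_for {rmorphism K -> C} f
  (GRing.isZmodMorphism.Build K C f fB)
  (GRing.isMonoidMorphism.Build K C f (conj f1 fM)).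
by exists g.
Qed.

(** The primitive element theorem in characteristic 0, with the minimal polynomial descended to
    [rat] so that it can be mapped into [R[i]]. *)
Lemma primitive_rational_poly : exists (t : K) (p : {poly rat}),
  [/\ p \is monic, size p = d.+1, separable_poly p,
    forall g, (map_poly (in_alg K) g).[t] = 0 <-> p %| g &
    forall x, exists g, x = (map_poly (in_alg K) g).[t]].
Proof.
have sep : separable (1%AS : {subfield K}) fullv.
  apply/separableP => y _; apply: pcharf0_separable.
  by move=> q; rewrite inE /= !inE; apply/negP => /andP[/prime_gt0 q0];
     rewrite -scaler_nat scaler_eq0 oner_eq0 orbF pnatr_eq0 -leqn0 leqNgt q0.
have full := eq_adjoin_separable_generator sep (sub1v _).
set t := separable_generator _ _ in full; exists t.
have /polyOver1P[p pE] := minPolyOver 1%AS t.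
have deg : adjoin_degree 1%AS t = d.
  have := dim_Fadjoin 1%AS t; rewrite dimv1 muln1 => <-.
  exact: esym (congr1 (fun E : {vspace K} => \dim E) full).
exists p; split.
- by rewrite -(map_monic (in_alg K)) -pE monic_minPoly.
- by rewrite -(size_map_poly (in_alg K)) -pE size_minPoly deg.
- rewrite -(separable_map (in_alg K)) -pE.
  by move/separableP: sep => /(_ t (memvf t)).
- move=> g; split=> [g0|].
    rewrite -(dvdp_map (in_alg K)) -pE; apply: minPoly_dvdp; last exact/rootP.
    by apply/polyOver1P; exists g.
  case/dvdpP => q ->; by rewrite rmorphM /= hornerM -pE minPolyxx mulr0.
- move=> x; have : x \in <<1; t>>%VS by rewrite -full memvf.
  by case/Fadjoin_polyP => q /polyOver1P[g ->] ->; exists g.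
Qed.

(** Evaluation at a complex root of [p] factors through [K] because it kills the multiples of [p].
    The roots are distinct, so the powers of [t] give a nonzero Vandermonde determinant; conversely
    any embedding sends [t] to a root. *)
Lemma all_embeddings_exist : exists s, all_embeddings s.
Proof.
have [t [p [mp szp sp pdv gen]]] := primitive_rational_poly.
have [rs rsE] := closed_field_poly_normal (map_poly (ratr : rat -> C) p).
have lc : lead_coef (map_poly (ratr : rat -> C) p) = 1.
  by rewrite lead_coef_map (monicP mp) rmorph1.
rewrite lc scale1r in rsE.
have urs : uniq rs.
  by rewrite -separable_prod_XsubC -rsE separable_map.
have szrs : size rs = d.
  have := size_prod_XsubC rs id; rewrite -rsE size_map_poly szp.
  by case.
have rootrs r : r \in rs -> root (map_poly (ratr : rat -> C) p) r.
  by rewrite rsE root_prod_XsubC.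
have /choice[G GE] : forall x, exists g, x = (map_poly (in_alg K) g).[t] by [].
pose ev (r : C) g := (map_poly (ratr : rat -> C) g).[r].
have evE r g : r \in rs -> ev r g = ev r (G (map_poly (in_alg K) g).[t]).
  move=> rr; apply/eqP; rewrite -subr_eq0 /ev -hornerN -hornerD -rmorphB /=.
  have : p %| g - G (map_poly (in_alg K) g).[t].
    by apply/pdv; rewrite rmorphB hornerD hornerN -GE subrr.
  rewrite -(dvdp_map (ratr : {rmorphism rat -> C})) => /dvdpP[q ->].
  by rewrite hornerM (rootP (rootrs r rr)) mulr0.
have mk r : r \in rs -> exists s : {rmorphism K -> C},
    forall g, s (map_poly (in_alg K) g).[t] = ev r g.
  move=> rr; have [|x y|x y|s sE] := @rmorphism_of (fun x => ev r (G x)).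
  - by have := evE r 1 rr; rewrite rmorph1 hornerC => <-; rewrite /ev rmorph1 hornerC.
  - rewrite -[in RHS]hornerN -hornerD -rmorphB /= -/(ev _ _) [RHS]evE //.
    by rewrite rmorphB /= hornerD hornerN -!GE.
  - rewrite -hornerM -rmorphM /= -/(ev _ _) [RHS]evE //.
    by rewrite rmorphM /= hornerM -!GE.
  by exists s => g; rewrite -sE -evE.
pose r_ (k : 'I_d) := rs`_k.
have r_in k : r_ k \in rs by rewrite mem_nth // szrs.
have /choice[s sE] (k : 'I_d) := mk _ (r_in k).
have st k : s k t = r_ k.
  have := sE k 'X; rewrite map_polyX hornerX => ->.
  by rewrite /ev map_polyX hornerX.
exists s; split.
  exists (fun i => t ^+ i).
  have -> : \matrix_(i, k) s k (t ^+ i) = Vandermonde d (\row_k r_ k).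
    by apply/matrixP => i k; rewrite !mxE rmorphXn st.
  rewrite det_Vandermonde; apply/prodf_neq0 => i _; apply/prodf_neq0 => j ij.
  by rewrite !mxE subr_eq0 /r_ nth_uniq ?szrs // eq_sym ltn_eqF.
move=> f; have : root (map_poly (ratr : rat -> C) p) (f t).
  have p0 : (map_poly (in_alg K) p).[t] = 0 by apply/pdv; exact: dvdpp.
  apply/rootP; have := congr1 f p0; rewrite rmorph0 -horner_map -map_poly_comp.
  move=> <-; congr (_.[_]); apply: eq_map_poly => q /=.
  by rewrite alg_num_field fmorph_rat.
rewrite rsE root_prod_XsubC => /(nthP 0)[k]; rewrite szrs => ltk kE.
exists (Ordinal ltk) => x; rewrite (GE x) sE -horner_map -map_poly_comp -kE.
congr (_.[_]); apply: eq_map_poly => q /=.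
by rewrite alg_num_field fmorph_rat.
Qed.

End Embeddings.

Section Basis.
Variables (R : realType) (K : fieldExtType rat).
Local Notation C := R[i].
Local Notation d := (degree K).
Variable s : 'I_d -> {rmorphism K -> C}.
Hypothesis hs : all_embeddings s.
Local Notation toC := (map_mx (ratr : rat -> C)).

Definition conj_mx n (b : 'I_n -> K) : 'M[C]_(n, d) := \matrix_(i, k) s k (b i).

Lemma emb_scale k (q : rat) x : s k (q *: x) = ratr q * s k x.
Proof. by rewrite -[q *: x]mulr_algl rmorphM alg_num_field fmorph_rat. Qed.

Lemma conj_mx_comb n (b : 'I_n -> K) (c : 'rV[rat]_n) k :
  s k (\sum_i c 0 i *: b i) = (toC c *m conj_mx b) 0 k.
Proof.
rewrite rmorph_sum mxE; apply: eq_bigr => i _.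
by rewrite emb_scale !mxE.
Qed.

Local Notation e := (fun i : 'I_d => (vbasis {:K})`_i).

Lemma vbasis_comb x : x = \sum_(i < d) coord (vbasis {:K}) i x *: e i.
Proof. exact: (coord_vbasis (memvf x)). Qed.

Lemma conj_mx_vbasis n (b : 'I_n -> K) :
  conj_mx b = toC (\matrix_(i, j) coord (vbasis {:K}) j (b i)) *m conj_mx e.
Proof.
apply/matrixP => i k; rewrite mxE {1}(vbasis_comb (b i)).
rewrite rmorph_sum mxE; apply: eq_bigr => j _.
by rewrite emb_scale !mxE.
Qed.

Lemma det_vbasis : \det (conj_mx e) != 0.
Proof.
have [[b bE] _] := hs; move: bE; rewrite -/(conj_mx b) conj_mx_vbasis det_mulmx mulf_eq0.
by rewrite negb_or => /andP[].
Qed.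

Lemma basis_expand (b : 'I_d -> K) x : \det (conj_mx b) != 0 ->
  exists c : 'rV[rat]_d, x = \sum_i c 0 i *: b i.
Proof.
set B := \matrix_(i, j) coord (vbasis {:K}) j (b i).
rewrite conj_mx_vbasis -/B det_mulmx mulf_eq0 negb_or det_map_mx fmorph_eq0.
move=> /andP[dB _]; have uB : B \in unitmx by rewrite unitmxE unitfE.
pose u : 'rV_d := \row_j coord (vbasis {:K}) j x.
exists (u *m invmx B); rewrite {1}(vbasis_comb x).
have -> : \sum_i (u *m invmx B) 0 i *: b i =
    \sum_j (u *m invmx B *m B) 0 j *: e j.
  under [RHS]eq_bigr => j _ do rewrite mxE scaler_suml.
  rewrite exchange_big; apply: eq_bigr => i _ /=.
  rewrite {1}(vbasis_comb (b i)) scaler_sumr; apply: eq_bigr => j _.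
  by rewrite scalerA [B i j]mxE.
by rewrite mulmxKV //; apply: eq_bigr => j _; rewrite mxE.
Qed.

Lemma conj_mx_free (b : 'I_d -> K) (c : 'rV[rat]_d) : \det (conj_mx b) != 0 ->
  \sum_i c 0 i *: b i = 0 -> c = 0.
Proof.
move=> db c0; have u : conj_mx b \in unitmx by rewrite unitmxE unitfE.
have : toC c *m conj_mx b = 0.
  by apply/rowP => k; rewrite -conj_mx_comb c0 rmorph0 mxE.
move=> /(congr1 (mulmx^~ (invmx (conj_mx b)))); rewrite mulmxK // mul0mx => h.
by apply/rowP => i; apply: (fmorph_inj (ratr : {rmorphism rat -> C})); have := congr1 (fun M : 'rV_d => M 0 i) h; rewrite !mxE rmorph0.
Qed.

(** The matrix of conjugates of a basis diagonalizes multiplication by [x], with eigenvalues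
    [s k x]. *)
Lemma trace_sum (x : K) : ratr (field_trace x) = \sum_k s k x.
Proof.
rewrite /field_trace; set A := passmx.mxof _ _ _.
have u : conj_mx e \in unitmx by rewrite unitmxE unitfE det_vbasis.
have AE i : x * e i = \sum_j A i j *: e j.
  have := passmx.mul_mxof (vbasis {:K}) (vbasis {:K}) (amull x) (delta_mx 0 i).
  rewrite -rowE -/A => /(congr1 (passmx.vecof (vbasis {:K}))).
  rewrite passmx.rVofK ?vbasisP // lfunE /= /passmx.vecof => /esym.
  rewrite (bigD1 i) //= big1 => [|j /negPf ji]; last by rewrite mxE ji andbF scale0r.
  rewrite mxE !eqxx scale1r addr0 => ->.
  by apply: eq_bigr => j _; rewrite mxE.
have E : toC A *m conj_mx e = conj_mx e *m diag_mx (\row_k s k x).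
  apply/matrixP => i k; rewrite mul_mx_diag !mxE -rmorphM mulrC AE rmorph_sum.
  by apply: eq_bigr => j _; rewrite emb_scale !mxE.
have -> : ratr (\tr A) = \tr (toC A) :> C.
  by rewrite trace_map_mx.
rewrite -(mulmxK u (toC A)) E -mulmxA mxtrace_mulC mulmxKV //.
by rewrite mxtrace_diag; apply: eq_bigr => k _; rewrite mxE.
Qed.

Definition disc (b : 'I_d -> K) : rat := \det (\matrix_(i, j) field_trace (b i * b j)).

Lemma disc_det (b : 'I_d -> K) : ratr (disc b) = \det (conj_mx b) ^+ 2.
Proof.
rewrite /disc -det_map_mx expr2 -[X in _ = _ * X]det_tr -det_mulmx; congr (\det _).
apply/matrixP => i j; rewrite !mxE; apply: etrans (trace_sum _) _.
by apply: eq_bigr => k _; rewrite !mxE rmorphM.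
Qed.

End Basis.

(** The substitute for taking [n]-th roots and letting [n] grow: estimates on absolute values are
    proved for powers up to a linear factor. *)
Lemma expr_bounded (R : realType) (a B : R) :
  (forall n, a ^+ n <= B * n.+1%:R) -> a <= 1.
Proof.
move=> aB; rewrite leNgt; apply/negP => a1.
(* Bernoulli's inequality for the square root makes [a ^+ n] grow at least quadratically, which a
   linear bound cannot follow. *)
pose b := Num.sqrt a; have a0 : 0 < a by apply: lt_trans a1.
have b1 : 1 < b by rewrite -sqrtr1 ltr_sqrt.
pose h := b - 1; have h0 : 0 < h by rewrite subr_gt0.
have bern m : 1 + m%:R * h <= b ^+ m.
  elim: m => [|m IH]; first by rewrite mul0r addr0 expr0.
  have mh : 0 <= m%:R * h * h by rewrite !mulr_ge0 // ltW.
  rewrite exprSr; apply: le_trans (ler_wpM2r (ltW (lt_trans ltr01 b1)) IH).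
  have bE : b = 1 + h by rewrite /h; ring.
  by rewrite bE -natr1; nra.
have B0 : 0 < B by have := aB 0%N; rewrite expr0 mulr1; apply: lt_le_trans.
pose n := (Num.truncn (2 * B / h ^+ 2)).+1.
have nB : 2 * B < n%:R * h ^+ 2.
  by rewrite -ltr_pdivrMr ?exprn_gt0 // truncnS_gt.
have := aB n; have -> : a ^+ n = b ^+ n * b ^+ n.
  by rewrite -exprMn -expr2 sqr_sqrtr // ltW.
have n1 : 1 <= n%:R :> R by rewrite ler1n.
have nh : 0 < n%:R * h by rewrite mulr_gt0 // ltr0n.
apply/negP; rewrite -ltNge; apply: lt_le_trans (_ : (n%:R * h) ^+ 2 <= _); last first.
  rewrite expr2; apply: ler_pM; rewrite ?(ltW nh) //;
  by apply: le_trans (bern n); rewrite lerDr.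
rewrite exprMn expr2 -mulrA; apply: le_lt_trans (_ : n%:R * (2 * B) < _).
  by rewrite -natr1; nra.
by rewrite ltr_pM2l // ltr0n.
Qed.

Section ComplexNorm.
Variable R : realType.
Local Notation C := R[i].

Definition nm (z : C) : R := Normc.normc z.

Lemma nmE z : `|z| = (nm z)%:C%C. Proof. by []. Qed.
Lemma nm_ge0 z : 0 <= nm z. Proof. by case: z => a b; rewrite sqrtr_ge0. Qed.
Lemma nm0 : nm 0 = 0. Proof. exact: Normc.normc0. Qed.
Lemma nm1 : nm 1 = 1. Proof. exact: Normc.normc1. Qed.
Lemma nmM x y : nm (x * y) = nm x * nm y. Proof. exact: Normc.normcM. Qed.
Lemma nmD x y : nm (x + y) <= nm x + nm y. Proof. exact: le_normcD. Qed.
Lemma nmN x : nm (- x) = nm x. Proof. exact: normcN. Qed.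
Lemma nmV x : nm x^-1 = (nm x)^-1. Proof. exact: Normc.normcV. Qed.
Lemma nm_eq0 x : (nm x == 0) = (x == 0).
Proof. by apply/eqP/eqP => [/Normc.eq0_normc //|->]; exact: nm0. Qed.
Lemma nmJ x : nm (x^*)%C = nm x.
Proof. by apply: complexI; rewrite -!nmE normcJ. Qed.
Lemma nm_real (a : R) : nm a%:C%C = `|a|.
Proof. by rewrite /nm /= expr0n addr0 sqrtr_sqr. Qed.
Lemma ratr_complex (q : rat) : ratr q = (ratr q : R)%:C%C :> C.
Proof. by rewrite -(fmorph_rat (real_complex R : {rmorphism R -> C})). Qed.
Lemma nm_ratr (q : rat) : nm (ratr q) = `|ratr q|.
Proof. by rewrite ratr_complex nm_real. Qed.
Lemma nmX x n : nm (x ^+ n) = nm x ^+ n.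
Proof. by elim: n => [|n IH]; rewrite ?expr0 ?nm1 // !exprS nmM IH. Qed.
Lemma nm_sum (I : finType) (F : I -> C) : nm (\sum_i F i) <= \sum_i nm (F i).
Proof.
elim/big_rec2: _ => [|i y x _ h]; first by rewrite nm0.
by apply: le_trans (nmD _ _) _; rewrite lerD2l.
Qed.
Lemma nm_sqr x : (nm x ^+ 2)%:C%C = x * (x^*)%C.
Proof. by rewrite -sqr_normc nmE -rmorphXn. Qed.

End ComplexNorm.

(** * Algebraic integers and integral bases *)

Section Integers.
Variable K : fieldExtType rat.
Local Notation O := (@algebraic_integer K).

Lemma ai1 : O 1. Proof. exact: integral1. Qed.
Lemma aiN x : O x -> O (- x). Proof. exact: integral_opp. Qed.
Lemma aiD x y : O x -> O y -> O (x + y). Proof. exact: integral_add. Qed.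
Lemma aiB x y : O x -> O y -> O (x - y). Proof. exact: integral_sub. Qed.
Lemma aiM x y : O x -> O y -> O (x * y). Proof. exact: integral_mul. Qed.
Lemma ai0 : O 0. Proof. by rewrite -(subrr 1); apply: aiB; exact: ai1. Qed.
Lemma ai_nat n : O n%:R. Proof. exact: integral_nat. Qed.
Lemma ai_int (n : int) : O n%:~R.
Proof. by case: n => n; rewrite ?NegzE ?mulrNz; [|apply: aiN]; exact: ai_nat. Qed.
Lemma aiX x n : O x -> O (x ^+ n).
Proof. by move=> Ox; elim: n => [|n IH]; rewrite ?exprS; [exact: ai1|exact: aiM]. Qed.
Lemma ai_sum (I : Type) (r : seq I) (P : pred I) (F : I -> K) :
  (forall i, P i -> O (F i)) -> O (\sum_(i <- r | P i) F i).
Proof. by move=> h; apply: big_ind => //; [exact: ai0|exact: aiD]. Qed.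

Lemma ai_monic_root x (p : {poly K}) : p \is monic -> p.[x] = 0 ->
  (forall i, O p`_i) -> O x.
Proof.
move=> mp px Op; apply: (@integral_root_monic _ _ (intr : {rmorphism int -> K}) x p mp).
  exact/rootP.
by move=> _ /(nthP 0)[i _ <-]; exact: Op.
Qed.

Lemma integral_rat (F : fieldType) (f : {rmorphism rat -> F}) (q : rat) :
  integralOver (intr : int -> F) (f q) -> q \is a Num.int.
Proof.
move=> [p mp rp].
have rq : root (map_poly (intr : int -> rat) p) q.
  apply/rootP; apply: (fmorph_inj f); rewrite rmorph0 -horner_map -map_poly_comp.
  rewrite -[RHS](rootP rp); congr (_.[_]); apply: eq_map_poly => z /=.
  exact: rmorph_int.
have : (ratr q : algC) \in Aint.
  apply: (@root_monic_Aint (map_poly intr p)).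
  - have -> : map_poly (intr : int -> algC) p =
        map_poly (ratr : rat -> algC) (map_poly intr p).
      by rewrite -map_poly_comp; apply: eq_map_poly => z /=; rewrite ratr_int.
    by rewrite fmorph_root.
  - exact: monic_map.
  - by apply/polyOverP => i; rewrite coef_map /= intr_int.
move=> /(Cint_rat_Aint (Crat_rat q))/intrP[z zE].
have -> : q = z%:~R; last exact: intr_int.
by apply: (fmorph_inj (ratr : {rmorphism rat -> algC})); rewrite /= zE ratr_int.
Qed.

Lemma ai_multiple (x : K) : exists2 m : nat, (0 < m)%N & O (m%:R * x).
Proof.
have /polyOver1P[g gE] := minPolyOver 1%AS x.
have mg : g \is monic by rewrite -(map_monic (in_alg K)) -gE monic_minPoly.
have gx : (map_poly (in_alg K) g).[x] = 0 by rewrite -gE minPolyxx.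
pose n := (size g).-1.
have sg : size g = n.+1.
  by rewrite prednK // lt0n size_poly_eq0 monic_neq0.
have [m m0 hm] := common_denominator (\row_(i < n.+1) g`_i).
exists m => //; have m0' : m%:R != 0 :> K.
  by rewrite -(rmorph_nat (in_alg K)) fmorph_eq0 pnatr_eq0 -lt0n.
(* The monic polynomial whose roots are [m] times those of [g]; each coefficient below the leading
   one carries a factor [m], which clears its denominator. *)
pose p : {poly K} := \poly_(i < n.+1) (m%:R ^+ (n - i) * (g`_i)%:A).
have gn : g`_n = 1 by have := monicP mg; rewrite /lead_coef sg.
have pn : p`_n = 1 by rewrite coef_poly ltnSn subnn expr0 mul1r gn scale1r.
apply: (@ai_monic_root _ p).
- have sp : size p = n.+1 by apply: size_poly_eq; rewrite subnn expr0 mul1r gn scale1r oner_neq0.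
  by rewrite monicE /lead_coef sp pn.
- have := congr1 ( *%R (m%:R ^+ n)) gx; rewrite mulr0 => h0; rewrite -[RHS]h0.
  rewrite horner_poly [X in _ = _ * X.[_]](_ : _ = \poly_(i < n.+1) (g`_i)%:A).
    rewrite horner_poly big_distrr; apply: eq_bigr => i _ /=.
    rewrite (_ : m%:R ^+ n = m%:R ^+ (n - i) * m%:R ^+ i); last first.
      by rewrite -exprD subnK // -ltnS.
    rewrite exprMn; move: (m%:R ^+ (n - i)) (m%:R ^+ i) (x ^+ i) (g`_i)%:A.
    by move=> A B D E; rewrite mulrACA -!mulrA; congr (_ * _); rewrite mulrCA.
  by apply/polyP => i; rewrite coef_map coef_poly -sg; case: ltnP => // h; rewrite (nth_default 0 h); exact: (scale0r (1 : K)).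
- move=> i; rewrite coef_poly; case: ltnP => [lt|_]; last exact: ai0.
  have [->|ni] := eqVneq i n.
    by rewrite subnn expr0 mul1r gn scale1r; exact: ai1.
  have {}lt : (i < n)%N by rewrite ltn_neqAle ni -ltnS.
  have -> : (n - i = (n - i).-1.+1)%N by lia.
  rewrite exprSr -mulrA; apply: aiM; first exact/aiX/ai_nat.
  have /mxOverP/(_ 0 (Ordinal (leqW lt))) := hm; rewrite !mxE /= => /intrP[z zE].
  have -> : m%:R * (g`_i)%:A = z%:~R :> K.
    by rewrite -(rmorph_nat (in_alg K)) -[(g`_i)%:A]/(in_alg K g`_i) -rmorphM /= -/(in_alg K _) zE rmorph_int.
  exact: ai_int.
Qed.

End Integers.

Section IntegralBasis.
Variables (R : realType) (K : fieldExtType rat).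
Local Notation C := R[i].
Local Notation d := (degree K).
Local Notation O := (@algebraic_integer K).
Variable s : 'I_d -> {rmorphism K -> C}.
Hypothesis hs : all_embeddings s.
Local Notation toC := (map_mx (ratr : rat -> C)).

Lemma trace_ai x : O x -> field_trace x \is a Num.int.
Proof.
move=> Ox; apply: (@integral_rat C (ratr : {rmorphism rat -> C})).
rewrite /= (trace_sum hs).
apply: (big_ind (integralOver (intr : int -> C))).
- exact: (integral_nat (intr : {rmorphism int -> C}) 0).
- by move=> y z; exact: (@integral_add _ _ (intr : {rmorphism int -> C})).
- move=> k _; case: Ox => p mp rp; exists p => //.
  apply/rootP; rewrite -(rmorph0 (s k)) -[in RHS](rootP rp) -horner_map.
  rewrite -map_poly_comp; congr (_.[_]); apply: eq_map_poly => z /=.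
  by rewrite rmorph_int.
Qed.

Lemma disc_int (b : 'I_d -> K) : (forall i, O (b i)) -> disc b \is a Num.int.
Proof.
move=> Ob; apply: det_int; apply/mxOverP => i j; rewrite mxE.
by apply/trace_ai/aiM.
Qed.

(** Along the replaced row the cofactors are those of the identity matrix. *)
Lemma det_row_replace (F : comNzRingType) n (u : 'rV[F]_n) (i : 'I_n) :
  \det (\matrix_(a, j) (if a == i then u 0 j else (a == j)%:R)) = u 0 i.
Proof.
set A := \matrix_(a, j) _.
have cof j : cofactor A i j = cofactor 1%:M i j.
  rewrite /cofactor; congr (_ * \det _); apply/matrixP => a b.
  by rewrite !mxE eq_sym (negPf (neq_lift _ _)).
have adj1 : \adj (1%:M : 'M[F]_n) = 1%:M.
  by rewrite -[LHS]mul1mx mul_mx_adj det1.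
have cof1 j : cofactor (1%:M : 'M[F]_n) i j = (j == i)%:R.
  by have := congr1 (fun M : 'M[F]_n => M j i) adj1; rewrite !mxE.
rewrite (expand_det_row A i) (bigD1 i) //= big1 ?addr0 => [|j ji].
  by rewrite cof cof1 mxE !eqxx mulr1.
by rewrite cof cof1 (negPf ji) mulr0.
Qed.

(* A Q-basis of integers of minimal discriminant is an integral basis: a
   non-integral coordinate could be replaced by its fractional part. *)
Lemma integral_basis_exists : exists b : 'I_d -> K,
  integral_basis b /\ \det (conj_mx s b) != 0.
Proof.
pose P (n : nat) := `[< exists b : 'I_d -> K,
  [/\ forall i, O (b i), disc b != 0 & `|disc b| = n%:R] >].
have disc0 (b : 'I_d -> K) : (disc b != 0) = (\det (conj_mx s b) != 0).
  by rewrite -(fmorph_eq0 (ratr : {rmorphism rat -> C})) /= (disc_det hs) sqrf_eq0.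
have exP : exists n, P n.
  have /choice[m mP] : forall i : 'I_d, exists m : nat,
      (0 < m)%N /\ O (m%:R * (vbasis {:K})`_i).
    by move=> i; have [m] := ai_multiple (vbasis {:K})`_i; exists m.
  pose b i := (m i)%:R * (vbasis {:K})`_i.
  have Ob i : O (b i) by case: (mP i).
  have /intrP[z zE] := disc_int Ob.
  exists `|z|%N; apply/asboolP; exists b; split=> //.
    rewrite disc0.
    have -> : conj_mx s b = diag_mx (\row_i (m i)%:R) *m
        conj_mx s (fun i : 'I_d => (vbasis {:K})`_i).
      by apply/matrixP => i k; rewrite mul_diag_mx !mxE rmorphM rmorph_nat.
    rewrite det_mulmx det_diag mulf_neq0 ?(det_vbasis hs) //.
    apply/prodf_neq0 => i _; rewrite mxE pnatr_eq0 -lt0n; by case: (mP i).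
  by rewrite zE -intr_norm -abszE.
have [n /asboolP[b [Ob db nE]] nmin] := ex_minnP exP.
have db' : \det (conj_mx s b) != 0 by rewrite -disc0.
exists b; split=> //; split=> // x Ox.
have [c cE] := basis_expand x db'.
have cint i : c 0 i \is a Num.int.
  apply/negPn/negP => nc; pose z := Num.floor (c 0 i).
  have f0 : 0 < c 0 i - z%:~R.
    rewrite subr_gt0 lt_neqAle floor_le andbT; apply: contraNneq nc => <-.
    exact: intr_int.
  have f1 : c 0 i - z%:~R < 1.
    by have := floorD1_gt (c 0 i); rewrite intrD -/z; lra.
  pose b' a := if a == i then x - z%:~R * b i else b a.
  have Ob' a : O (b' a).
    by rewrite /b'; case: eqP => // _; apply/aiB/aiM => //; exact: ai_int.
  pose u : 'rV[rat]_d := c - z%:~R *: delta_mx 0 i.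
  have bE : conj_mx s b' =
      toC (\matrix_(a, j) (if a == i then u 0 j else (a == j)%:R)) *m conj_mx s b.
    apply/matrixP => a k; rewrite [LHS]mxE /b'; case: eqP => [->|/eqP ai].
      rewrite {1}cE rmorphB rmorphM rmorph_int /= conj_mx_comb.
      have -> : (toC (\matrix_(a, j) (if a == i then u 0 j else (a == j)%:R)) *m
          conj_mx s b) i k = (toC u *m conj_mx s b) 0 k.
        by rewrite !mxE; apply: eq_bigr => j _; rewrite !mxE eqxx.
      have -> : toC u = toC c - z%:~R *: delta_mx 0 i.
        by apply/rowP => j; rewrite !mxE rmorphB rmorphM /= ratr_int rmorph_nat.
      by rewrite mulmxBl -scalemxAl -rowE !mxE.
    rewrite mxE (bigD1 a) //= big1 ?addr0 => [|j ja].
      by rewrite !mxE (negPf ai) eqxx rmorph1 mul1r.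
    by rewrite !mxE (negPf ai) eq_sym (negPf ja) rmorph0 mul0r.
  have dE : disc b' = (c 0 i - z%:~R) ^+ 2 * disc b.
    apply: (fmorph_inj (ratr : {rmorphism rat -> C})); rewrite rmorphM rmorphXn /=.
    rewrite !(disc_det hs) bE det_mulmx exprMn det_map_mx det_row_replace.
    by rewrite !mxE !eqxx mulr1.
  have /intrP[y yE] := disc_int Ob'.
  have : P `|y|%N.
    apply/asboolP; exists b'; split=> //.
      by rewrite dE mulf_neq0 // sqrf_eq0 lt0r_neq0.
    by rewrite yE -intr_norm -abszE.
  move/nmin; apply/negP; rewrite -ltnNge -(ltr_nat rat) -nE.
  have -> : (`|y|%N%:R : rat) = `|disc b'| by rewrite yE -intr_norm -abszE.
  rewrite dE normrM -[ltRHS]mul1r ltr_pM2r ?normr_gt0 //.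
  by rewrite normrX gtr0_norm // expr_lt1 // ltW.
have bi (z : {ffun 'I_d -> int}) : \sum_i b i *~ z i =
    \sum_i (\row_j (z j)%:~R : 'rV[rat]_d) 0 i *: b i.
  by apply: eq_bigr => i _; rewrite mxE scaler_int.
exists [ffun i => Num.floor (c 0 i)]; split.
  rewrite bi {1}cE; apply: eq_bigr => i _; rewrite mxE ffunE.
  by rewrite (floorK (cint i)).
move=> z; rewrite bi => zE; apply/ffunP => i; rewrite ffunE.
have : c - \row_j (z j)%:~R = 0.
  apply: (conj_mx_free db').
  under eq_bigr do rewrite mxE [X in _ + X]mxE scalerBl.
  by rewrite sumrB -cE -zE subrr.
by move=> /(congr1 (fun M : 'rV_d => M 0 i)); rewrite !mxE => /eqP;
   rewrite subr_eq0 => /eqP ->; rewrite intrKfloor.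
Qed.

Lemma integral_basis_det (b : 'I_d -> K) :
  integral_basis b -> \det (conj_mx s b) != 0.
Proof.
move=> [Ob hb]; have [b0 [[Ob0 _] d0]] := integral_basis_exists.
have /choice[c cE] : forall i, exists c : {ffun 'I_d -> int}, b0 i = \sum_j b j *~ c j.
  by move=> i; have [c [cE _]] := hb _ (Ob0 i); exists c.
apply: contraNneq d0 => db.
have -> : conj_mx s b0 = (\matrix_(i, j) (c i j)%:~R) *m conj_mx s b.
  apply/matrixP => i k; rewrite !mxE cE rmorph_sum; apply: eq_bigr => j _.
  by rewrite !mxE rmorphMz -mulrzl.
by rewrite det_mulmx db mulr0.
Qed.

(** Since an integral basis exists, the default 0 of [xget] is not taken, and [w] is a basis
    realizing the chosen value. *)
Lemma discriminant_basis : exists w : 'I_d -> K,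
  [/\ integral_basis w, \det (conj_mx s w) != 0 &
      ratr (discriminant K) = \det (conj_mx s w) ^+ 2].
Proof.
have [b [ib db]] := integral_basis_exists.
have : [set D | exists2 b : 'I_d -> K, integral_basis b & D = disc b]%classic (discriminant K).
  by apply: xgetPex; exists (disc b); exists b.
case=> w iw wE; exists w; split=> //; first exact: integral_basis_det.
by rewrite wE (disc_det hs).
Qed.

Lemma coord_bound (b : 'I_d -> K) : \det (conj_mx s b) != 0 ->
  exists2 B : R, 0 < B & forall (c : 'rV[rat]_d) (M : R),
    (forall k, nm (s k (\sum_i c 0 i *: b i)) <= M) ->
    forall i, `|ratr (c 0 i)| <= B * M.
Proof.
move=> db; have u : conj_mx s b \in unitmx by rewrite unitmxE unitfE.
set I := invmx (conj_mx s b).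
pose B := 1 + \sum_i \sum_k nm (I k i).
have B0 : 0 < B.
  rewrite ltr_pwDl // sumr_ge0 // => i _; apply: sumr_ge0 => k _; exact: nm_ge0.
exists B => // c M hM i.
have -> : `|ratr (c 0 i) : R| = nm ((toC c *m conj_mx s b *m I) 0 i).
  by rewrite mulmxK // mxE nm_ratr.
rewrite mxE; apply: le_trans (nm_sum _) _.
apply: (@le_trans _ _ (\sum_k M * nm (I k i))).
  by apply: ler_sum => k _; rewrite nmM -conj_mx_comb ler_wpM2r ?nm_ge0.
have [k0|M0] := leP 0 M; last first.
  by have := le_lt_trans (le_trans (nm_ge0 _) (hM i)) M0; rewrite ltxx.
rewrite -mulr_sumr mulrC ler_wpM2r // /B [X in _ <= 1 + X](bigD1 i) //= addrCA lerDl.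
by rewrite addr_ge0 // sumr_ge0 // => j _; apply: sumr_ge0 => k _; exact: nm_ge0.
Qed.


(** The powers of a nonzero [x] have integral coordinates, not all zero, in an integral basis, while
    [coord_bound] makes these coordinates decay geometrically. *)
Lemma ai_small (x : K) : O x -> (forall k, nm (s k x) < 1) -> x = 0.
Proof.
move=> Ox sx; apply/eqP/negPn/negP => x0.
have [w [[Ow hw] dw _]] := discriminant_basis.
have [B B0 hB] := coord_bound dw.
pose M : R := \big[Num.max/1/2]_k nm (s k x).
have M0 : 0 < M by apply: lt_le_trans (bigmax_ge_id _ _ _ _); lra.
have M1 : M < 1 by apply: bigmax_lt => //; lra.
have Mk k : nm (s k x) <= M by apply: le_bigmax.
suff : M^-1 <= 1 by rewrite invf_le1 // leNgt M1.
apply: (@expr_bounded _ _ B) => n.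
have [c [cE _]] := hw _ (aiX n Ox).
have cE' : x ^+ n = \sum_i (\row_j (c j)%:~R : 'rV[rat]_d) 0 i *: w i.
  by rewrite cE; apply: eq_bigr => i _; rewrite mxE scaler_int.
have [i ci] : exists i, c i != 0.
  apply/existsP; apply: contraNT (expf_neq0 n x0); rewrite negb_exists => /forallP h.
  by rewrite cE big1 // => i _; have := h i; rewrite negbK => /eqP ->; rewrite mulr0z.
have : `|ratr ((\row_j (c j)%:~R : 'rV[rat]_d) 0 i)| <= B * M ^+ n.
  apply: hB => k; rewrite -cE' rmorphXn nmX.
  by rewrite lerXn2r ?nnegrE ?nm_ge0 // ltW.
rewrite mxE ratr_int -intr_norm => h.
have h1 : 1 <= B * M ^+ n.
  by apply: le_trans h; rewrite ler1z; case: (c i) ci => [[|m]|m].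
rewrite exprVn; apply: (@le_trans _ _ B).
  by rewrite -[leLHS]mul1r ler_pdivrMr ?exprn_gt0.
by rewrite -[leLHS]mulr1 ler_wpM2l ?(ltW B0) // ler1n.
Qed.

Lemma emb_inj k j : s k =1 s j -> k = j.
Proof.
move=> kj; apply/eqP/negPn/negP => nkj; move: (det_vbasis hs).
rewrite -det_tr (determinant_alternate nkj) ?eqxx // => i.
by rewrite !mxE.
Qed.

Lemma emb_conj_exists : exists kp : 'I_d -> 'I_d,
  forall k x, s (kp k) x = ((s k x)^*)%C.
Proof.
have /choice[kp kpE] : forall k, exists j, forall x, s j x = ((s k x)^*)%C.
  move=> k; have [|x y|x y|f fE] := @rmorphism_of R K (fun x => ((s k x)^*)%C).
  - by rewrite rmorph1 conjc1.
  - by rewrite !rmorphB.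
  - by rewrite !rmorphM.
  by have [j jE] := hs.2 f; exists j => x; rewrite -jE -fE.
by exists kp.
Qed.

Section Conj.
Variable kp : 'I_d -> 'I_d.
Hypothesis kpE : forall k x, s (kp k) x = ((s k x)^*)%C.

Lemma emb_conjK : involutive kp.
Proof. by move=> k; apply: emb_inj => x; rewrite !kpE conjcK. Qed.

(** A target compatible with conjugation has real coordinates in a rational basis, and these are
    approximated by rationals: [K] is dense in its archimedean completion. *)
Lemma emb_dense (w : 'I_d -> C) (eps : R) :
  (forall k, w (kp k) = ((w k)^*)%C) -> 0 < eps ->
  exists x, forall k, nm (s k x - w k) < eps.
Proof.
move=> wJ eps0.
pose e := fun i : 'I_d => (vbasis {:K})`_i.
have u : conj_mx s e \in unitmx by rewrite unitmxE unitfE (det_vbasis hs).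
pose a := (\row_k w k) *m invmx (conj_mx s e).
have aE k : \sum_i a 0 i * s k (e i) = w k.
  transitivity ((a *m conj_mx s e) 0 k); last by rewrite mulmxKV // mxE.
  by rewrite mxE; apply: eq_bigr => i _; rewrite [conj_mx s e _ _]mxE.
have aJ i : ((a 0 i)^*)%C = a 0 i.
  have aJE : map_mx conjc a *m conj_mx s e = \row_k w k.
    apply/rowP => k; rewrite !mxE -[k in RHS]emb_conjK wJ -aE rmorph_sum.
    apply: eq_bigr => j _; rewrite rmorphM !mxE; congr (_ * _).
    by rewrite -[RHS]/(((s (kp k) (e j))^*)%C) -kpE emb_conjK.
  have : map_mx conjc a = a by rewrite -(mulmxK u (map_mx conjc a)) aJE.
  by move/(congr1 (fun M : 'rV_d => M 0 i)); rewrite mxE.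
have aR i : a 0 i = (complex.Re (a 0 i))%:C%C.
  by case: (a 0 i) (aJ i) => x y /= [] /eqP; rewrite -subr_eq0 => h; congr Complex; lra.
pose B := 1 + \sum_k \sum_i nm (s k (e i)).
have B0 : 0 < B.
  by rewrite ltr_pwDl // sumr_ge0 // => k _; apply: sumr_ge0 => i _; exact: nm_ge0.
have /choice[q qE] : forall i, exists q : rat, `|ratr q - complex.Re (a 0 i)| < eps / B.
  move=> i; have eB : 0 < eps / B by rewrite divr_gt0.
  have [|q] := @rat_in_itvoo R (complex.Re (a 0 i) - eps / B) (complex.Re (a 0 i) + eps / B).
    by lra.
  by rewrite in_itv /= => /andP[h1 h2]; exists q; rewrite ltr_norml; lra.
exists (\sum_i q i *: e i) => k.
have -> : s k (\sum_i q i *: e i) - w k = \sum_i (ratr (q i) - a 0 i) * s k (e i).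
  rewrite rmorph_sum -aE -sumrB; apply: eq_bigr => i _.
  by rewrite emb_scale mulrBl.
apply: le_lt_trans (nm_sum _) _.
apply: (@le_lt_trans _ _ (eps / B * \sum_i nm (s k (e i)))).
  rewrite mulr_sumr; apply: ler_sum => i _; rewrite nmM ler_wpM2r ?nm_ge0 //.
  by rewrite aR ratr_complex -rmorphB nm_real ltW.
rewrite mulrAC ltr_pdivrMr // ltr_pM2l // /B [X in _ < 1 + X](bigD1 k) //=.
rewrite addrCA ltrDl ltr_pwDl // sumr_ge0 // => j _; apply: sumr_ge0 => i _.
exact: nm_ge0.
Qed.

End Conj.
End IntegralBasis.

(** * Bases of a completion and local degrees *)

Section LocalDegree.
Variables (R : realType) (K : fieldExtType rat) (v : absval R K).
Local Notation Kv := (completion v).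
Local Notation piv := (\pi_Kv%qT : cauchy_ring v -> Kv).

Lemma cauchyP (x : cauchy_ring v) : is_cauchy v x.
Proof. exact: (asboolW (cauchy_valP x)). Qed.

Lemma mk_cauchy (u : nat -> K) : is_cauchy v u ->
  exists x : cauchy_ring v, cauchy_val x = u.
Proof.
move=> hu; have cu : u \in cauchy_seq v by apply/asboolP.
by exists (CauchySeq cu).
Qed.

Lemma const_cauchy (a : K) : is_cauchy v (fun _ => a).
Proof. by move=> e e0; exists 0%N => m n _ _; rewrite subrr absval0. Qed.

Lemma cauchy_sumE n (F : 'I_n -> cauchy_ring v) m :
  (\sum_i F i : cauchy_ring v) m = \sum_i F i m.
Proof. by apply: (big_morph (fun x : cauchy_ring v => cauchy_val x m)). Qed.

Lemma pi_eq (x y : cauchy_ring v) :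
  piv x = piv y <-> is_null v (fun n => x n - y n).
Proof.
have E : (x - y \in @null_ideal R K v) = `[< is_null v (fun n => x n - y n) >].
  by [].
split=> [e|h].
  have : x - y \in @null_ideal R K v by rewrite Quotient.idealrBE; apply/eqP.
  by rewrite E => /asboolP.
by apply/eqP; rewrite -Quotient.idealrBE E; apply/asboolP.
Qed.

Lemma rat_completion_ring : [/\ rat_completion (0 : Kv), rat_completion (1 : Kv),
  forall x y : Kv, rat_completion x -> rat_completion y -> rat_completion (x + y) &
  forall x y : Kv, rat_completion x -> rat_completion y -> rat_completion (x * y)].
Proof.
split.
- exists 0; last by rewrite rmorph0.
  by move=> n; exists 0; rewrite scale0r.
- exists 1; last by rewrite rmorph1.
  by move=> n; exists 1; rewrite scale1r.
- move=> x y [u hu ->] [u' hu' ->]; exists (u + u'); last by rewrite rmorphD.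
  move=> n; have [q qE] := hu n; have [q' q'E] := hu' n; exists (q + q').
  by rewrite scalerDl -qE -q'E.
- move=> x y [u hu ->] [u' hu' ->]; exists (u * u'); last by rewrite rmorphM.
  move=> n; have [q qE] := hu n; have [q' q'E] := hu' n; exists (q * q').
  have -> : (q * q')%:A = q%:A * q'%:A :> K by rewrite -scalerAl mul1r scalerA.
  by rewrite -qE -q'E.
Qed.

(** By uniqueness of coordinates the product of the two change-of-basis matrices is the identity,
    which bounds [n] by [m]. Hence the [xget] in [local_degree] has at most one candidate. *)
Lemma completion_basis_le n m (b : 'I_n -> Kv) (b' : 'I_m -> Kv) :
  completion_basis b -> completion_basis b' -> (n <= m)%N.
Proof.
have [r0 r1 rD rM] := rat_completion_ring.
move=> hb hb'.
have /choice[P PE] := fun i => hb' (b i).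
have /choice[Q QE] := fun j => hb (b' j).
apply: (@mulmx1_min _ n m (\matrix_(i, j) P i j) (\matrix_(j, i) Q j i)).
apply/matrixP => i k; rewrite !mxE.
have [c [[cr cE] cU]] := hb (b i).
pose e := [ffun l => (i == l)%:R : Kv].
pose f := [ffun l => \sum_j P i j * Q j l].
have cf : c = f.
  apply: cU; split=> [l|].
    rewrite ffunE; apply: big_ind => // j _; apply: rM.
      by have [[]] := PE i.
    by have [[]] := QE j.
  have E1 : b i = \sum_j P i j * b' j by case: (PE i) => -[].
  have E2 j : b' j = \sum_l Q j l * b l by case: (QE j) => -[].
  rewrite [LHS]E1; under [RHS]eq_bigr do rewrite ffunE mulr_suml.
  rewrite exchange_big; apply: eq_bigr => j _ /=.
  rewrite [in LHS]E2 mulr_sumr.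
  by apply: eq_bigr => l _; rewrite mulrA.
have ce : c = e.
  apply: cU; split=> [l|].
    by rewrite ffunE; case: (i == l).
  rewrite (bigD1 i) //= big1 ?addr0 => [|l /negPf li]; rewrite ffunE.
    by rewrite eqxx mul1r.
  by rewrite eq_sym li mul0r.
have := ffunP f e; rewrite -cf => -[_ /(_ ce)/(_ k)].
by rewrite {1}cf !ffunE => <-; apply: eq_bigr => j _; rewrite !mxE.
Qed.

(* The rational coordinates of a Cauchy sequence of K are Cauchy sequences. *)
Lemma local_degree_eq n (b : 'I_n -> K) (delta : R) : 0 < delta ->
  (forall x e, 0 < e -> exists c : 'I_n -> rat, v (x - \sum_i c i *: b i) < e) ->
  (forall (c : 'I_n -> rat) i, delta * v (c i)%:A <= v (\sum_i c i *: b i)) ->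
  local_degree v = n.
Proof.
move=> delta0 dens low.
have scaleA (q : rat) (x : K) : q%:A * x = q *: x by rewrite mulr_algl.
have [cb cbE] : exists cb : 'I_n -> cauchy_ring v, forall i m, cb i m = b i.
  have /choice[cb cbE] : forall i, exists x : cauchy_ring v, cauchy_val x = fun _ => b i.
    by move=> i; apply/mk_cauchy/const_cauchy.
  by exists cb => i m; rewrite cbE.
have basis : completion_basis (fun i => piv (cb i)).
  elim/quotW => u.
  have inv0 m : 0 < (m.+1%:R : R)^-1 by rewrite invr_gt0 ltr0n.
  (* Each term is approximated by a rational combination. As [low] bounds every coordinate by the
     combination, the coordinates are Cauchy; the same bound gives uniqueness in the limit. *)
  have /choice[c cE] := fun m => dens (u m) _ (inv0 m).
  have inv_small e : 0 < e -> exists n0, forall m, (n0 <= m)%N -> (m.+1%:R : R)^-1 < e.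
    move=> e0; exists (Num.truncn e^-1) => m le.
    rewrite -[ltRHS]invrK ltf_pV2 ?posrE ?invr_gt0 ?ltr0n //.
    by apply: lt_le_trans (truncnS_gt _) _; rewrite ler_nat.
  have cC i : is_cauchy v (fun m => (c m i)%:A).
    move=> e e0; have ed0 : 0 < e * delta / 3 by rewrite divr_gt0 ?mulr_gt0.
    have [n1 h1] := cauchyP u ed0; have [n2 h2] := inv_small _ ed0.
    exists (maxn n1 n2) => m m'; rewrite !geq_max => /andP[m1 m2] /andP[m1' m2'].
    have := low (fun i => c m i - c m' i) i; rewrite scalerBl => h3.
    rewrite -(ltr_pM2l delta0); apply: le_lt_trans h3 _.
    have -> : \sum_i (c m i - c m' i) *: b i =
        - (u m - \sum_i c m i *: b i) + (u m - u m') + (u m' - \sum_i c m' i *: b i).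
      under eq_bigr do rewrite scalerBl.
      rewrite sumrB opprB !addrA; congr (_ - _).
      by rewrite subrK subrK.
    apply: le_lt_trans (absvalD v _ _) _; apply: le_lt_trans (lerD (absvalD v _ _) (lexx _)) _.
    rewrite absvalN; have k1 := cE m; have k2 := cE m'.
    have k3 := h1 _ _ m1 m1'; have k4 := h2 _ m2; have k5 := h2 _ m2'.
    have {}k1 := lt_trans k1 k4; have {}k2 := lt_trans k2 k5; move: k1 k2 k3.
    move: (v (u m - u m')) (v (u m - _)) (v (u m' - _)) => A B D *; lra.
  have /choice[cc ccE] := fun i => mk_cauchy (cC i).
  exists [ffun i => piv (cc i)]; split.
    split=> [i|].
      by rewrite ffunE; exists (cc i) => // m; exists (c m i); rewrite ccE.
    under eq_bigr do rewrite ffunE -rmorphM.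
    rewrite -rmorph_sum; apply/pi_eq => e e0; have [n2 h2] := inv_small _ e0.
    exists n2 => m /h2; apply: lt_trans; rewrite cauchy_sumE.
    have -> : \sum_i (cc i * cb i : cauchy_ring v) m = \sum_i c m i *: b i.
      apply: eq_bigr => i _; rewrite -[LHS]/(cc i m * cb i m) cbE ccE scaleA //.
    exact: cE.
  move=> c' [/= c'r c'E]; apply/ffunP => i; rewrite ffunE.
  have /choice[w wE] i0 : exists w : cauchy_ring v, [/\ c' i0 = piv w &
      forall m, exists q : rat, w m = q%:A].
    by have [w hw ->] := c'r i0; exists w.
  have [-> _] := wE i; apply/pi_eq => e e0.
  have hn : is_null v (fun m => u m - (\sum_i w i * cb i : cauchy_ring v) m).
    apply/pi_eq; rewrite c'E rmorph_sum; apply: eq_bigr => j _.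
    by rewrite rmorphM; case: (wE j) => ->.
  have ed0 : 0 < e * delta / 2 by rewrite divr_gt0 ?mulr_gt0.
  have [n1 h1] := hn _ ed0; have [n2 h2] := inv_small _ ed0.
  exists (maxn n1 n2) => m; rewrite geq_max => /andP[m1 m2].
  have /choice[q qE] : forall j, exists q : rat, w j m = q%:A.
    by move=> j; case: (wE j) => _ /(_ m).
  have sumE : (\sum_i w i * cb i : cauchy_ring v) m = \sum_j q j *: b j.
    rewrite cauchy_sumE; apply: eq_bigr => j _.
    by rewrite -[LHS]/(w j m * cb j m) cbE qE scaleA.
  have := low (fun j => c m j - q j) i; rewrite scalerBl -qE => h3.
  have -> : cc i m = (c m i)%:A by rewrite ccE.
  rewrite -(ltr_pM2l delta0); apply: le_lt_trans h3 _.
  have -> : \sum_j (c m j - q j) *: b j =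
      (u m - \sum_j q j *: b j) - (u m - \sum_j c m j *: b j).
    under eq_bigr do rewrite scalerBl.
    by rewrite sumrB opprB [RHS]addrC addrA subrK.
  apply: le_lt_trans (absvalD v _ _) _; rewrite absvalN.
  have k1 := cE m; have k2 := h1 _ m1; rewrite sumE in k2; have k3 := h2 _ m2.
  have {}k1 := lt_trans k1 k3; move: k1 k2.
  by move: (v _) (v (u m - \sum_j q j *: b j)) => A B *; lra.
have : exists b' : 'I_n -> Kv, completion_basis b' by exists (fun i => piv (cb i)).
move=> hex.
have [b' hb'] : exists b' : 'I_(local_degree v) -> Kv, completion_basis b'.
  by apply: (@xgetPex _ 0%N [set n | exists b : 'I_n -> Kv, completion_basis b]%classic); exists n.
apply/eqP; rewrite eqn_leq; apply/andP; split.
  exact: completion_basis_le hb' basis.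
exact: completion_basis_le basis hb'.
Qed.

End LocalDegree.

(** * Archimedean places *)

Section AbsvalExtra.
Variables (R : realType) (K : fieldExtType rat).
Implicit Types v : absval R K.

Lemma absval_gt0 v x : x != 0 -> 0 < v x.
Proof.
move=> x0; rewrite lt_neqAle absval_ge0 andbT eq_sym.
by apply: contraNneq x0 => /absval_eq0 ->.
Qed.

Lemma absvalV v x : v x^-1 = (v x)^-1.
Proof.
have [->|x0] := eqVneq x 0; first by rewrite invr0 absval0 invr0.
apply: (mulfI (lt0r_neq0 (absval_gt0 v x0))).
by rewrite -absvalM !mulfV ?absval1 // lt0r_neq0 // absval_gt0.
Qed.

Lemma absvalX v x n : v (x ^+ n) = v x ^+ n.
Proof. by elim: n => [|n IH]; rewrite ?expr0 ?absval1 // !exprS absvalM IH. Qed.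

Lemma absval_sum v (I : finType) (F : I -> K) : v (\sum_i F i) <= \sum_i v (F i).
Proof.
elim/big_rec2: _ => [|i y x _ h]; first by rewrite absval0.
by apply: le_trans (absvalD v _ _) _; rewrite lerD2l.
Qed.

Lemma absval_ext v v' : v =1 v' -> v = v'.
Proof.
case: v => f f0 f1 f2 f3; case: v' => g g0 g1 g2 g3 /= /funext fg.
move: f0 f1 f2 f3 g0 g1 g2 g3; rewrite fg => *.
by congr AbsVal; apply: Prop_irrelevance.
Qed.

Lemma place_ext (v v' : place R K) : (forall x, v x = v' x) -> v = v'.
Proof.
case: v v' => [v hv] [v' hv'] /= /absval_ext e; move: hv hv'; rewrite e => hv hv'.
by congr Place; apply: Prop_irrelevance.
Qed.

End AbsvalExtra.

Lemma expr_small (R : realType) (a e : R) : 0 <= a -> a < 1 -> 0 < e ->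
  exists m, a ^+ m < e.
Proof.
move=> a0 a1 e0; apply: contrapT => h.
have ha m : e <= a ^+ m by rewrite leNgt; apply/negP => hm; apply: h; exists m.
have a0' : 0 < a by rewrite lt_neqAle a0 andbT eq_sym; apply/eqP => ae; have := ha 1%N; rewrite ae expr1; lra.
suff : a^-1 <= 1 by rewrite invf_le1 // leNgt a1.
apply: (@expr_bounded _ _ e^-1) => n; rewrite exprVn.
apply: (@le_trans _ _ e^-1); first by rewrite lef_pV2 ?posrE ?exprn_gt0.
by rewrite -[leLHS]mulr1 ler_wpM2l ?invr_ge0 ?(ltW e0) // ler1n.
Qed.

Section ArchimedeanPlaces.
Variables (R : realType) (K : fieldExtType rat).
Local Notation C := R[i].
Local Notation d := (degree K).
Variable s : 'I_d -> {rmorphism K -> C}.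
Hypothesis hs : all_embeddings s.
Variable kp : 'I_d -> 'I_d.
Hypothesis kpE : forall k x, s (kp k) x = ((s k x)^*)%C.

Lemma emb_scalar k (q : rat) : s k q%:A = ratr q.
Proof. by rewrite alg_num_field fmorph_rat. Qed.

Lemma emb_place_exists k : exists v : place R K,
  archimedean v /\ forall x, v x = nm (s k x).
Proof.
have h0 x : nm (s k x) = 0 <-> x = 0.
  by split=> [/eqP|->]; rewrite ?rmorph0 ?nm0 // nm_eq0 fmorph_eq0 => /eqP.
have hM : {morph (fun x => nm (s k x)) : x y / x * y}.
  by move=> x y; rewrite rmorphM nmM.
have hD x y : nm (s k (x + y)) <= nm (s k x) + nm (s k y) by rewrite rmorphD nmD.
pose v := AbsVal (fun x => nm_ge0 (s k x)) h0 hM hD.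
have av : archimedean v by move=> q; rewrite /= emb_scalar nm_ratr.
by exists (@Place R K v (or_introl av)).
Qed.

(** Coordinates in a rational basis bound [v (x ^+ n)] by a constant times [M ^+ n]; [expr_bounded]
    removes the constant. *)
Lemma arch_le_max (v : absval R K) x (M : R) : archimedean v ->
  (forall k, nm (s k x) <= M) -> v x <= M.
Proof.
move=> av hM; have [B B0 hB] := coord_bound (det_vbasis hs).
pose e := fun i : 'I_d => (vbasis {:K})`_i.
pose B' := B * \sum_i v (e i).
have k0 : 'I_d by apply: (@Ordinal _ 0); rewrite /degree adim_gt0.
have M0 : 0 <= M by apply: le_trans (nm_ge0 _) (hM k0).
have pw n : v x ^+ n <= B' * M ^+ n.
  pose c : 'rV[rat]_d := \row_i coord (vbasis {:K}) i (x ^+ n).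
  have cE : x ^+ n = \sum_i c 0 i *: e i.
    by rewrite {1}(vbasis_comb (x ^+ n)); apply: eq_bigr => i _; rewrite mxE.
  have hc i : `|ratr (c 0 i)| <= B * M ^+ n.
    apply: hB => k; rewrite -cE rmorphXn nmX.
    by rewrite lerXn2r ?nnegrE ?nm_ge0.
  rewrite -absvalX cE; apply: le_trans (absval_sum _ _) _.
  rewrite /B' mulrAC mulr_sumr; apply: ler_sum => i _.
  by rewrite -mulr_algl absvalM av ler_wpM2r ?absval_ge0.
have [M1|] := ltP 0 M; last first.
  move=> M1; have {M1}ME : M = 0 by apply/eqP; rewrite eq_le M1 M0.
  by have := pw 1%N; rewrite ME !expr1 mulr0.
rewrite -[leRHS]mul1r -ler_pdivrMr //; apply: (@expr_bounded _ _ B') => n.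
rewrite expr_div_n ler_pdivrMr ?exprn_gt0 //; apply: le_trans (pw n) _.
have B'0 : 0 <= B' by rewrite mulr_ge0 ?(ltW B0) // sumr_ge0 // => i _; apply: absval_ge0.
by rewrite ler_wpM2r ?exprn_ge0 // -[leLHS]mulr1 ler_wpM2l // ler1n.
Qed.

(* Otherwise, with elements approximating the idempotents of K (x) R, v would
   be small on each of them, although their sum is nearly 1. *)
Lemma arch_place_emb (v : absval R K) : archimedean v ->
  exists k, forall x, v x = nm (s k x).
Proof.
move=> av; apply: contrapT => hno.
have d0 : (0 < d)%N by rewrite /degree adim_gt0.
(* If [v] were at most the [k]-th absolute value everywhere, applying this to inverses would give
   equality. Otherwise a rational number between the two values of some [z] rescales [z] to such a
   [y]. *)
have /choice[y yP] k : exists y, nm (s k y) < 1 /\ 1 < v y.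
  apply: contrapT => hy; apply: hno; exists k => x.
  have le1 z : v z <= nm (s k z).
    rewrite leNgt; apply/negP => lt.
    have [q] := rat_in_itvoo lt; rewrite in_itv /= => /andP[q1 q2].
    have q0 : 0 < ratr q :> R by apply: le_lt_trans q1; apply: nm_ge0.
    have qA : v (q%:A) = ratr q by rewrite av gtr0_norm.
    apply: hy; exists (z / q%:A); split.
      by rewrite rmorphM fmorphV emb_scalar nmM nmV nm_ratr gtr0_norm // ltr_pdivrMr // mul1r.
    by rewrite absvalM absvalV qA ltr_pdivlMr // mul1r.
  have [->|x0] := eqVneq x 0; first by rewrite rmorph0 nm0 absval0.
  apply/eqP; rewrite eq_le le1 /=; have := le1 x^-1.
  rewrite absvalV fmorphV nmV lef_pV2 // posrE.
    exact: absval_gt0.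
  by rewrite lt_neqAle nm_ge0 andbT eq_sym nm_eq0 fmorph_eq0.
(* Chosen so that the final estimate of [v 1] is at most [1/8 + 1/4]. *)
pose t : R := (8 * d%:R)^-1.
have t0 : 0 < t by rewrite invr_gt0 mulr_gt0 ?ltr0n.
have /choice[m mP] k : exists m, nm (s k (y k)) ^+ m < t.
  by case: (yP k) => h _; apply: expr_small => //; apply: nm_ge0.
pose Y := 1 + \sum_k \sum_j nm (s j (y k ^+ m k)).
have sum0 k : 0 <= \sum_j nm (s j (y k ^+ m k)).
  by apply: sumr_ge0 => j _; apply: nm_ge0.
have Y1 : 1 <= Y by rewrite lerDl; apply: sumr_ge0 => k _; apply: sum0.
have Yk j k : nm (s j (y k ^+ m k)) <= Y.
  apply: le_trans (_ : \sum_j nm (s j (y k ^+ m k)) <= _).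
    by rewrite (bigD1 j) //= lerDl; apply: sumr_ge0 => i _; apply: nm_ge0.
  rewrite /Y [X in _ <= 1 + X](bigD1 k) //= addrCA lerDl addr_ge0 //.
  by apply: sumr_ge0 => i _; apply: sum0.
pose eps := t / Y.
have eps0 : 0 < eps by rewrite divr_gt0 // (lt_le_trans ltr01).
(* The idempotent of the conjugate pair of [k], halved because the pair is met twice when [k] runs
   over all embeddings; for a real embedding the two terms coincide. Thus the sum over [k] is 1. *)
pose w k j : C := ((((j == k)%:R + (j == kp k)%:R) / 2 : R))%:C%C.
have kpK := emb_conjK hs kpE.
have /choice[e eP] k : exists x, forall j, nm (s j x - w k j) < eps.
  apply: (emb_dense hs kpE) => // j; rewrite conjc_real; congr ((_ / _)%:C)%C.
  by rewrite addrC (inj_eq (inv_inj kpK)) (can2_eq kpK kpK).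
have epst : eps <= t.
  by rewrite /eps ler_pdivrMr ?(lt_le_trans ltr01) // -[leLHS]mulr1 ler_wpM2l // ltW.
have t1 : t <= 1 / 8.
  have d1 : 1 <= d%:R :> R by rewrite ler1n.
  by rewrite /t -div1r ler_pdivrMr ?mulr_gt0 ?ltr0n //; lra.
(* Multiplying by a power of [y k] does not decrease [v] but makes the element small at [k] and its
   conjugate; at the other embeddings [eps] was chosen to beat the size [Y] of that power. *)
have ve k : v (e k) <= 2 * t.
  apply: (@le_trans _ _ (v (e k * y k ^+ m k))).
    rewrite absvalM absvalX -[leLHS]mulr1 ler_wpM2l ?absval_ge0 //.
    by rewrite exprn_ege1 // ltW; case: (yP k).
  apply: arch_le_max => // j; rewrite rmorphM nmM.
  have ej : nm (s j (e k)) <= eps + nm (w k j).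
    rewrite -[s j (e k)](subrK (w k j)); apply: le_trans (nmD _ _) _.
    by rewrite lerD2r ltW.
  have wle : nm (w k j) <= 1.
    have b1 (b : bool) : (b%:R : R) <= 1 by case: b.
    rewrite nm_real ger0_norm ?divr_ge0 ?addr_ge0 // ler_pdivrMr //.
    by have := lerD (b1 (j == k)) (b1 (j == kp k)); lra.
  have [jk|njk] := boolP ((j == k) || (j == kp k)).
    have yj : nm (s j (y k ^+ m k)) <= t.
      have -> : nm (s j (y k ^+ m k)) = nm (s k (y k)) ^+ m k.
        by case/orP: jk => /eqP ->; rewrite ?kpE ?nmJ rmorphXn nmX.
      exact/ltW/mP.
    by apply: ler_pM; rewrite ?nm_ge0 //; lra.
  move: njk ej; rewrite negb_or /w => /andP[/negPf -> /negPf ->].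
  rewrite addr0 mul0r nm_real normr0 addr0 => ej.
  apply: le_trans (_ : eps * Y <= _).
    by apply: ler_pM; rewrite ?nm_ge0.
  by rewrite /eps divfK ?lt0r_neq0 ?(lt_le_trans ltr01) //; lra.
have v1 : v (1 - \sum_k e k) <= d%:R * eps.
  apply: arch_le_max => // j; rewrite rmorphB rmorph1 rmorph_sum.
  have -> : 1 - \sum_k s j (e k) = \sum_k (w k j - s j (e k)).
    rewrite sumrB; congr (_ - _).
    rewrite -(rmorph_sum (real_complex R)) -mulr_suml big_split /=.
    rewrite (bigD1 j) //= eqxx big1 => [|k /negPf kj]; last by rewrite eq_sym kj.
    rewrite (bigD1 (kp j)) //= kpK eqxx big1 => [|k /negPf kj]; last first.
      by rewrite eq_sym (can2_eq kpK kpK) kj.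
    by rewrite !addr0 -[1 + 1]/(2%:R) mulfV ?pnatr_eq0.
  apply: le_trans (nm_sum _) _; rewrite -[d in leRHS]card_ord mulr_natl -sumr_const.
  by apply: ler_sum => k _; rewrite -nmN opprB ltW.
have : v 1 <= v (1 - \sum_k e k) + \sum_k v (e k).
  rewrite -[1 in leLHS](subrK (\sum_k e k)); apply: le_trans (absvalD _ _ _) _.
  by rewrite lerD2l absval_sum.
rewrite absval1; have : \sum_k v (e k) <= d%:R * (2 * t).
  rewrite -[d in leRHS]card_ord mulr_natl -sumr_const.
  by apply: ler_sum => k _; apply: ve.
have dt : d%:R * t = 1 / 8.
  by rewrite /t; field; rewrite pnatr_eq0 -lt0n.
have : d%:R * eps <= d%:R * t by rewrite ler_wpM2l.
by lra.
Qed.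


Section PlaceOfEmbedding.
Variable pl : 'I_d -> place R K.
Hypothesis pl_arch : forall k, archimedean (pl k).
Hypothesis plE : forall k x, pl k x = nm (s k x).

Lemma arch_place_pl (v : place R K) : archimedean v -> exists k, v = pl k.
Proof.
move=> av; have [k kE] := arch_place_emb av; exists k; apply: place_ext => x.
by rewrite plE -kE.
Qed.

(** If [j] is neither [k] nor its conjugate, density yields an element below [1/2] at [k] and at
    least [1/2] at [j]. *)
Lemma pl_eq k j : pl k = pl j <-> j = k \/ j = kp k.
Proof.
have kpK := emb_conjK hs kpE.
split=> [e|[->//|->]]; last first.
  by apply: place_ext => x; rewrite !plE kpE nmJ.
apply: contrapT => h; have [/eqP njk /eqP njk'] : j <> k /\ j <> kp k.
  by split=> jE; apply: h; [left|right].
pose w i : C := (((i == j)%:R + (i == kp j)%:R : R))%:C%C.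
have [|//|x xE] := @emb_dense _ _ _ hs _ kpE w (1 / 2).
- move=> i; rewrite conjc_real; congr (_%:C)%C.
  by rewrite addrC (inj_eq (inv_inj kpK)) (can2_eq kpK kpK).
have : nm (s k x) < 1 / 2.
  have := xE k; rewrite /w eq_sym (negPf njk) -(can2_eq kpK kpK) eq_sym.
  by rewrite (negPf njk') addr0 [(_)%:C%C](_ : _ = 0) ?subr0.
have : 1 / 2 <= nm (s j x).
  have wj : 1 <= nm (w j).
    by rewrite /w eqxx nm_real ger0_norm ?addr_ge0 // lerDl.
  have := xE j; have := nmD (s j x) (w j - s j x); rewrite addrC subrK.
  by rewrite -[nm (w j - _)]nmN opprB; lra.
by rewrite -!plE e; lra.
Qed.

Lemma nm_le_norm (a b : R) : nm (a +i* b)%C <= `|a| + `|b|.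
Proof.
have -> : (a +i* b)%C = a%:C%C + ('i * b%:C)%C :> C by rewrite [LHS]complexE.
apply: le_trans (nmD _ _) _; rewrite nmM !nm_real.
by rewrite [nm 'i%C](_ : _ = 1) ?mul1r // /nm /= expr0n add0r expr1n sqrtr1.
Qed.

Lemma re_le_nm (z : C) : `|complex.Re z| <= nm z.
Proof.
case: z => a b /=; rewrite -sqrtr_sqr ler_sqrt ?addr_ge0 ?sqr_ge0 //.
by rewrite lerDl sqr_ge0.
Qed.

Lemma im_le_nm (z : C) : `|complex.Im z| <= nm z.
Proof.
case: z => a b /=; rewrite -sqrtr_sqr ler_sqrt ?addr_ge0 ?sqr_ge0 //.
by rewrite lerDr sqr_ge0.
Qed.

Lemma rat_approx (x e : R) : 0 < e -> exists q : rat, `|x - ratr q| < e.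
Proof.
move=> e0; have [|q] := @rat_in_itvoo R (x - e) (x + e); first by lra.
by rewrite in_itv /= => /andP[h1 h2]; exists q; rewrite ltr_norml; lra.
Qed.

Lemma local_degree_pl k : local_degree (pl k) = (if kp k == k then 1 else 2)%N.
Proof.
case: eqP => [kk|/eqP nkk].
  apply: (@local_degree_eq R K (pl k) 1 (fun _ => 1) 1) => // [x e e0|c i].
    have im0 : complex.Im (s k x) = 0.
      have := kpE k x; rewrite kk; case: (s k x) => a b /= [] h.
      by move/eqP: h; rewrite -subr_eq0 => /eqP h; lra.
    have [q qE] := rat_approx (complex.Re (s k x)) e0.
    exists (fun _ => q); rewrite big_ord1 plE rmorphB emb_scalar ratr_complex.
    have -> : s k x = (complex.Re (s k x))%:C%C by move: im0; case: (s k x) => a b /= ->.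
    by rewrite -rmorphB nm_real.
  by rewrite big_ord1 mul1r (ord1 i).
have [x ximg] : exists x, complex.Im (s k x) != 0.
  apply: contrapT => h; move/eqP: nkk; apply; apply: (emb_inj hs) => x; rewrite kpE.
  have im0 : complex.Im (s k x) = 0.
    by apply/eqP/negPn/negP => hx; apply: h; exists x.
  by move: im0; case: (s k x) => a b /= ->; rewrite oppr0.
set z := s k x in ximg; set b := complex.Im z in ximg; set a := complex.Re z.
have b0 : 0 < `|b| by rewrite normr_gt0.
have sumE (c : 'I_2 -> rat) :
    s k (\sum_i c i *: (if i == ord0 then 1 else x)) =
    ((ratr (c ord0) + ratr (c ord_max) * a) +i* (ratr (c ord_max) * b))%C.
  rewrite big_ord_recr big_ord1 /= rmorphD !emb_scale rmorph1 mulr1.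
  rewrite (_ : widen_ord _ _ = ord0); last exact: val_inj.
  rewrite !ratr_complex -/z [z]complexE -/a -/b.
  by apply/eqP; rewrite eq_complex /=; apply/andP; split; apply/eqP; ring.
(* Solving for the coordinates in the real basis formed by 1 and [z = a + i b] bounds each by [L]
   times the modulus of the combination. *)
pose L := 1 + (1 + `|a|) / `|b|.
have L0 : 0 < L by rewrite ltr_pwDl // divr_ge0 ?addr_ge0.
apply: (@local_degree_eq R K (pl k) 2 (fun i => if i == ord0 then 1 else x) L^-1).
- by rewrite invr_gt0.
- move=> y e e0; set Y := s k y.
  pose e' := e / 2 / (1 + `|a| + `|b|).
  have D0 : 0 < 1 + `|a| + `|b| by rewrite -addrA ltr_pwDl // addr_ge0.
  have e'0 : 0 < e' by rewrite !divr_gt0.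
  have [q1 q1E] := rat_approx (complex.Im Y / b) e'0.
  have e20 : 0 < e / 2 by rewrite divr_gt0.
  have [q0 q0E] := rat_approx (complex.Re Y - ratr q1 * a) e20.
  exists (fun i => if i == ord0 then q0 else q1); rewrite plE rmorphB sumE /= -/Y.
  have -> : Y - ((ratr q0 + ratr q1 * a) +i* (ratr q1 * b))%C =
      ((complex.Re Y - (ratr q0 + ratr q1 * a)) +i* (complex.Im Y - ratr q1 * b))%C.
    by case: (Y).
  apply: le_lt_trans (nm_le_norm _ _) _.
  have h1 : `|complex.Im Y - ratr q1 * b| < e / 2.
    have -> : complex.Im Y - ratr q1 * b = (complex.Im Y / b - ratr q1) * b.
      by rewrite mulrBl divfK.
    rewrite normrM; apply: lt_le_trans (_ : e' * `|b| <= _).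
      by rewrite ltr_pM2r.
    rewrite /e' mulrAC ler_pdivrMr // ler_wpM2l ?(ltW e20) //.
    by rewrite lerDr addr_ge0.
  have h2 : `|complex.Re Y - (ratr q0 + ratr q1 * a)| < e / 2.
    by rewrite opprD addrA addrAC.
  by lra.
- move=> c i; rewrite [pl k (\sum_j _)]plE sumE (pl_arch k) ler_pdivrMl //.
  set W := nm _.
  have im := im_le_nm ((ratr (c ord0) + ratr (c ord_max) * a) +i* (ratr (c ord_max) * b))%C.
  have re := re_le_nm ((ratr (c ord0) + ratr (c ord_max) * a) +i* (ratr (c ord_max) * b))%C.
  move: im re; rewrite /= -/W normrM => im re.
  have c1 : `|ratr (c ord_max)| <= W / `|b| by rewrite ler_pdivlMr.
  have W0 : 0 <= W by apply: nm_ge0.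
  have c0 : `|ratr (c ord0)| <= W + W / `|b| * `|a|.
    have -> : ratr (c ord0) = (ratr (c ord0) + ratr (c ord_max) * a) - ratr (c ord_max) * a :> R.
      by rewrite addrK.
    apply: le_trans (ler_normB _ _) _; apply: lerD => //.
    by rewrite normrM ler_wpM2r.
  have LW : L * W = W + W / `|b| + W / `|b| * `|a|.
    by rewrite /L; field; rewrite lt0r_neq0.
  have Wb : 0 <= W / `|b| by rewrite divr_ge0.
  have Wba : 0 <= W / `|b| * `|a| by rewrite mulr_ge0.
  have : i = ord0 \/ i = ord_max.
    by case: i => -[|[|//]] ?; [left|right]; apply: val_inj.
  by rewrite LW => -[->|->]; lra.
Qed.

Lemma finite_arch : finite_set [set v : place R K | archimedean v].
Proof.
have -> : [set v : place R K | archimedean v]%classic = (pl @` [set: 'I_d])%classic.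
  apply/seteqP; split=> [v /= /arch_place_pl[k ->]|v /= [k _ <-] //].
  by exists k.
exact: finite_image.
Qed.

(** The fibre of [pl] over an archimedean place has one element or a conjugate pair, according to
    its local degree. *)
Lemma prod_arch (G : place R K -> R) :
  \prod_k G (pl k) =
  \big[*%R/1]_(v \in [set v : place R K | archimedean v]) G v ^+ local_degree v.
Proof.
rewrite fsbig_finite /=; last exact: finite_arch.
set S := finmap.enum_fset _.
have memS v : (v \in S) = `[< archimedean v >].
  by rewrite in_fset_set ?mem_setE //; exact: finite_arch.
transitivity (\prod_(v <- S) \prod_(k | pl k == v) G (pl k)).
  rewrite (exchange_big_dep xpredT) //=; apply: eq_bigr => k _.
  have kS : pl k \in S by rewrite memS; apply/asboolP.
  rewrite big_mkcond (bigD1_seq (pl k)) ?finmap.fset_uniq //= eqxx.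
  by rewrite big1 ?mulr1 // => v /negPf nv; rewrite eq_sym nv.
apply: eq_big_seq => v; rewrite memS => /asboolP/arch_place_pl[k ->].
under eq_bigr => j /eqP -> do [].
rewrite prodr_const local_degree_pl; congr (_ ^+ _).
case: eqP => [kk|/eqP nkk].
  rewrite -(card1 k); apply: eq_card => j; rewrite !inE.
  by apply/asboolP/eqP => [/esym/pl_eq[]|->//]; rewrite ?kk.
rewrite -[RHS](_ : #|pred2 k (kp k)| = 2%N); last first.
  by rewrite card2 eq_sym nkk.
apply: eq_card => j; rewrite !inE.
apply/asboolP/orP => [/esym/pl_eq[]->|[]/eqP ->]; rewrite ?eqxx; auto.
by apply/esym/pl_eq; right.
Qed.

(** With weight 2 at complex places and 1 at real ones, the product over the embeddings is [4 ^+ r2]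
    and at most [2 ^+ d]. *)
Lemma complex_places_le : (2 * num_complex_places R K <= d)%N.
Proof.
pose G (v : place R K) : R := if local_degree v == 2%N then 2 else 1.
have h : \prod_k G (pl k) <= 2 ^+ d.
  rewrite -[d in X in _ <= X]card_ord -prodr_const; apply: ler_prod => k _.
  by rewrite /G; case: ifP => _; apply/andP; split; lra.
rewrite prod_arch in h.
have : (4 : R) ^+ num_complex_places R K <= 2 ^+ d.
  apply: le_trans h; rewrite le_eqVlt; apply/orP; left; apply/eqP.
  have fin2 : finite_set [set v : place R K | archimedean v /\ local_degree v = 2%N].
    by apply: sub_finite_set finite_arch => v [].
  rewrite -(fsbig_widen [set v : place R K | archimedean v /\ local_degree v = 2%N]%classic).
  - rewrite fsbig_finite //= /num_complex_places.
    rewrite (eq_big_seq (fun=> 4)); last first.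
      move=> v; rewrite in_fset_set // inE => -[_ v2].
      by rewrite /G v2 eqxx expr2; ring.
    by rewrite big_const_seq count_predT iter_mulr mulr1.
  - by move=> v [].
  - by move=> v [/= av nv]; rewrite /G; case: eqP => [v2|_]; [case: nv|rewrite expr1n].
rewrite (_ : 4 = 2 ^+ 2) -?exprM; last by ring.
by rewrite ler_eXn2l // ltr1n.
Qed.

End PlaceOfEmbedding.
End ArchimedeanPlaces.

(** * Maximal ideals and finite places *)

Section Index.
Variable E : zmodType.
Implicit Types A B D : E -> Prop.

Definition is_subgroup A := A 0 /\ forall x y, A x -> A y -> A (x - y).

(** No quotient group is formed: a finite index is witnessed by a complete irredundant system of
    representatives. *)
Definition has_index A B (k : nat) := exists r : 'I_k -> E,
  (forall i, A (r i)) /\ forall x, A x -> exists! i, B (x - r i).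

Lemma subgrpN A x : is_subgroup A -> A x -> A (- x).
Proof. by move=> [A0 AB]; apply: subgroupN. Qed.

Lemma subgrpD A x y : is_subgroup A -> A x -> A y -> A (x + y).
Proof. by move=> [A0 AB]; apply: subgroupD. Qed.

Lemma has_index_fin A B (T : finType) (r : T -> E) : (forall t, A (r t)) ->
  (forall x, A x -> exists! t, B (x - r t)) -> has_index A B #|T|.
Proof.
move=> Ar rU; exists (fun i => r (enum_val i)); split=> // x /rU[t [tB tU]].
exists (enum_rank t); split; first by rewrite enum_rankK.
by move=> i /tU ->; rewrite enum_valK.
Qed.

Lemma index_mul A B D k k' : is_subgroup B -> is_subgroup D ->
  (forall x, B x -> A x) -> (forall x, D x -> B x) -> is_subgroup A ->
  has_index A B k -> has_index B D k' -> has_index A D (k * k').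
Proof.
move=> sB sD BA DB sA [r [Ar rU]] [r' [Br' rU']].
have := @has_index_fin A D ('I_k * 'I_k')%type (fun t => r t.1 + r' t.2).
rewrite card_prod !card_ord; apply=> [t|x Ax]; first by apply: subgrpD; auto.
have [i [iB iU]] := rU x Ax; have [j [jD jU]] := rU' _ iB.
exists (i, j); split=> /= [|[i' j'] /= h]; first by rewrite opprD addrA.
have ii : i = i'.
  apply: iU; rewrite -[x - r i'](subrK (r' j')); apply: subgrpD => //.
  by apply: DB; rewrite -addrA -opprD.
by rewrite -ii in h *; rewrite (jU j') // -addrA -opprD.
Qed.

Lemma index_le A A' B k : is_subgroup A -> (forall x, A x -> A' x) ->
  (forall x, B x -> A x) -> has_index A' B k ->
  exists2 k', (k' <= k)%N & has_index A B k'.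
Proof.
move=> sA AA' BA [r [Ar rU]].
pose T := {i : 'I_k | `[< A (r i) >]}.
have rA (t : T) : A (r (val t)) by apply: asboolW (valP t).
exists #|{: T}|; first by rewrite card_sig -[leqRHS]card_ord max_card.
apply: (@has_index_fin A B T (fun t => r (val t))) => // x Ax.
have [i [iB iU]] := rU x (AA' x Ax).
have Ari : `[< A (r i) >].
  apply/asboolP; have -> : r i = x - (x - r i) by rewrite subKr.
  by apply: sA.2 => //; apply: BA.
exists (Sub i Ari); split=> [|t /iU it]; first by rewrite SubK.
by apply: val_inj; rewrite SubK.
Qed.

Lemma index_coarse A B D k : is_subgroup D -> (forall x, B x -> D x) ->
  has_index A B k -> exists k', has_index A D k'.
Proof.
move=> sD BD [r [Ar rU]].
pose e i j := `[< D (r i - r j) >].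
pose rep i := odflt i [pick j | e i j].
have erep i : D (r i - r (rep i)).
  rewrite /rep; case: pickP => [j /asboolP //|/(_ i)/asboolP []].
  by rewrite subrr; exact: sD.1.
have repE i j : D (r i - r j) -> rep i = rep j.
  move=> Dij; have ee l : e i l = e j l.
    apply/asboolP/asboolP => h.
      have -> : r j - r l = (r i - r l) - (r i - r j) by rewrite opprB [RHS]addrC addrA subrK.
      exact: sD.2.
    have -> : r i - r l = (r i - r j) + (r j - r l) by rewrite addrA subrK.
    exact: subgrpD.
  rewrite /rep (eq_pick ee); case: pickP => // /(_ j)/asboolP[].
  by rewrite subrr; exact: sD.1.
pose T := {i : 'I_k | rep i == i}.
exists #|{: T}|; apply: (@has_index_fin A D T (fun t => r (val t))) => // x Ax.
have [i [iB _]] := rU x Ax.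
have rri : rep (rep i) == rep i.
  by apply/eqP/esym/repE/erep.
exists (exist (fun i => is_true (rep i == i)) (rep i) rri); split=> [|t tD] /=.
  have -> : x - r (rep i) = (x - r i) + (r i - r (rep i)).
    by rewrite addrA subrK.
  by apply: subgrpD => //; apply: BD.
apply: val_inj; rewrite /= -[RHS](eqP (valP t)); apply: repE.
have -> : r i - r (val t) = (x - r (val t)) - (x - r i).
  by rewrite opprB [RHS]addrC addrA subrK.
by apply: sD.2 => //; apply: BD.
Qed.

(** Serves the arguments by minimal index: for nested subgroups of equal index over [B], the
    injection between representatives is bijective and the subgroups coincide. *)
Lemma index_inj A A' B k k' : is_subgroup B -> (forall x, A x -> A' x) ->
  (forall x, B x -> A x) -> is_subgroup A ->
  has_index A B k -> has_index A' B k' ->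
  (k <= k')%N /\ (k = k' -> forall x, A' x -> A x).
Proof.
move=> sB AA' BA sA [r [Ar rU]] [r' [Ar' rU']].
have /choice[f fE] i : exists j, B (r i - r' j).
  by have [j [jB _]] := rU' _ (AA' _ (Ar i)); exists j.
have fI : injective f.
  move=> i j fij; have [l [_ lU]] := rU _ (Ar i).
  rewrite -(lU i) ?subrr; last exact: sB.1.
  apply: lU; have -> : r i - r j = (r i - r' (f i)) - (r j - r' (f j)).
    by rewrite fij opprB addrA subrK.
  exact: sB.2.
split; first by have := leq_card f fI; rewrite !card_ord.
move=> kk; move: r' Ar' rU' f fE fI; rewrite -kk => r' Ar' rU' f fE fI x A'x.
have [j [jB _]] := rU' x A'x; have [g _ fg] := injF_bij fI.
have -> : x = (x - r' j) - (r (g j) - r' j) + r (g j).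
  by rewrite opprB addrA subrK subrK.
apply: subgrpD => //; apply: BA; apply: sB.2 => //.
by rewrite -{2}(fg j).
Qed.

Lemma index_uniq A B k k' : is_subgroup A -> is_subgroup B ->
  (forall x, B x -> A x) -> has_index A B k -> has_index A B k' -> k = k'.
Proof.
move=> sA sB BA h h'; apply/eqP; rewrite eqn_leq.
by apply/andP; split; [have [] := index_inj sB (fun x => id) BA sA h h'
                      |have [] := index_inj sB (fun x => id) BA sA h' h].
Qed.

Lemma index_pigeon A B k (f : nat -> E) : is_subgroup B -> has_index A B k ->
  (forall n, A (f n)) -> exists i j, (i < j)%N /\ B (f j - f i).
Proof.
move=> sB [r [Ar rU]] Af.
have /choice[c cE] n : exists i, B (f n - r i).
  by have [i [iB _]] := rU _ (Af n); exists i.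
have /injectivePn[i [j nij cij]] : ~~ injectiveb (fun n : 'I_k.+1 => c n).
  by apply/negP => /injectiveP/leq_card; rewrite !card_ord ltnn.
have cc (a b : nat) : c a = c b -> B (f b - f a).
  move=> cab; have -> : f b - f a = (f b - r (c b)) - (f a - r (c a)).
    by rewrite cab opprB addrA subrK.
  exact: sB.2.
have : (i != j :> nat) by [].
case: ltngtP => // lt _; [exists i, j|exists j, i]; split=> //; apply: cc => //.
Qed.

Lemma index1 A B : is_subgroup A -> is_subgroup B -> (forall x, B x -> A x) ->
  has_index A B 1 -> forall x, A x -> B x.
Proof.
move=> sA sB BA [r [Ar rU]] x Ax.
have [i [iB _]] := rU x Ax; have [j [jB _]] := rU 0 sA.1.
rewrite -[x](subrK (r i)); apply: subgrpD => //.
by have := subgrpN sB jB; rewrite sub0r opprK (ord1 j) (ord1 i).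
Qed.

End Index.

Lemma index_vec (K : fieldType) (A B : K -> Prop) k l :
  has_index A B k ->
  has_index (fun x : 'rV[K]_l => forall i, A (x 0 i))
            (fun x : 'rV[K]_l => forall i, B (x 0 i)) (k ^ l).
Proof.
move=> [r [Ar rU]].
have := @has_index_fin _ (fun x : 'rV[K]_l => forall i, A (x 0 i))
  (fun x : 'rV[K]_l => forall i, B (x 0 i)) {ffun 'I_l -> 'I_k}
  (fun t => \row_i r (t i)).
rewrite card_ffun !card_ord; apply=> [t i|x Ax]; first by rewrite mxE.
have /choice[c cE] i := rU _ (Ax i).
exists [ffun i => c i]; split=> [i|t tB].
  by rewrite !mxE ffunE; case: (cE i).
by apply/ffunP => i; rewrite ffunE; case: (cE i) => _; apply; have := tB i; rewrite !mxE.
Qed.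

Section MaximalIdeals.
Variables (R : realType) (K : fieldExtType rat).
Local Notation d := (degree K).
Local Notation O := (@algebraic_integer K).

Definition is_submodule (E : lmodType K) (M : E -> Prop) :=
  is_subgroup M /\ forall a x, O a -> M x -> M (a *: x).

(** Maximality is stated as invertibility modulo [p]; the positive integer in [p] excludes the zero
    ideal. *)
Definition is_maxideal (p : K -> Prop) :=
  [/\ is_subgroup p, forall x, p x -> O x, forall a x, O a -> p x -> p (a * x),
      ~ p 1 /\ (exists2 m : nat, (0 < m)%N & p m%:R) &
      forall b, O b -> ~ p b -> exists2 c, O c & p (1 - c * b)].

Definition multiples (m : nat) (x : K) := exists2 y, O y & x = m%:R * y.

Lemma ai_subgroup : is_subgroup O.
Proof. by split; [exact: ai0|exact: aiB]. Qed.

Lemma multiples_subgroup m : is_subgroup (multiples m).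
Proof.
split; first by exists 0; [exact: ai0|rewrite mulr0].
by move=> _ _ [x Ox ->] [y Oy ->]; exists (x - y); [exact: aiB|rewrite mulrBr].
Qed.

Lemma multiples_ai m x : multiples m x -> O x.
Proof. by move=> [y Oy ->]; apply: aiM => //; exact: ai_nat. Qed.

Lemma natK_neq0 m : (0 < m)%N -> (m%:R : K) != 0.
Proof. by move=> m0; rewrite -(rmorph_nat (in_alg K)) fmorph_eq0 pnatr_eq0 -lt0n. Qed.

Lemma index_multiples m : (0 < m)%N -> has_index O (multiples m) (m ^ d).
Proof.
move=> m0; have [s hs] := all_embeddings_exist R K.
have [w [[Ow hw] dw _]] := discriminant_basis hs.
have := @has_index_fin _ O (multiples m) {ffun 'I_d -> 'I_m}
  (fun t => \sum_i w i *~ (t i : nat)).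
rewrite card_ffun !card_ord; apply=> [t|x Ox].
  by apply: ai_sum => i _; rewrite -mulrzr; apply: aiM => //; exact: ai_int.
have [c [cE _]] := hw x Ox.
have m0' : (m%:Z != 0) by rewrite -lt0n.
have lt i : (`|(c i %% m)%Z| < m)%N.
  by have := ltz_mod (c i) m0'; have := modz_ge0 (c i) m0'; lia.
exists [ffun i => Ordinal (lt i)]; split.
  exists (\sum_i w i *~ (c i %/ m)%Z).
    by apply: ai_sum => i _; rewrite -mulrzr; apply: aiM => //; exact: ai_int.
  rewrite cE -sumrB mulr_sumr; apply: eq_bigr => i _; rewrite ffunE /=.
  rewrite gez0_abs ?modz_ge0 // {1}(divz_eq (c i) m) mulrzDr addrK.
  by rewrite mulrzA mulr_natl pmulrn.
move=> t [y Oy yE]; apply/ffunP => i; rewrite ffunE; apply: val_inj => /=.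
have [c' [c'E _]] := hw y Oy.
have [c0 [c0E c0U]] := hw x Ox.
have e1 : c = c0 by apply/esym/c0U.
have e2 : c0 = [ffun i => (t i : nat)%:Z + m%:Z * c' i].
  apply: c0U; move/eqP: yE; rewrite subr_eq => /eqP ->; rewrite c'E mulr_sumr -big_split.
  apply: eq_bigr => j _; rewrite ffunE mulrzDr addrC; congr (_ + _).
  by rewrite mulrzA mulrzAC mulr_natl.
rewrite e1 e2 ffunE addrC [m%:Z * _]mulrC modzMDl modz_small ?absz_nat //.
by rewrite /= ltz_nat ltn_ord.
Qed.

Lemma maxideal_prime p a b : is_maxideal p -> O a -> O b -> p (a * b) -> p a \/ p b.
Proof.
move=> [sp pO pM _ pmax] Oa Ob pab.
have [pa|npa] := pselect (p a); [by left|right].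
have [c Oc pc] := pmax a Oa npa.
have -> : b = b * (1 - c * a) + c * (a * b) by ring.
by apply: subgrpD => //; apply: pM.
Qed.

Lemma maxideal_sub p p' : is_maxideal p -> is_maxideal p' ->
  (forall x, p x -> p' x) -> forall x, p' x -> p x.
Proof.
move=> [sp pO pM [np1 _] pmax] [sp' pO' pM' [np1' _] pmax'] pp' x p'x.
apply: contrapT => npx; have [c Oc pc] := pmax x (pO' x p'x) npx.
apply: np1'; rewrite -(subrK (c * x) 1); apply: subgrpD => //; first exact: pp'.
exact: pM'.
Qed.

Definition add_cyclic (E : lmodType K) (M : E -> Prop) (z x : E) :=
  exists2 a, O a & M (x - a *: z).

Lemma add_cyclic_submodule (E : lmodType K) (M : E -> Prop) z :
  is_submodule M -> is_submodule (add_cyclic M z).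
Proof.
move=> [sM aM]; split; first split.
- by exists 0; [exact: ai0|rewrite scale0r subrr; exact: sM.1].
- move=> x y [a Oa ha] [b Ob hb]; exists (a - b); first exact: aiB.
  have -> : x - y - (a - b) *: z = (x - a *: z) - (y - b *: z).
    by rewrite scalerBl !opprB addrACA [RHS]addrACA; congr (_ + _); exact: addrC.
  exact: sM.2.
- move=> b x Ob [a Oa ha]; exists (b * a); first exact: aiM.
  by rewrite -scalerA -scalerBr; apply: aM.
Qed.

Lemma add_cyclic_sub (E : lmodType K) (M : E -> Prop) z x : M x -> add_cyclic M z x.
Proof. by exists 0; [exact: ai0|rewrite scale0r subr0]. Qed.

Lemma add_cyclic_gen (E : lmodType K) (M : E -> Prop) z :
  is_submodule M -> add_cyclic M z z.
Proof. by move=> sM; exists 1; [exact: ai1|rewrite scale1r subrr; exact: sM.1.1]. Qed.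

Lemma add_cyclic_min (E : lmodType K) (M L : E -> Prop) z : is_submodule L ->
  (forall x, M x -> L x) -> L z -> forall x, add_cyclic M z x -> L x.
Proof.
move=> [sL aL] ML Lz x [a Oa h]; rewrite -(subrK (a *: z) x).
by apply: subgrpD => //; [exact: ML|exact: aL].
Qed.

Definition annihilator (E : lmodType K) (M : E -> Prop) z (a : K) :=
  O a /\ M (a *: z).

(* If O z + M has minimal index over M then it is simple modulo M. *)
Lemma annihilator_maxideal (E : lmodType K) (M L : E -> Prop) k :
  is_submodule M -> is_submodule L -> (forall x, M x -> L x) ->
  has_index L M k -> (exists2 x, L x & ~ M x) ->
  exists z, [/\ L z, ~ M z & is_maxideal (annihilator M z)].
Proof.
move=> mM mL ML hk [x Lx nMx].
have cyc_idx y : L y -> exists2 k', (k' <= k)%N & has_index (add_cyclic M y) M k'.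
  move=> Ly; apply: index_le hk.
  - by case: (add_cyclic_submodule y mM).
  - exact: add_cyclic_min.
  - exact: add_cyclic_sub.
pose P n := `[< exists y, [/\ L y, ~ M y & has_index (add_cyclic M y) M n] >].
have exP : exists n, P n.
  by have [k' _ hk'] := cyc_idx x Lx; exists k'; apply/asboolP; exists x.
have [n /asboolP[z [Lz nMz hz]] nmin] := ex_minnP exP.
exists z; split=> //; split.
- split; first by split; [exact: ai0|rewrite scale0r; exact: mM.1.1].
  by move=> a b [Oa ha] [Ob hb]; split; [exact: aiB|rewrite scalerBl; exact: mM.1.2].
- by move=> a [].
- by move=> a b Oa [Ob hb]; split; [exact: aiM|rewrite -scalerA; exact: mM.2].
- split; first by case=> _; rewrite scale1r.
  have [i [j [ij hij]]] := index_pigeon (f := fun n => n%:R *: z) mM.1 hk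
    (fun n => mL.2 _ _ (ai_nat K n) Lz).
  exists (j - i)%N; first by rewrite subn_gt0.
  by split; [exact: ai_nat|rewrite natrB ?scalerBl // ltnW].
- move=> b Ob nb; have nMbz : ~ M (b *: z) by move=> h; apply: nb.
  have Lbz : L (b *: z) by exact: mL.2.
  have [k' _ hk'] := cyc_idx _ Lbz.
  have sub u : add_cyclic M (b *: z) u -> add_cyclic M z u.
    apply: add_cyclic_min; first exact: add_cyclic_submodule.
      by move=> ? ?; apply: add_cyclic_sub.
    by apply: (add_cyclic_submodule z mM).2 => //; apply: add_cyclic_gen.
  (* By minimality [b *: z] generates over [M] as much as [z] does; expressing [z] through it
     inverts [b] modulo the annihilator. *)
  have [le eq] := index_inj mM.1 sub (@add_cyclic_sub _ _ _) (add_cyclic_submodule _ mM).1 hk' hz.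
  have kn : k' = n.
    by apply/eqP; rewrite eqn_leq le; apply: nmin; apply/asboolP; exists (b *: z).
  have [c Oc hc] := eq kn z (add_cyclic_gen z mM).
  exists c => //; split; first by apply: aiB; [exact: ai1|exact: aiM].
  by rewrite scalerBl scale1r -scalerA.
Qed.

(** Multiplication by [z] identifies [O] modulo the annihilator with [M + O z] modulo [M]. *)
Lemma index_annihilator (E : lmodType K) (M : E -> Prop) z q : is_submodule M ->
  has_index (add_cyclic M z) M q -> has_index O (annihilator M z) q.
Proof.
move=> mM [r [Ar rU]].
have /choice[a aE] i : exists a, O a /\ M (r i - a *: z).
  by have [a Oa h] := Ar i; exists a.
exists a; split=> [i|b Ob]; first by case: (aE i).
have bz : add_cyclic M z (b *: z).
  by apply: (add_cyclic_submodule z mM).2 => //; apply: add_cyclic_gen.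
have [i [iM iU]] := rU _ bz; exists i; split.
  split; first by apply: aiB => //; case: (aE i).
  have -> : (b - a i) *: z = (b *: z - r i) + (r i - a i *: z).
    by rewrite scalerBl addrA subrK.
  by apply: (subgrpD mM.1) => //; case: (aE i).
move=> j [_ hj]; apply: iU.
have -> : b *: z - r j = (b - a j) *: z - (r j - a j *: z).
  by rewrite scalerBl opprB addrA subrK.
by apply: mM.1.2 => //; case: (aE j).
Qed.

(** Two of the integers [t ^+ k * m] agree modulo [m]; dividing the congruence by [m] gives a monic
    equation for [t]. *)
Lemma power_bounded_ai t m : (0 < m)%N -> (forall k, O (t ^+ k * m%:R)) -> O t.
Proof.
move=> m0 tm.
have [i [j [ij [a Oa aE]]]] := index_pigeon (multiples_subgroup m) (index_multiples m0) tm.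
have tE : t ^+ j - t ^+ i = a.
  apply: (mulfI (natK_neq0 m0)); rewrite -aE mulrC mulrBl //.
pose q : {poly K} := 'X^j - ('X^i + a%:P).
have sq : (size (- ('X^i + a%:P : {poly K})) < size ('X^j : {poly K}))%N.
  rewrite size_polyN size_polyXn; apply: leq_ltn_trans (size_polyD _ _) _.
  rewrite size_polyXn gtn_max ltnS ij; apply: leq_ltn_trans (size_polyC_leq1 _) _.
  by rewrite ltnS; apply: leq_ltn_trans ij.
apply: (@ai_monic_root _ t q).
- by rewrite monicE lead_coefDl // lead_coefXn.
- by rewrite !hornerE -tE addrCA subrr addr0 subrr.
- move=> n; rewrite coefB coefD !coefXn coefC.
  by apply: aiB; [|apply: aiD]; [exact: ai_nat|exact: ai_nat|case: ifP => _ //; exact: ai0].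
Qed.

Section Uniformizer.
Variable p : K -> Prop.
Hypothesis mp : is_maxideal p.

(** It suffices to find [z] outside [m O] with [p z] inside, and to take [t = z / m]. Such a [z] has
    annihilator [p] modulo [m]; the difficulty is to obtain [p] rather than another maximal ideal
    containing [m]. *)
Lemma maxideal_inverse : exists2 t, ~ O t & forall a, p a -> O (t * a).
Proof.
have [sp pO pM [np1 [m m0 pm]] pmax] := mp.
have mOp x : multiples m x -> p x.
  by move=> [y Oy ->]; rewrite mulrC; apply: pM.
have mM : @is_submodule K^o (multiples m).
  split; first exact: multiples_subgroup.
  move=> a _ Oa [y Oy ->]; exists (a * y); first exact: aiM.
  by rewrite mulrCA.
have mO : @is_submodule K^o O.
  by split; [exact: ai_subgroup|move=> a x; exact: aiM].
pose S s := @add_cyclic K^o (multiples m) s.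
have S_idx s : O s -> exists k, has_index (S s) (multiples m) k.
  move=> Os; have [k _ hk] := index_le (add_cyclic_submodule (s : K^o) mM).1
    (add_cyclic_min mO (@multiples_ai m) Os) (@add_cyclic_sub K^o _ s)
    (index_multiples m0).
  by exists k.
(* Multiplying by elements outside [p] shrinks [O / m O] to its part at [p]; minimal index means
   that this part has been reached. *)
pose P n := `[< exists s, [/\ O s, ~ p s & has_index (S s) (multiples m) n] >].
have exP : exists n, P n.
  have [k hk] := S_idx 1 (ai1 K); exists k; apply/asboolP.
  by exists 1; split=> //; exact: ai1.
have [n /asboolP[s [Os nps hs]] nmin] := ex_minnP exP.
have [|z [Sz nz mz]] := annihilator_maxideal mM (add_cyclic_submodule (s : K^o) mM)
    (@add_cyclic_sub K^o _ s) hs.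
  exists s; first exact: (add_cyclic_gen (s : K^o) mM).
  by move=> /mOp.
have Oz : O z by apply: (add_cyclic_min mO (@multiples_ai m) Os Sz).
(* An annihilating [s'] outside [p] would make [s * s'] another candidate; by minimality it
   generates [s] modulo [m], so [s'] acts invertibly on [z], which is then a multiple of [m]. *)
have sub : forall x, @annihilator K^o (multiples m) z x -> p x.
  move=> s' [Os' hs']; apply: contrapT => nps'.
  have npss : ~ p (s * s') by move=> /(maxideal_prime mp Os Os')[].
  have Oss := aiM Os Os'; have [k hk] := S_idx _ Oss.
  have sub u : S (s * s') u -> S s u.
    apply: (add_cyclic_min (add_cyclic_submodule (s : K^o) mM)).
      by move=> ? ?; apply: (@add_cyclic_sub K^o).
    exists s' => //; rewrite /GRing.scale /= mulrC subrr; exact: mM.1.1.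
  have [le eq] := index_inj mM.1 sub (@add_cyclic_sub K^o _ _)
    (add_cyclic_submodule (_ : K^o) mM).1 hk hs.
  have kn : k = n.
    by apply/eqP; rewrite eqn_leq le; apply: nmin; apply/asboolP; exists (s * s').
  have [b Ob [e Oe bE]] := eq kn s (add_cyclic_gen (s : K^o) mM).
  have [a Oa [e' Oe' aE]] := Sz.
  apply: nz; have [f Of fE] := hs'.
  rewrite /GRing.scale /= in bE aE fE.
  have -> : z = b * (s' * z) + ((z - a * s) * (1 - b * s') + a * (s - b * (s * s'))).
    by ring.
  rewrite aE bE fE; exists (b * f + (e' * (1 - b * s') + a * e)); last by ring.
  apply: aiD; [exact: aiM|apply: aiD; apply: aiM => //].
  by apply: aiB; [exact: ai1|exact: aiM].
exists (z / m%:R).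
  move=> Ot; apply: nz; exists (z / m%:R) => //.
  by rewrite mulrC divfK // natK_neq0.
move=> a /(maxideal_sub mz mp sub)[_ [y Oy yE]].
rewrite /GRing.scale /= in yE; rewrite mulrAC [z * a]mulrC yE mulrAC mulfV ?natK_neq0 //.
by rewrite mul1r.
Qed.

(** If [t] mapped [p] into itself, all [t ^+ k * m] would be integral for an integer [m] in [p], and
    [t] would be integral by [power_bounded_ai]. *)
Lemma uniformizer_exists : exists t pi,
  [/\ forall a, p a -> O (t * a), p pi & ~ p (t * pi)].
Proof.
have [t nOt tp] := maxideal_inverse.
have [[pi ppi npi]|h] := pselect (exists2 pi, p pi & ~ p (t * pi)).
  by exists t, pi.
have tpp a : p a -> p (t * a) by move=> pa; apply: contrapT => na; apply: h; exists a.
have [_ pO _ [_ [m m0 pm]] _] := mp.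
case: nOt; apply: (@power_bounded_ai t m) => // k; apply: pO.
by elim: k => [|k IH]; rewrite ?expr0 ?mul1r // exprS -mulrA; apply: tpp.
Qed.

Variables (t pi : K).
Hypotheses (tp : forall a, p a -> O (t * a)) (ppi : p pi) (npi : ~ p (t * pi)).

Lemma inverse_not_ai : ~ O t.
Proof. by case: mp => _ _ pM _ _ Ot; apply: npi; apply: pM. Qed.

(** If multiplication by [t] never left [p], all [t ^+ k * x] would be integral; multiplying by an
    integral multiple of [x^-1] bounds the denominators of the powers of [t]. *)
Lemma order_exists x : O x -> x != 0 ->
  exists k, [/\ forall j, (j <= k)%N -> O (t ^+ j * x) & ~ p (t ^+ k * x)].
Proof.
move=> Ox x0; apply: contrapT => h.
have all k : (forall j, (j <= k)%N -> O (t ^+ j * x)) /\ p (t ^+ k * x).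
  elim: k => [|k [IH1 IH2]].
    split=> [j|]; first by rewrite leqn0 => /eqP ->; rewrite expr0 mul1r.
    apply: contrapT => np; apply: h; exists 0%N; split=> // j.
    by rewrite leqn0 => /eqP ->; rewrite expr0 mul1r.
  have Ok : O (t ^+ k.+1 * x) by rewrite exprS -mulrA; apply: tp.
  have allj j : (j <= k.+1)%N -> O (t ^+ j * x).
    by rewrite leq_eqVlt => /orP[/eqP ->|/IH1].
  by split=> //; apply: contrapT => np; apply: h; exists k.+1.
have [m m0 Om] := ai_multiple x^-1.
apply: inverse_not_ai; apply: (@power_bounded_ai t m) => // k.
have -> : t ^+ k * m%:R = (m%:R * x^-1) * (t ^+ k * x).
  by rewrite [RHS]mulrCA -mulrA mulVf // mulr1.
by apply: aiM => //; case: (all k) => /(_ k (leqnn k)).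
Qed.

End Uniformizer.
End MaximalIdeals.

(** * The valuation and the local degree at a finite place *)

Section PadicValue.
Variables (R : realType) (K : fieldExtType rat) (v : absval R K) (l : nat).
Hypotheses (pl : prime l) (hv : padic l v).
Local Notation d := (degree K).
Local Notation O := (@algebraic_integer K).

Let l0 : 0 < (l%:R : R). Proof. by rewrite ltr0n prime_gt0. Qed.
Let l1 : 1 < (l%:R : R). Proof. by rewrite ltr1n prime_gt1. Qed.

Lemma padic_int (z : int) : z != 0 -> v z%:~R = l%:R ^- logn l `|z|%N.
Proof.
move=> z0; have -> : z%:~R = (z%:~R : rat)%:A :> K.
  by rewrite -[RHS]/(in_alg K z%:~R) rmorph_int.
by rewrite hv /padic_abs intr_eq0 (negPf z0) numq_int denq_int /= logn1 expr0 div1r.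
Qed.

Lemma padic_int_le1 (z : int) : v z%:~R <= 1.
Proof.
have [->|z0] := eqVneq z 0; first by rewrite absval0.
by rewrite padic_int // invf_le1 ?exprn_gt0 // exprn_ege1 // ltW.
Qed.

Lemma padic_prime : v l%:R = l%:R^-1.
Proof.
rewrite -[l%:R]/((l%:Z)%:~R) padic_int; last by rewrite -lt0n prime_gt0.
by rewrite absz_nat (logn_prime _ pl) eqxx expr1.
Qed.

Lemma padic_pow_dvd (z : int) a : (v z%:~R <= l%:R ^- a) = (l ^ a %| `|z|)%N.
Proof.
have [->|z0] := eqVneq z 0.
  by rewrite absval0 dvdn0 invr_ge0 exprn_ge0 // ltW.
rewrite padic_int // lef_pV2 ?posrE ?exprn_gt0 // ler_eXn2l //.
by rewrite pfactor_dvdn // absz_gt0.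
Qed.

Lemma padic_ai x : O x -> v x <= 1.
Proof.
move=> Ox; have [s hs] := all_embeddings_exist R K.
have [w [[Ow hw] dw _]] := discriminant_basis hs.
apply: (@expr_bounded _ _ (\sum_i v (w i))) => n; rewrite -absvalX.
have [c [-> _]] := hw _ (aiX n Ox); apply: le_trans (absval_sum _ _) _.
apply: (@le_trans _ _ (\sum_i v (w i))).
  apply: ler_sum => i _; rewrite -mulrzr absvalM -[leRHS]mulr1.
  by rewrite ler_wpM2l ?absval_ge0 // padic_int_le1.
rewrite -[leLHS]mulr1 ler_wpM2l ?ler1n //.
by apply: sumr_ge0 => i _; apply: absval_ge0.
Qed.

(** After division the claim is [v (1 + z) <= 1] for [v z <= 1]. Binomial coefficients have value at
    most 1, so the [n]-th power has value at most [n + 1], and [expr_bounded] concludes. *)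
Lemma padic_ultra x y (M : R) : v x <= M -> v y <= M -> v (x + y) <= M.
Proof.
suff H z : v z <= 1 -> v (1 + z) <= 1.
  wlog le : x y / v x <= v y.
    move=> h hx hy; case: (leP (v x) (v y)) => [le|/ltW le]; first exact: h.
    by rewrite addrC; apply: h.
  move=> hx hy; have [y0|y0] := eqVneq y 0.
    by move: le hx; rewrite y0 addr0.
  have -> : x + y = y * (1 + x / y) by field.
  rewrite absvalM -[leRHS]mulr1; apply: ler_pM; rewrite ?absval_ge0 //.
  by apply: H; rewrite absvalM absvalV ler_pdivrMr ?absval_gt0 // mul1r.
move=> z1; apply: (@expr_bounded _ _ 1) => n; rewrite mul1r -absvalX exprDn.
apply: le_trans (absval_sum _ _) _; rewrite -[n.+1 in leRHS]card_ord -sumr_const.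
apply: ler_sum => i _; rewrite expr1n mul1r -mulr_natr absvalM absvalX.
rewrite -[leRHS]mulr1; apply: ler_pM; rewrite ?exprn_ge0 ?absval_ge0 ?exprn_ile1 ?absval_ge0 //.
exact: (padic_int_le1 'C(n, i)).
Qed.

Lemma padic_ultraB x y (M : R) : v x <= M -> v y <= M -> v (x - y) <= M.
Proof. by move=> hx hy; apply: padic_ultra; rewrite ?absvalN. Qed.

Lemma padic_ultra_lt x y (M : R) : v x < M -> v y < M -> v (x + y) < M.
Proof.
move=> hx hy; apply: le_lt_trans (_ : Num.max (v x) (v y) < M).
  by apply: padic_ultra; rewrite le_max lexx ?orbT.
by rewrite gt_max hx.
Qed.

Lemma padic_ultra_sum (I : finType) (F : I -> K) (M : R) : 0 <= M ->
  (forall i, v (F i) <= M) -> v (\sum_i F i) <= M.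
Proof.
move=> M0 h; apply: (big_ind (fun x => v x <= M)) => //.
  by rewrite absval0.
by move=> x y; exact: padic_ultra.
Qed.

Lemma padic_multiples x : multiples l x -> v x <= l%:R^-1.
Proof.
move=> [y Oy ->]; rewrite absvalM padic_prime -[leRHS]mulr1.
by rewrite ler_wpM2l ?padic_ai // invr_ge0 ltW.
Qed.

(* O modulo l is finite, so units of the valuation ring in O are roots of
   unity modulo l. *)
Lemma padic_inverse b : O b -> v b = 1 ->
  exists2 c, O c & v (1 - c * b) <= l%:R^-1.
Proof.
move=> Ob vb; have l_gt0 := prime_gt0 pl.
have [i [j [ij hij]]] := index_pigeon (multiples_subgroup K l) (index_multiples R K l_gt0)
  (fun n => aiX n Ob).
exists (b ^+ (j - i).-1); first exact: aiX.
have := padic_multiples hij.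
have -> : b ^+ j - b ^+ i = - (b ^+ i * (1 - b ^+ (j - i).-1 * b)).
  rewrite -exprSr prednK ?subn_gt0 // mulrBr mulr1 -exprD subnKC ?opprB //.
  exact: ltnW.
by rewrite absvalN absvalM absvalX vb expr1n mul1r.
Qed.

Definition place_ideal (a : K) := O a /\ v a < 1.

Lemma place_ideal_maximal : is_maxideal place_ideal.
Proof.
have linv : l%:R^-1 < 1 :> R by rewrite invf_lt1.
split.
- split; first by split; [exact: ai0|rewrite absval0].
  move=> x y [Ox vx] [Oy vy]; split; first exact: aiB.
  by apply: padic_ultra_lt; rewrite ?absvalN.
- by move=> x [].
- move=> a x Oa [Ox vx]; split; first exact: aiM.
  rewrite absvalM; apply: le_lt_trans vx; rewrite -[leRHS]mul1r.
  by rewrite ler_wpM2r ?absval_ge0 // padic_ai.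
- split; first by case; rewrite absval1 ltxx.
  by exists l; [exact: prime_gt0|split; [exact: ai_nat|rewrite padic_prime]].
- move=> b Ob nb; have vb : v b = 1.
    by apply/eqP; rewrite eq_le padic_ai //= leNgt; apply/negP => h; apply: nb.
  have [c Oc hc] := padic_inverse Ob vb; exists c => //; split.
    by apply: aiB; [exact: ai1|exact: aiM].
  exact: le_lt_trans hc linv.
Qed.

Lemma not_place_ideal a : O a -> ~ place_ideal a -> v a = 1.
Proof.
move=> Oa na; apply/eqP; rewrite eq_le padic_ai //= leNgt.
by apply/negP => h; apply: na.
Qed.

Definition uniformizer (t pi : K) := [/\ forall a, place_ideal a -> O (t * a),
  place_ideal pi & ~ place_ideal (t * pi)].

Lemma place_uniformizer : exists t pi, uniformizer t pi.
Proof. exact: (uniformizer_exists R place_ideal_maximal). Qed.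

Section Uniformizer.
Variables (t pi : K).
Hypothesis tpi : uniformizer t pi.

Lemma uniformizer_t : v t = (v pi)^-1.
Proof.
have [tp [Opi vpi] npi] := tpi.
have : v (t * pi) = 1 by apply: not_place_ideal => //; apply: tp.
rewrite absvalM => h; apply: (mulIf (x := v pi)).
  by apply/eqP => v0; move: h; rewrite v0 mulr0 => /eqP; rewrite eq_sym oner_eq0.
rewrite h mulVf //; apply/eqP => v0.
by move: h; rewrite v0 mulr0 => /eqP; rewrite eq_sym oner_eq0.
Qed.

Lemma uniformizer_bounds : 0 < v pi < 1.
Proof.
have [tp [Opi vpi] npi] := tpi; rewrite vpi andbT; apply: absval_gt0.
apply/eqP => pi0; apply: npi; rewrite pi0 mulr0.
by split; [exact: ai0|rewrite absval0].
Qed.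

Lemma value_order x : O x -> x != 0 -> exists k,
  (forall j, (j <= k)%N -> O (t ^+ j * x)) /\ v x = v pi ^+ k.
Proof.
have [tp ppi npi] := tpi; move=> Ox x0.
have [k [Ok nk]] := order_exists R place_ideal_maximal tp ppi npi Ox x0.
exists k; split=> //; have := not_place_ideal (Ok k (leqnn k)) nk.
have /andP[p0 p1] := uniformizer_bounds.
rewrite absvalM absvalX uniformizer_t exprVn => h.
by apply: (mulfI (x := (v pi ^+ k)^-1)); rewrite ?h ?mulVf ?invr_eq0 ?expf_neq0 ?lt0r_neq0.
Qed.

Lemma localize n (b : 'I_n -> K) : (forall i, v (b i) <= 1) ->
  exists s, [/\ O s, v s = 1 & forall i, O (s * b i)].
Proof.
have /andP[p0 p1] := uniformizer_bounds.
move=> hb; have one x : v x <= 1 -> exists s, [/\ O s, v s = 1 & O (s * x)].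
  move=> hx; have [->|x0] := eqVneq x 0.
    by exists 1; rewrite mulr0 absval1; split=> //; [exact: ai1|exact: ai0].
  have [m m0 Om] := ai_multiple x; have mK := natK_neq0 K m0.
  have [i [Oi vi]] := value_order Om (mulf_neq0 mK x0).
  have [j [Oj vj]] := value_order (ai_nat K m) mK.
  have ji : (j <= i)%N.
    rewrite leqNgt; apply/negP => lt; move: hx.
    have : v m%:R * v x = v pi ^+ i by rewrite -absvalM.
    rewrite vj => /(canRL (mulKf _)) ->; last by rewrite expf_neq0 // lt0r_neq0.
    rewrite mulrC ler_pdivrMr ?exprn_gt0 // mul1r leNgt => /negP; apply.
    by rewrite ltr_iXn2l.
  (* The integer [m] clears the denominator of [x] but may be small at [v]; the factor [t ^+ j]
     restores its value to 1 and preserves integrality. *)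
  exists (t ^+ j * m%:R); split.
  - exact: Oj.
  - by rewrite absvalM absvalX vj uniformizer_t exprVn mulVf // expf_neq0 // lt0r_neq0.
  - by rewrite -mulrA; apply: Oi.
have /choice[s sE] i := one _ (hb i).
exists (\prod_i s i); split.
- apply: big_ind => [|x y|i _]; [exact: ai1|exact: aiM|by case: (sE i)].
- apply: (big_ind (fun x => v x = 1)) => [|x y vx vy|i _]; first exact: absval1.
    by rewrite absvalM vx vy mul1r.
  by case: (sE i).
- move=> i; rewrite (bigD1 i) //= mulrAC mulrC; apply: aiM; last by case: (sE i).
  by apply: big_ind => [|x y|j _]; [exact: ai1|exact: aiM|case: (sE j)].
Qed.

Lemma localize1 x : v x <= 1 -> exists s, [/\ O s, v s = 1 & O (s * x)].
Proof.
move=> hx; have [|s [Os vs Osx]] := @localize 1 (fun _ => x) => //.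
by exists s; split=> //; apply: (Osx ord0).
Qed.

Lemma value_discrete x : v x < 1 -> v x <= v pi.
Proof.
have /andP[p0 p1] := uniformizer_bounds.
move=> hx; have [s [Os vs Osx]] := localize1 (ltW hx).
have -> : v x = v (s * x) by rewrite absvalM vs mul1r.
have [->|sx0] := eqVneq (s * x) 0; first by rewrite absval0 ltW.
have [[|k] [_ vk]] := value_order Osx sx0.
  have e : v (s * x) = v x by rewrite absvalM vs mul1r.
  by move: hx; rewrite -e vk expr0 ltxx.
by rewrite vk exprS ger_pMr // exprn_ile1 // ltW.
Qed.

Lemma approx_ai x : v x <= 1 -> exists2 y, O y & v (x - y) <= l%:R^-1.
Proof.
move=> hx; have [s [Os vs Osx]] := localize1 hx.
have [c Oc hc] := padic_inverse Os vs.
exists (c * (s * x)); first exact: aiM.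
have -> : x - c * (s * x) = x * (1 - c * s) by ring.
rewrite absvalM -[leRHS]mul1r; apply: ler_pM; rewrite ?absval_ge0 //.
Qed.

Lemma prime_order : exists2 e, (0 < e)%N & v pi ^+ e = l%:R^-1.
Proof.
have [[|e] [_ vk]] := value_order (ai_nat K l) (natK_neq0 K (prime_gt0 pl)).
  by move: l1; rewrite -[l%:R]invrK -padic_prime vk expr0 invr1 ltxx.
by exists e.+1; rewrite // -vk padic_prime.
Qed.

Definition value_ideal k (a : K) := O a /\ v a <= v pi ^+ k.

Lemma value_ideal_submodule k : @is_submodule K K^o (value_ideal k).
Proof.
have /andP[p0 p1] := uniformizer_bounds.
split; first split.
- by split; [exact: ai0|rewrite absval0 exprn_ge0 // ltW].
- move=> x y [Ox vx] [Oy vy]; split; first exact: aiB.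
  exact: padic_ultraB.
- move=> a x Oa [Ox vx]; split; first exact: aiM.
  rewrite absvalM -[leRHS]mul1r; apply: ler_pM; rewrite ?absval_ge0 //.
  exact: padic_ai.
Qed.

(** Each ideal of the filtration is generated by [pi ^+ k] modulo the next one, with annihilator
    [place_ideal], so every step has index [q]. *)
Lemma value_ideal_index q k : has_index O place_ideal q ->
  has_index O (value_ideal k) (q ^ k).
Proof.
have /andP[p0 p1] := uniformizer_bounds; have [_ [Opi vpi] _] := tpi.
have sub j : forall x, value_ideal j.+1 x -> value_ideal j x.
  move=> x [Ox vx]; split=> //; apply: le_trans vx _.
  by rewrite exprS ger_pMl ?exprn_gt0 // ltW.
move=> hq; elim: k => [|k IH].
  have := @has_index_fin _ O (value_ideal 0) 'I_1 (fun _ => 0).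
  rewrite card_ord expn0; apply=> [_|x Ox]; first exact: ai0.
  exists ord0; split=> [|i _]; last by rewrite (ord1 i).
  by rewrite subr0; split=> //; rewrite expr0 padic_ai.
rewrite expnSr; apply: (index_mul _ _ _ _ _ IH).
- by case: (value_ideal_submodule k).
- by case: (value_ideal_submodule k.+1).
- by move=> x [].
- exact: sub.
- exact: ai_subgroup.
have [e e0 eE] := prime_order.
have [n hn] : exists n, has_index O (value_ideal k.+1) n.
  have lk : (0 < l ^ k.+1)%N by rewrite expn_gt0 prime_gt0.
  apply: (index_coarse _ _ (index_multiples R K lk)); first by case: (value_ideal_submodule k.+1).
  move=> _ [y Oy ->]; split; first by apply: aiM => //; exact: ai_nat.
  rewrite absvalM natrX absvalX padic_prime -eE -exprM -[leRHS]mulr1.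
  apply: ler_pM; rewrite ?exprn_ge0 ?absval_ge0 ?padic_ai //.
  by apply: ler_wiXn2l; rewrite ?(ltW p0) ?(ltW p1) //; nia.
have [|n' _ hn'] := index_le (value_ideal_submodule k).1 _ (@sub k) hn; first by move=> x [].
have mS := value_ideal_submodule k.+1.
have cyc x : add_cyclic (value_ideal k.+1 : K^o -> Prop) (pi ^+ k : K^o) x <-> value_ideal k x.
  split.
    apply: add_cyclic_min; first exact: value_ideal_submodule.
      exact: sub.
    by split; [exact: aiX|rewrite absvalX].
  move=> [Ox vx]; have pk0 : pi ^+ k != 0.
    by rewrite expf_neq0 //; apply: contraTneq p0 => ->; rewrite absval0 ltxx.
  have [|y Oy yE] := @approx_ai (x / pi ^+ k).
    by rewrite absvalM absvalV absvalX ler_pdivrMr ?exprn_gt0 // mul1r.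
  exists y => //; rewrite /GRing.scale /=; split.
    by apply: aiB => //; apply: aiM => //; exact: aiX.
  have -> : x - y * pi ^+ k = (x / pi ^+ k - y) * pi ^+ k by rewrite mulrBl divfK.
  rewrite absvalM absvalX exprS; apply: ler_wpM2r; first by rewrite exprn_ge0 // ltW.
  by apply: value_discrete; apply: le_lt_trans yE _; rewrite invf_lt1.
have hc : has_index (add_cyclic (value_ideal k.+1 : K^o -> Prop) (pi ^+ k : K^o))
    (value_ideal k.+1) n'.
  have [r [Ar rU]] := hn'; exists r; split=> [i|x /cyc]; [exact/cyc|exact: rU].
have ann a : annihilator (value_ideal k.+1 : K^o -> Prop) (pi ^+ k : K^o) a <-> place_ideal a.
  have vE : v (a * pi ^+ k) = v a * v pi ^+ k by rewrite absvalM absvalX.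
  split=> [[Oa [_]]|[Oa va]].
    rewrite /GRing.scale /= vE exprS ler_pM2r ?exprn_gt0 // => h.
    by split=> //; apply: le_lt_trans h p1.
  split=> //; split; first by apply: aiM => //; exact: aiX.
  rewrite /GRing.scale /= vE exprS ler_pM2r ?exprn_gt0 //; exact: value_discrete.
suff -> : q = n' by [].
have := index_annihilator mS hc => -[r [Ar rU]].
apply: (@index_uniq _ O place_ideal) => //.
- exact: ai_subgroup.
- by case: place_ideal_maximal.
- by move=> x [].
exists r; split=> // x Ox; have [i [iP iU]] := rU x Ox.
by exists i; split=> [|j /ann]; [exact/ann|exact: iU].
Qed.


End Uniformizer.

(** Linear independence over the prime field of [O] modulo the elements of value at most [1 / l]. *)
Definition independent_mod n (b : 'I_n -> K) := (forall i, O (b i)) /\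
  forall c : 'I_n -> int, v (\sum_i b i *~ c i) <= l%:R^-1 ->
    forall i, (l %| `|c i|%N)%N.

Lemma residue_basis : exists n (b : 'I_n -> K), independent_mod b /\
  has_index O (fun a => O a /\ v a <= l%:R^-1) (l ^ n) /\
  forall x, O x -> exists c : 'I_n -> int, v (x - \sum_i b i *~ c i) <= l%:R^-1.
Proof.
pose J := fun a => O a /\ v a <= l%:R^-1.
have l0' : 0 <= (l%:R^-1 : R) by rewrite invr_ge0 ltW.
have sJ : is_subgroup J.
  split; first by split; [exact: ai0|rewrite absval0].
  by move=> x y [Ox vx] [Oy vy]; split; [exact: aiB|exact: padic_ultraB].
have JO x : J x -> O x by case.
have [N hN] : exists N, has_index O J N.
  apply: (index_coarse sJ _ (index_multiples R K (prime_gt0 pl))).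
  by move=> x hx; split; [exact: multiples_ai hx|exact: padic_multiples].
have Ocomb n (b : 'I_n -> K) (c : 'I_n -> int) : (forall i, O (b i)) -> O (\sum_i b i *~ c i).
  by move=> Ob; apply: ai_sum => i _; rewrite -mulrzr; apply: aiM => //; exact: ai_int.
have vl (x : K) (c : int) : O x -> (l %| `|c|%N)%N -> v (x *~ c) <= l%:R^-1.
  move=> Ox; rewrite -[l in (l %| _)%N]expn1 -padic_pow_dvd expr1 => hc.
  rewrite -mulrzr absvalM -[leRHS]mul1r; apply: ler_pM; rewrite ?absval_ge0 //.
  exact: padic_ai.
have ltl (c : int) : (`|(c %% l)%Z| < l)%N.
  have l0z : (l%:Z != 0) by rewrite -lt0n prime_gt0.
  by have := ltz_mod c l0z; have := modz_ge0 c l0z; lia.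
have dvd_small (a b : 'I_l) : (l %| `|(a : nat)%:Z - (b : nat)%:Z|%N)%N -> a = b.
  move=> h; apply: val_inj; have la := ltn_ord a; have lb := ltn_ord b.
  have [//|ab] := eqVneq (a : nat) b.
  have : (0 < `|(a : nat)%:Z - (b : nat)%:Z|%N)%N by lia.
  by move=> /dvdn_leq/(_ h); lia.
pose P n := `[< exists b : 'I_n -> K, independent_mod b >].
have inj n (b : 'I_n -> K) (t t' : {ffun 'I_n -> 'I_l}) : independent_mod b ->
    J (\sum_i b i *~ (t i : nat) - \sum_i b i *~ (t' i : nat)) -> t = t'.
  move=> [Ob ib] [_]; rewrite -sumrB.
  under eq_bigr do rewrite -mulrzBr.
  by move=> /ib h; apply/ffunP => i; apply: dvd_small; exact: h.
have Pbound n : P n -> (n <= N)%N.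
  move=> /asboolP[b ib].
  have [r [Ar rU]] := hN.
  have /choice[f fE] (t : {ffun 'I_n -> 'I_l}) :
      exists i, J (\sum_j b j *~ (t j : nat) - r i).
    have [i [iJ _]] := rU _ (Ocomb _ _ (fun j => t j : nat) ib.1).
    by exists i.
  have fI : injective f.
    move=> t t' ft; apply: (inj _ b) => //.
    have -> : \sum_i b i *~ (t i : nat) - \sum_i b i *~ (t' i : nat) =
        (\sum_i b i *~ (t i : nat) - r (f t)) - (\sum_i b i *~ (t' i : nat) - r (f t')).
      by rewrite ft opprB addrA subrK.
    exact: sJ.2.
  have := leq_card f fI; rewrite card_ffun !card_ord; apply: leq_trans.
  exact/ltnW/ltn_expl/prime_gt1.
have exP : exists n, P n.
  by exists 0%N; apply/asboolP; exists (fun _ => 0); split=> [|c _] [].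
have [n /asboolP[b ib] nmax] := ex_maxnP exP Pbound.
(* By maximality adjoining [x] creates a relation; its coefficient of [x] is prime to [l], as
   otherwise it would be a relation among the [b i], and Bezout inverts it. *)
have span x : O x -> exists c : 'I_n -> int, v (x - \sum_i b i *~ c i) <= l%:R^-1.
  move=> Ox; pose b' (i : 'I_n.+1) := oapp b x (unlift ord0 i).
  have [c hc [i ni]] : exists2 c : 'I_n.+1 -> int, v (\sum_i b' i *~ c i) <= l%:R^-1 &
      exists i, ~~ (l %| `|c i|%N)%N.
    apply: contrapT => h; have : P n.+1.
      apply/asboolP; exists b'; split=> [i|c hc i].
        by rewrite /b'; case: (unlift ord0 i) => [j|] //=; exact: ib.1.
      apply/negPn/negP => ni; apply: h; exists c => //; by exists i.
    by move/nmax; rewrite ltnn.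
  move: hc; rewrite big_ord_recl {1}/b' unlift_none /=.
  under eq_bigr do rewrite /b' liftK /=.
  move=> hc; pose c' j := c (lift ord0 j).
  have nc0 : ~~ (l %| `|c ord0|%N)%N.
    apply/negP => h0; have h : v (\sum_i b i *~ c' i) <= l%:R^-1.
      rewrite (_ : \sum_i b i *~ c' i = (x *~ c ord0 + \sum_i b i *~ c' i) - x *~ c ord0).
        by apply: padic_ultraB => //; exact: vl.
      by rewrite addrAC subrr add0r.
    have [j ji|i0] := unliftP ord0 i; last by rewrite i0 h0 in ni.
    by have := ib.2 _ h j; rewrite /c' -ji (negPf ni).
  have /eqP co : coprime l `|c ord0|%N by rewrite prime_coprime.
  have [u [w uw]] : exists u w : int, u * c ord0 + w * l%:Z = 1.
    have [u [w uw]] := Bezoutz (c ord0) l%:Z; exists u, w.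
    by rewrite uw /gcdz absz_nat gcdnC co.
  exists (fun j => - (u * c' j)).
  have -> : x - \sum_j b j *~ - (u * c' j) =
      (x *~ c ord0 + \sum_i b i *~ c' i) *~ u + (x *~ w) *~ l.
    rewrite mulrzDl -!mulrzA addrAC -mulrzDr.
    rewrite [c ord0 * u]mulrC [w * _]mulrC -[(l : int) * w]mulrC uw mulr1z; congr (_ + _).
    rewrite -sumrN mulrz_suml; apply: eq_bigr => j _.
    by rewrite mulrNz opprK -mulrzA mulrC.
  apply: padic_ultra.
    rewrite -mulrzr absvalM -[leRHS]mulr1; apply: ler_pM; rewrite ?absval_ge0 //.
    exact: padic_int_le1.
  apply: vl; last by rewrite absz_nat.
  by rewrite -mulrzr; apply: aiM => //; exact: ai_int.
exists n, b; split=> //; split=> //.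
have := @has_index_fin _ O J {ffun 'I_n -> 'I_l} (fun t => \sum_i b i *~ (t i : nat)).
rewrite card_ffun !card_ord; apply=> [t|x Ox]; first by apply: Ocomb; exact: ib.1.
have [c hc] := span x Ox.
pose t := [ffun i => Ordinal (ltl (c i))].
have tJ : J (x - \sum_i b i *~ (t i : nat)).
  split; first by apply: aiB => //; apply: Ocomb; exact: ib.1.
  have -> : x - \sum_i b i *~ (t i : nat) = (x - \sum_i b i *~ c i) +
      \sum_i b i *~ (c i - (t i : nat)%:Z).
    under [X in _ = _ + X]eq_bigr do rewrite mulrzBr.
    by rewrite sumrB addrA subrK.
  apply: padic_ultra => //; apply: padic_ultra_sum => // i; apply: vl.
    exact: ib.1.
  rewrite ffunE /= gez0_abs ?modz_ge0 -?lt0n ?prime_gt0 //.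
  by rewrite {1}(divz_eq (c i) l) addrK abszM absz_nat dvdn_mull.
exists t; split=> // t' t'J; apply: (inj _ b) => //.
have -> : \sum_i b i *~ (t i : nat) - \sum_i b i *~ (t' i : nat) =
    (x - \sum_i b i *~ (t' i : nat)) - (x - \sum_i b i *~ (t i : nat)).
  by rewrite opprB [RHS]addrC addrA subrK.
exact: sJ.2.
Qed.

(** The identity [n = e f] by double counting: the integers modulo those of value at most [1 / l]
    number [l ^ n] by a residue basis, which is also a basis of the completion, and [q ^ e] by
    powers of the ideal of the place. *)
Lemma padic_local_degree t pi q : uniformizer t pi -> has_index O place_ideal q ->
  v pi ^+ local_degree v = q%:R^-1.
Proof.
move=> tpi hq; have /andP[p0 p1] := uniformizer_bounds tpi.
have [n [b [ib [hn span]]]] := residue_basis.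
have linv : 0 < (l%:R^-1 : R) by rewrite invr_gt0.
have linv1 : l%:R^-1 < 1 :> R by rewrite invf_lt1.
have deg : local_degree v = n.
  apply: (@local_degree_eq R K v n b l%:R^-1) => //.
  - have step x : v x <= 1 -> exists c : 'I_n -> int, v (x - \sum_i b i *~ c i) <= l%:R^-1.
      move=> hx; have [y Oy hy] := approx_ai tpi hx; have [c hc] := span y Oy.
      exists c; rewrite -[x](subrK y) -addrA; exact: padic_ultra.
    (* One digit of the [l]-adic expansion per step: the error is divided by [l ^+ m] and
       approximated again. *)
    have iter m x : v x <= 1 -> exists c : 'I_n -> rat, v (x - \sum_i c i *: b i) <= l%:R ^- m.
      move=> hx; elim: m => [|m [c hc]].
        exists (fun _ => 0); rewrite big1 ?subr0 ?expr0 ?invr1 // => i _.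
        by rewrite scale0r.
      set y := x - _ in hc; have lK := natK_neq0 K (prime_gt0 pl).
      have [|c' hc'] := step (y / l%:R ^+ m).
        rewrite absvalM absvalV absvalX padic_prime exprVn invrK.
        by rewrite -ler_pdivlMr ?exprn_gt0 // mul1r.
      exists (fun i => c i + (c' i)%:~R * l%:R ^+ m).
      have -> : x - \sum_i (c i + (c' i)%:~R * l%:R ^+ m) *: b i =
          (y / l%:R ^+ m - \sum_i b i *~ c' i) * l%:R ^+ m.
        rewrite mulrBl divfK ?expf_neq0 // /y -addrA -opprD; congr (_ - _).
        rewrite mulr_suml -big_split; apply: eq_bigr => i _ /=.
        rewrite scalerDl; congr (_ + _).
        rewrite -scalerA scaler_int mulrzAl; congr (_ *~ _).
        by rewrite -mulr_algl -[_%:A]/(in_alg K _) rmorphXn rmorph_nat mulrC.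
      rewrite absvalM absvalX padic_prime exprSr invfM exprVn mulrC.
      by rewrite ler_wpM2l // invr_ge0 exprn_ge0 // ltW.
    move=> x e e0.
    have [M hM] : exists M, v x <= l%:R ^+ M.
      have [->|x0] := eqVneq x 0; first by exists 0%N; rewrite absval0.
      have vx : 0 < (v x)^-1 by rewrite invr_gt0 absval_gt0.
      have [M hM] := expr_small (ltW linv) linv1 vx.
      exists M; rewrite -[leRHS]invrK -[leLHS]invrK lef_pV2 ?posrE //.
        by rewrite -exprVn ltW.
      by rewrite invr_gt0 exprn_gt0.
    have eM : 0 < e / l%:R ^+ M by rewrite divr_gt0 ?exprn_gt0.
    have [m hm] := expr_small (ltW linv) linv1 eM.
    have lK := natK_neq0 K (prime_gt0 pl).
    have [|c hc] := iter m (x * l%:R ^+ M).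
      by rewrite absvalM absvalX padic_prime exprVn ler_pdivrMr ?exprn_gt0 // mul1r.
    exists (fun i => c i / l%:R ^+ M).
    have -> : x - \sum_i (c i / l%:R ^+ M) *: b i =
        (x * l%:R ^+ M - \sum_i c i *: b i) / l%:R ^+ M.
      rewrite mulrBl mulfK ?expf_neq0 //; congr (_ - _).
      rewrite mulr_suml; apply: eq_bigr => i _.
      rewrite [c i / _]mulrC -scalerA -mulr_algl mulrC; congr (_ * _).
      by rewrite -[LHS]/(in_alg K _) fmorphV rmorphXn rmorph_nat.
    rewrite absvalM absvalV absvalX padic_prime exprVn invrK.
    apply: le_lt_trans (ler_wpM2r _ hc) _; first by rewrite exprn_ge0 // ltW.
    by rewrite -ltr_pdivlMr ?exprn_gt0 // -exprVn.
  (* Independence modulo [l] propagates to [l ^ a] by dividing all coefficients by [l]; hence a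
     combination is smaller than its coefficients by a factor of at most [l]. *)
  - have key a (c : 'I_n -> int) : v (\sum_i b i *~ c i) <= l%:R ^- a ->
        forall i, (l ^ a %| `|c i|%N)%N.
      elim: a c => [|a IH] c hc i; first by rewrite expn0 dvd1n.
      have hl : forall j, (l %| `|c j|%N)%N.
        apply: ib.2; apply: le_trans hc _; rewrite lef_pV2 ?posrE ?exprn_gt0 //.
        have l1' := ltW l1; have l0' := ltW l0.
        by rewrite exprS ler_peMr // exprn_ege1.
      have cE j : c j = l%:Z * (c j %/ l)%Z.
        by rewrite mulrC divzK // dvdzE absz_nat.
      have : v (\sum_j b j *~ (c j %/ l)%Z) <= l%:R ^- a.
        have lK := natK_neq0 K (prime_gt0 pl).
        have -> : \sum_j b j *~ (c j %/ l)%Z = (\sum_j b j *~ c j) / l%:R.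
          rewrite mulr_suml; apply: eq_bigr => j _.
          rewrite [in RHS](cE j); move: (c j %/ l)%Z => z.
          have -> : b j *~ (Posz l * z) = (b j *~ z) * l%:R.
            by rewrite mulrC mulrzA -pmulrn mulr_natr.
          by rewrite mulfK.
        rewrite absvalM absvalV padic_prime invrK.
        apply: le_trans (ler_wpM2r (ltW l0) hc) _.
        by rewrite exprSr invfM -mulrA mulVf ?mulr1 // lt0r_neq0.
      move=> /IH/(_ i) h; rewrite [c i]cE abszM absz_nat expnS.
      by rewrite dvdn_pmul2l // prime_gt0.
    have lowint (c : 'I_n -> int) i : l%:R^-1 * v (c i)%:~R <= v (\sum_j b j *~ c j).
      have [->|ci0] := eqVneq (c i) 0; first by rewrite absval0 mulr0 absval_ge0.
      rewrite padic_int // -invfM -exprS leNgt; apply/negP => /ltW/key/(_ i).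
      by rewrite pfactor_dvdn ?absz_gt0 // ltnn.
    move=> c i; have [D D0 hD] := common_denominator (\row_j c j).
    have /choice[z zE] j : exists z : int, D%:R * c j = z%:~R.
      by have /mxOverP/(_ 0 j) := hD; rewrite !mxE => /intrP.
    have DK := natK_neq0 K D0.
    rewrite -(ler_pM2l (absval_gt0 v DK)) -absvalM mulrCA -absvalM.
    have -> : D%:R * (c i)%:A = (z i)%:~R :> K.
      by rewrite -(rmorph_nat (in_alg K)) -[(c i)%:A]/(in_alg K (c i)) -rmorphM zE rmorph_int.
    have -> : D%:R * (\sum_j c j *: b j) = \sum_j b j *~ z j.
      rewrite mulr_sumr; apply: eq_bigr => j _.
      by rewrite -scaler_int -zE -scalerA scaler_nat mulr_natl.
    exact: lowint.
have [e e0 eE] := prime_order tpi.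
have hqe := value_ideal_index tpi e hq.
have lq : (l ^ n = q ^ e)%N.
  apply: (index_uniq _ _ _ hn).
  - exact: ai_subgroup.
  - split; first by split; [exact: ai0|rewrite absval0 ltW].
    by move=> x y [Ox vx] [Oy vy]; split; [exact: aiB|exact: padic_ultraB].
  - by move=> x [].
  - have [r [Ar rU]] := hqe; exists r; split=> // x /rU[i [iP iU]].
    exists i; split; first by case: iP => ? ?; split=> //; rewrite -eE.
    by move=> j [? ?]; apply: iU; split=> //; rewrite eE.
(* Both [e]-th powers are [l ^- n], by [v pi ^+ e = l^-1] and [l ^ n = q ^ e]. *)
rewrite deg; apply/eqP; rewrite -(@eqrXn2 _ e) ?exprn_ge0 ?invr_ge0 ?(ltW p0) //.
by rewrite -exprM mulnC exprM eE exprVn -natrX lq natrX exprVn.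
Qed.

End PadicValue.

(** * Correspondence of maximal ideals and finite places *)

Section FinitePlaces.
Variables (R : realType) (K : fieldExtType rat).
Local Notation d := (degree K).
Local Notation O := (@algebraic_integer K).

Lemma padic_finite (v : absval R K) l : prime l -> padic l v -> ~ archimedean v.
Proof.
move=> pl hv /(_ l%:R); rewrite -[_%:A]/(in_alg K _) rmorph_nat (padic_prime pl hv) ratr_nat normr_nat.
have l1 : (1 : R) < l%:R by rewrite ltr1n prime_gt1.
have : (l%:R : R)^-1 < 1 by rewrite invf_lt1 //; lra.
by move=> + e; rewrite e; lra.
Qed.

Lemma finite_padic (v : place R K) : ~ archimedean v -> exists2 l, prime l & padic l v.
Proof. by case: v => v [] //= av. Qed.

Section FromIdeal.
Variable p : K -> Prop.
Hypothesis mp : is_maxideal p.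

Lemma maxideal_rational_prime : exists2 l, prime l & p l%:R.
Proof.
have [sp pO pM [np1 [m m0 pm]] pmax] := mp.
elim/ltn_ind: m m0 pm => m IH m0 pm.
have [m1|m1] := leqP m 1.
  by case: np1; have -> : 1 = m%:R :> K by have /eqP -> : m == 1%N; rewrite ?eqn_leq ?m1.
have pr := pdiv_prime m1; have := divnK (pdiv_dvd m) => mE.
have : p (m %/ pdiv m)%:R \/ p (pdiv m)%:R.
  by apply: (maxideal_prime mp); [exact: ai_nat|exact: ai_nat|rewrite -natrM mE].
case=> h; last by exists (pdiv m).
apply: (IH (m %/ pdiv m)%N) => //; first by rewrite ltn_Pdiv ?prime_gt1.
by rewrite divn_gt0 ?prime_gt0 // dvdn_leq // pdiv_dvd.
Qed.

Variables (t pi : K).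
Hypotheses (tp : forall a, p a -> O (t * a)) (ppi : p pi) (npi : ~ p (t * pi)).

(** [k] is the valuation of [x] at [p], measured by the inverse [t] of a local uniformizer. *)
Definition has_order x k := O (t ^+ k * x) /\ ~ p (t ^+ k * x).

Lemma maxideal_prod a b : O a -> O b -> ~ p a -> ~ p b -> ~ p (a * b).
Proof. by move=> Oa Ob na nb /(maxideal_prime mp Oa Ob)[]. Qed.

Lemma has_orderM x y k j : has_order x k -> has_order y j -> has_order (x * y) (k + j).
Proof.
move=> [Ox px] [Oy py]; rewrite /has_order.
have -> : t ^+ (k + j) * (x * y) = (t ^+ k * x) * (t ^+ j * y) by rewrite exprD; ring.
by split; [exact: aiM|exact: maxideal_prod].
Qed.

(** If [k < j], the product of [(t pi)^(j-k)] and [t^k x] avoids [p] by primality, yet it equals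
    [pi^(j-k) (t^j x)], which lies in [p]. *)
Lemma has_order_uniq x k j : has_order x k -> has_order x j -> k = j.
Proof.
have [sp pO pM _ _] := mp.
wlog lt : k j / (k < j)%N => [H hk hj|].
  by case: (ltngtP k j) => // lt; [exact: H|apply/esym/H].
move=> [Ok pk] [Oj pj]; exfalso.
have Oc : O (t * pi) by apply: tp.
have Ocn n : O ((t * pi) ^+ n) by elim: n => [|n IH]; rewrite ?expr0 ?exprS; [exact: ai1|exact: aiM].
have : ~ p ((t * pi) ^+ (j - k) * (t ^+ k * x)).
  apply: maxideal_prod => //; elim: (j - k)%N => [|n IH].
    by rewrite expr0; case: mp => _ _ _ [].
  by rewrite exprS; apply: maxideal_prod.
apply; have -> : (t * pi) ^+ (j - k) * (t ^+ k * x) = pi ^+ (j - k).-1 * (t ^+ j * x) * pi.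
  rewrite -[X in _ = _ * (t ^+ X * _) * _](subnK (ltnW lt)) exprD exprMn.
  have : (0 < j - k)%N by rewrite subn_gt0.
  by case: (j - k)%N => // n _; rewrite /= [pi ^+ n.+1]exprSr; ring.
apply: pM => //; apply: aiM => //.
by elim: (j - k).-1 => [|n IH]; rewrite ?expr0 ?exprS; [exact: ai1|apply: aiM => //; exact: pO].
Qed.

Lemma has_order_low x k j : O x -> has_order x k -> (j < k)%N -> p (t ^+ j * x).
Proof.
move=> Ox hk jk; have x0 : x != 0.
  by apply/eqP => x0; case: hk => _; apply; rewrite x0 mulr0; case: mp => [[]].
have [k' [Ok nk]] := order_exists R mp tp ppi npi Ox x0.
have kk : k = k' by apply: has_order_uniq hk _; split=> //; apply: Ok.
rewrite -kk in Ok nk; apply: contrapT => np.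
have : has_order x j by split=> //; apply/Ok/ltnW.
by move/(has_order_uniq hk) => kj; rewrite kj ltnn in jk.
Qed.

Lemma order_function : exists o : K -> nat, forall x, O x -> x != 0 -> has_order x (o x).
Proof.
have /choice[od oE] x : exists k, O x -> x != 0 -> has_order x k.
  have [[Ox x0]|h] := pselect (O x /\ x != 0).
    have [k [Ok nk]] := order_exists R mp tp ppi npi Ox x0.
    by exists k => _ _; split=> //; apply: Ok.
  by exists 0%N => Ox x0; case: h.
by exists od.
Qed.

Lemma maxideal_coprime l (u : int) : p l%:R -> coprime l `|u| -> ~ p u%:~R.
Proof.
have [sp pO pM [np1 _] _] := mp.
move=> pl co pu; have : coprimez l u by [].
case/coprimezP => -[a b] /= e; apply: np1.
have -> : 1 = a%:~R * l%:R + b%:~R * u%:~R :> K.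
  by rewrite [l%:R]pmulrn -!intrM -intrD e.
by apply: subgrpD => //; apply: pM => //; exact: ai_int.
Qed.

Lemma maxideal_place_aux : exists v : place R K, ~ archimedean v /\
  forall a, O a -> (p a <-> v a < 1).
Proof.
have [l pl plp] := maxideal_rational_prime; have [od oE] := order_function.
have [sp pO pM [np1 _] pmax] := mp.
have lK := natK_neq0 K (prime_gt0 pl).
have oM x y : O x -> O y -> x != 0 -> y != 0 -> od (x * y) = (od x + od y)%N.
  move=> Ox Oy x0 y0; apply: (@has_order_uniq (x * y)).
    by apply: oE; [exact: aiM|exact: mulf_neq0].
  by apply: has_orderM; apply: oE.
have o0 x : O x -> x != 0 -> (p x <-> (0 < od x)%N).
  move=> Ox x0; have [_] := oE x Ox x0; case: posnP => [->|o0 _].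
    by rewrite expr0 mul1r; split.
  split=> // _; have := has_order_low Ox (oE x Ox x0) o0.
  by rewrite expr0 mul1r.
have e0 : (0 < od l%:R)%N by apply/o0 => //; exact: ai_nat.
set e := od l%:R in e0.
(* The normalization giving [l] the value [1 / l], as [padic] requires. *)
pose rho : R := l%:R `^ (- e%:R^-1).
have l0 : 0 < (l%:R : R) by rewrite ltr0n prime_gt0.
have l1 : 1 < (l%:R : R) by rewrite ltr1n prime_gt1.
have rho0 : 0 < rho by rewrite powR_gt0.
have rhoe : rho ^+ e = l%:R^-1.
  rewrite -powR_mulrn ?ltW // /rho -powRrM mulNr mulVf ?pnatr_eq0 -?lt0n //.
  by rewrite powR_inv1 // ltW.
have rho1 : rho < 1.
  rewrite ltNge; apply/negP => h; have : 1 <= rho ^+ e by rewrite exprn_ege1.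
  by rewrite rhoe leNgt invf_lt1 // l1.
have /choice[D hD] (x : K) : exists m, (0 < m)%N /\ O (m%:R * x).
  by have [m m0 Om] := ai_multiple x; exists m.
have DK x : (D x)%:R != 0 :> K by apply: natK_neq0; case: (hD x).
(* Orders are defined for integers only, so [x] is written as a fraction with denominator [D x];
   [fE] shows that any other integral denominator gives the same value. *)
pose f (x : K) : R := if x == 0 then 0 else rho ^+ od ((D x)%:R * x) / rho ^+ od (D x)%:R.
have re k : rho ^+ k != 0 by rewrite expf_neq0 // lt0r_neq0.
have fE x b : O b -> b != 0 -> O (b * x) -> x != 0 -> f x = rho ^+ od (b * x) / rho ^+ od b.
  move=> Ob b0 Obx x0; rewrite /f (negPf x0); apply/eqP; rewrite eqr_div //.
  have [m0 Om] := hD x; rewrite -!exprD -!oM ?ai_nat ?mulf_neq0 //; last exact: ai_nat.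
  by apply/eqP; congr (_ ^+ od _); ring.
have fO x : O x -> x != 0 -> f x = rho ^+ od x.
  move=> Ox x0; rewrite (fE x 1) ?mul1r ?oner_neq0 //; last exact: ai1.
  have -> : od 1 = 0%N.
    have [//|] := posnP (od 1); first by move/o0 => /(_ (ai1 K) (oner_neq0 K)).
  by rewrite expr0 divr1.
have f_gt0 x : x != 0 -> 0 < f x.
  by move=> x0; rewrite /f (negPf x0) divr_gt0 ?exprn_gt0.
have fz : f 0 = 0 by rewrite /f eqxx.
have f_ge0 x : 0 <= f x.
  by have [->|/f_gt0/ltW //] := eqVneq x 0; rewrite fz.
have f_eq0 x : f x = 0 <-> x = 0.
  split=> [fx|->]; last exact: fz.
  by apply/eqP; apply: contraT => /f_gt0; rewrite fx ltxx.
have fM : {morph f : x y / x * y}.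
  move=> x y; have [->|x0] := eqVneq x 0; first by rewrite mul0r !fz mul0r.
  have [->|y0] := eqVneq y 0; first by rewrite mulr0 !fz mulr0.
  have [m0 Om] := hD x; have [n0 On] := hD y.
  have Dx : O (D x)%:R by exact: ai_nat.
  have Dy : O (D y)%:R by exact: ai_nat.
  have eqn : (D x)%:R * (D y)%:R * (x * y) = ((D x)%:R * x) * ((D y)%:R * y) by ring.
  rewrite (fE _ ((D x)%:R * (D y)%:R)) ?mulf_neq0 ?eqn //; try exact: aiM.
  rewrite (oM _ _ Om On (mulf_neq0 (DK x) x0) (mulf_neq0 (DK y) y0)).
  rewrite (oM _ _ Dx Dy (DK x) (DK y)) !exprD.
  by rewrite (fE x (D x)%:R) // (fE y (D y)%:R) // mulf_div.
have fU x y : f (x + y) <= Num.max (f x) (f y).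
  have [->|x0] := eqVneq x 0; first by rewrite add0r le_max lexx orbT.
  have [->|y0] := eqVneq y 0; first by rewrite addr0 le_max lexx.
  have [xy|xy0] := eqVneq (x + y) 0; first by rewrite xy fz le_max f_ge0.
  have [m0 Om] := hD x; have [n0 On] := hD y.
  have Dx : O (D x)%:R by exact: ai_nat.
  have Dy : O (D y)%:R by exact: ai_nat.
  have Ob : O ((D x)%:R * (D y)%:R) by exact: aiM.
  have b0 : (D x)%:R * (D y)%:R != 0 :> K by rewrite mulf_neq0.
  set b := (D x)%:R * (D y)%:R in Ob b0.
  have Obx : O (b * x).
    have -> : b * x = (D y)%:R * ((D x)%:R * x) by rewrite /b; ring.
    exact: aiM.
  have Oby : O (b * y).
    have -> : b * y = (D x)%:R * ((D y)%:R * y) by rewrite /b; ring.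
    exact: aiM.
  have Obxy : O (b * (x + y)) by rewrite mulrDr; apply: aiD.
  rewrite (fE _ b) // (fE x b) // (fE y b) //.
  have : (minn (od (b * x)%R) (od (b * y)%R) <= od (b * (x + y))%R)%N.
    rewrite leqNgt; apply/negP; rewrite leq_min => /andP[h1 h2].
    have [_] := oE _ Obxy (mulf_neq0 b0 xy0); apply.
    move: h1 h2; move: (od (b * (x + y))) => k h1 h2; rewrite [b * (x + y)]mulrDr mulrDr.
    apply: (subgrpD sp).
      exact: (has_order_low Obx (oE _ Obx (mulf_neq0 b0 x0))).
    exact: (has_order_low Oby (oE _ Oby (mulf_neq0 b0 y0))).
  have mono k j : (k <= j)%N -> rho ^+ j / rho ^+ od b <= rho ^+ k / rho ^+ od b.
    by move=> kj; rewrite ler_pM2r ?invr_gt0 ?exprn_gt0 // ler_wiXn2l ?ltW.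
  by rewrite geq_min le_max => /orP[/mono ->|/mono ->]; rewrite ?orbT.
have fD x y : f (x + y) <= f x + f y.
  by apply: le_trans (fU x y) _; rewrite ge_max lerDl lerDr !f_ge0.
pose v := @AbsVal R K f f_ge0 f_eq0 fM fD.
have vint (z : int) : z != 0 -> v z%:~R = l%:R ^- logn l `|z|%N.
  move=> z0; have z1 : (0 < `|z|)%N by rewrite absz_gt0.
  have [u lu zE] := pfactor_coprime pl z1.
  set a := logn l _ in zE *.
  have {}zE : z = (Num.sg z * u%:Z) * (l ^ a)%N%:Z.
    by rewrite -mulrA -PoszM -zE -intEsg.
  have -> : z%:~R = (Num.sg z * u%:Z)%:~R * l%:R ^+ a :> K.
    by rewrite {1}zE intrM -pmulrn natrX.
  have vl : v l%:R = l%:R^-1 by rewrite -rhoe; exact: (fO _ (ai_nat K l) lK).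
  rewrite absvalM absvalX vl exprVn.
  have nu : ~ p (Num.sg z * u%:Z)%:~R.
    apply: (maxideal_coprime plp); rewrite abszM absz_sg z0 mul1n //.
  have u0 : (Num.sg z * u%:Z)%:~R != 0 :> K.
    by apply/eqP => h; apply: nu; rewrite h; exact: sp.1.
  have -> : v (Num.sg z * u%:Z)%:~R = rho ^+ od (Num.sg z * u%:Z)%:~R.
    by apply: fO => //; exact: ai_int.
  have -> : od (Num.sg z * u%:Z)%:~R = 0%N.
    by have [//|/(o0 _ (ai_int _ _) u0)] := posnP (od (Num.sg z * u%:Z)%:~R).
  by rewrite expr0 mul1r.
have vp : padic l v.
  move=> q; rewrite /padic_abs; have [->|q0] := eqVneq q 0.
    by rewrite scale0r absval0.
  have dK : (denq q)%:~R != 0 :> K.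
    by rewrite -(rmorph_int (in_alg K)) fmorph_eq0 intr_eq0 denq_neq0.
  have -> : q%:A = (numq q)%:~R / (denq q)%:~R :> K.
    rewrite -{1}(divq_num_den q) -[LHS]/(in_alg K _) fmorph_div.
    by rewrite !rmorph_int.
  rewrite absvalM absvalV !vint ?numq_eq0 ?denq_neq0 // invrK.
  by rewrite mulrC.
exists (Place (or_intror (ex_intro2 _ _ l pl vp))); split=> [|a Oa].
  exact: padic_finite pl vp.
have [->|a0] := eqVneq a 0; first by rewrite absval0 ltr01; split=> // _; exact: sp.1.
rewrite /= fO // (o0 a Oa a0); case: (od a) => [|k]; first by rewrite expr0 ltxx.
by split=> // _; rewrite exprn_ilt1 // ltW.
Qed.

End FromIdeal.

Lemma maxideal_place p : is_maxideal p -> exists v : place R K, ~ archimedean v /\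
  forall a, O a -> (p a <-> v a < 1).
Proof.
move=> mp; have [t [pi [tp ppi npi]]] := uniformizer_exists R mp.
exact: maxideal_place_aux mp _ _ tp ppi npi.
Qed.

(** Without a separating integer the ideals of the places coincide. Then one pair [t], [pi] serves
    both, orders agree, and the common value of the residue prime forces the absolute values to be
    equal. *)
Lemma places_separated (v v' : place R K) : ~ archimedean v -> ~ archimedean v' ->
  v <> v' -> exists a, [/\ O a, v a < 1 & v' a = 1].
Proof.
move=> /finite_padic[l pl hv] /finite_padic[l' pl' hv'] nvv.
apply: contrapT => h; apply: nvv.
have sub a : place_ideal v a -> place_ideal v' a.
  move=> [Oa va]; apply: contrapT => na; apply: h; exists a; split=> //.
  exact: (not_place_ideal pl' hv').
have mi := place_ideal_maximal pl hv; have mi' := place_ideal_maximal pl' hv'.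
have eqv a : place_ideal v a <-> place_ideal v' a.
  by split; [exact: sub|exact: (maxideal_sub mi mi' sub)].
have [t [pi tpi]] := place_uniformizer pl hv.
have tpi' : uniformizer v' t pi.
  case: tpi => h1 /eqv h2 h3; split=> //; first by move=> a /eqv/h1.
  by move=> /eqv.
have ll : l = l'.
  have [_] : place_ideal v' l%:R.
    apply: sub; split; first exact: ai_nat.
    by rewrite (padic_prime pl hv) invf_lt1 ?ltr0n ?ltr1n ?prime_gt1 ?prime_gt0.
  rewrite pmulrn (padic_int hv') /=; last by rewrite -lt0n prime_gt0.
  rewrite logn_prime //; case: eqP => //; by rewrite expr0 invr1 ltxx.
rewrite -ll in hv' pl'.
have /andP[p0 p1] := uniformizer_bounds tpi.
have /andP[p0' p1'] := uniformizer_bounds tpi'.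
have ord x : O x -> x != 0 -> exists k, v x = v pi ^+ k /\ v' x = v' pi ^+ k.
  move=> Ox x0; have [tp ppi npi] := tpi; have [tp' ppi' npi'] := tpi'.
  have [k [Ok nk]] := order_exists R mi tp ppi npi Ox x0.
  exists k; split.
    have := not_place_ideal pl hv (Ok k (leqnn k)) nk.
    rewrite absvalM absvalX (uniformizer_t pl hv tpi) exprVn => e.
    by apply: (mulfI (x := (v pi ^+ k)^-1)); rewrite ?e ?mulVf ?invr_eq0 ?expf_neq0 ?lt0r_neq0.
  have nk' : ~ place_ideal v' (t ^+ k * x) by move/eqv.
  have := not_place_ideal pl hv' (Ok k (leqnn k)) nk'.
  rewrite absvalM absvalX (uniformizer_t pl hv' tpi') exprVn => e.
  by apply: (mulfI (x := (v' pi ^+ k)^-1)); rewrite ?e ?mulVf ?invr_eq0 ?expf_neq0 ?lt0r_neq0.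
have lK := natK_neq0 K (prime_gt0 pl).
have linv : (l%:R : R)^-1 < 1 by rewrite invf_lt1 ?ltr0n ?ltr1n ?prime_gt1 ?prime_gt0.
have pp : v pi = v' pi.
  have [k [k1 k2]] := ord l%:R (ai_nat K l) lK.
  have e : v pi ^+ k == v' pi ^+ k by rewrite -k1 -k2 !padic_prime.
  case: k k1 k2 e => [k1|k _ _]; last first.
    by rewrite eqrXn2 ?absval_ge0 // => /eqP.
  by move: linv; rewrite -(padic_prime pl hv) k1 expr0 ltxx.
have vO x : O x -> v x = v' x.
  move=> Ox; have [->|x0] := eqVneq x 0; first by rewrite !absval0.
  by have [k [-> ->]] := ord x Ox x0; rewrite pp.
apply: place_ext => x; have [m m0 Om] := ai_multiple x.
have mK := natK_neq0 K m0.
apply: (mulfI (lt0r_neq0 (absval_gt0 v mK))).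
by rewrite -absvalM vO // [v m%:R]vO ?absvalM //; exact: ai_nat.
Qed.

End FinitePlaces.

(** * Indices as products over the finite places *)

Section IndexProducts.
Variables (R : realType) (K : fieldExtType rat).
Local Notation d := (degree K).
Local Notation O := (@algebraic_integer K).
Local Notation fin v := (~ archimedean v).
Implicit Types (f g : place R K -> R) (a b : R) (v u : place R K).
Implicit Types s : seq (place R K).

(** A relation instead of an infinite product: the list witnesses finite support, which is thereby
    carried through products and inverses. *)
Definition finite_product (f : place R K -> R) (k : R) :=
  exists s : seq (place R K), [/\ uniq s, (forall v, v \in s -> fin v),
    (forall v, fin v -> v \notin s -> f v = 1) &
    \prod_(v <- s) f v ^+ local_degree v = k].

Lemma finite_product_widen f s s' : uniq s -> uniq s' -> {subset s <= s'} ->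
  (forall v, v \in s' -> fin v) -> (forall v, fin v -> v \notin s -> f v = 1) ->
  \prod_(v <- s') f v ^+ local_degree v = \prod_(v <- s) f v ^+ local_degree v.
Proof.
move=> us us' ss' fs' f1.
rewrite (bigID (mem s)) /= [X in _ * X]big1_seq ?mulr1; last first.
  by move=> v /andP[nv /fs' fv]; rewrite f1 // expr1n.
rewrite -big_filter; apply: perm_big; apply: uniq_perm => //; first exact: filter_uniq.
by move=> v; rewrite mem_filter andb_idr //; exact: ss'.
Qed.

Lemma finite_productM f g a b : finite_product f a -> finite_product g b ->
  finite_product (fun v => f v * g v) (a * b).
Proof.
move=> [s [us fs f1 <-]] [t [ut ft g1 <-]].
pose r := undup (s ++ t).
have ur : uniq r by exact: undup_uniq.
have fr v : v \in r -> fin v by rewrite mem_undup mem_cat => /orP[/fs|/ft].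
exists r; split=> // [v fv|].
  by rewrite mem_undup mem_cat negb_or => /andP[h1 h2]; rewrite f1 // g1 // mulr1.
under eq_bigr do rewrite exprMn.
rewrite big_split /=; congr (_ * _); apply: finite_product_widen => // v vs;
  by rewrite mem_undup mem_cat vs ?orbT.
Qed.

Lemma finite_productV f a : finite_product f a -> finite_product (fun v => (f v)^-1) a^-1.
Proof.
move=> [s [us fs f1 <-]]; exists s; split=> // [v fv nv|].
  by rewrite f1 // invr1.
by rewrite -prodfV; apply: eq_bigr => v _; rewrite exprVn.
Qed.

Lemma finite_product1 (f : place R K -> R) : (forall v, fin v -> f v = 1) ->
  finite_product f 1.
Proof. by move=> f1; exists [::]; rewrite big_nil; split=> // v fv _; exact: f1. Qed.

Lemma finite_product_eq f g a : (forall v, fin v -> f v = g v) ->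
  finite_product f a -> finite_product g a.
Proof.
move=> fg [s [us fs f1 <-]]; exists s; split=> // [v fv nv|].
  by rewrite -fg // f1.
by apply: eq_big_seq => v /fs fv; rewrite fg.
Qed.

Lemma finite_product_at (u : place R K) x : fin u ->
  finite_product (fun v => if v == u then x else 1) (x ^+ local_degree u).
Proof.
move=> fu; exists [:: u]; split=> // [v|v fv|]; first by rewrite inE => /eqP ->.
  by rewrite inE => /negPf ->.
by rewrite big_seq1 eqxx.
Qed.

End IndexProducts.

Section Chain.
Variables (R : realType) (K : fieldExtType rat) (n : nat).
Local Notation d := (degree K).
Local Notation O := (@algebraic_integer K).
Local Notation fin v := (~ archimedean v).
Implicit Types (M L : 'rV[K]_n -> Prop) (v u : place R K).

(** Stands in for the absolute value at [v] of the determinant of a local basis of [M], without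
    localizing. *)
Definition max_det v M (c : R) :=
  (exists2 A : 'M[K]_n, (forall i, M (row i A)) & v (\det A) = c) /\
  (forall A : 'M[K]_n, (forall i, M (row i A)) -> v (\det A) <= c).

Section Step.
Variables (u : place R K) (M : 'rV[K]_n -> Prop) (z : 'rV[K]_n) (t pi : K).
Hypotheses (fu : fin u) (mM : is_submodule M) (tpi : uniformizer u t pi)
  (annP : forall a, O a -> (annihilator M z a <-> u a < 1)).
Local Notation M1 := (add_cyclic M z).

Lemma submodule_scale_sub a x : O a -> u a < 1 -> M1 x -> M (a *: x).
Proof.
move=> Oa ua [b Ob h]; have [_ az] := (annP Oa).2 ua.
have -> : a *: x = a *: (x - b *: z) + b *: (a *: z).
  by rewrite scalerBr !scalerA [b * a]mulrC subrK.
by apply: (subgrpD mM.1); apply: mM.2.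
Qed.

(** A multiplier small at [u] and of value 1 at [v] brings [M1] into [M] without changing any
    determinant at [v]. *)
Lemma max_det_other v c : fin v -> v <> u -> max_det v M c -> max_det v M1 c.
Proof.
move=> fv vu [[A MA <-] hM]; split.
  by exists A => // i; apply: add_cyclic_sub.
move=> B hB; have [a [Oa ua va]] := places_separated fu fv (nesym vu).
have := hM (a *: B); rewrite detZ absvalM absvalX va expr1n mul1r; apply => i.
by rewrite linearZ /=; apply: submodule_scale_sub.
Qed.

Lemma max_det_same_le c (B : 'M[K]_n) : (forall A : 'M[K]_n, (forall i, M (row i A)) ->
  u (\det A) <= c) -> 0 <= c -> (forall i, M1 (row i B)) -> u (\det B) <= c / u pi.
Proof.
have [l pl hu] := finite_padic fu.
have /andP[p0 p1] := uniformizer_bounds tpi; have [_ [Opi upi] _] := tpi.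
move=> hc c0 hB; have /choice[b bE] i : exists b, O b /\ M (row i B - b *: z).
  by case: (hB i) => b; exists b.
have [allp|] := pselect (forall i, u (b i) < 1).
  have MB i : M (row i B).
    rewrite -(subrK (b i *: z) (row i B)); apply: (subgrpD mM.1); first by case: (bE i).
    by have [Ob _] := bE i; case: ((annP Ob).2 (allp i)).
  apply: le_trans (hc _ MB) _.
  by rewrite ler_pdivlMr // -[leRHS]mulr1; apply: ler_wpM2l => //; exact: ltW.
move=> /existsNP[i0 /negP nb]; have [Ob0 Mb0] := bE i0.
have [_ _ _ _ pmax] := place_ideal_maximal pl hu.
have [|e Oe [Oeb ueb]] := pmax (b i0) Ob0; first by case => _; apply/negP.
(* Row [i0], whose coefficient of [z] is invertible at [u], eliminates [z] from the other rows and
   is itself multiplied by [pi]. All rows then lie in [M], at the cost of the determinant [pi]. *)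
pose E : 'M[K]_n := \matrix_(i, j) if i == i0 then pi *+ (j == i0)
   else (i == j)%:R - (b i * e) *+ (j == i0).
have detE : \det E = pi.
  rewrite (expand_det_row _ i0) (bigD1 i0) //= big1 ?addr0 => [|j /negPf ji]; last first.
    by rewrite !mxE eqxx ji mul0r.
  rewrite !mxE eqxx mulr1n /cofactor -signr_odd addnn odd_double expr0 mul1r.
  have -> : row' i0 (col' i0 E) = 1%:M.
    apply/matrixP => i j; rewrite !mxE eq_sym (negPf (neq_lift _ _)).
    by rewrite (inj_eq lift_inj) [lift i0 j == i0]eq_sym (negPf (neq_lift _ _)) subr0.
  by rewrite det1 mulr1.
have rowE i : row i (E *m B) = if i == i0 then pi *: row i0 B
    else row i B - (b i * e) *: row i0 B.
  apply/rowP => j; rewrite !mxE; case: ifP => [/eqP ->|ii].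
    rewrite (bigD1 i0) //= big1 ?addr0 => [|k /negPf ki]; last by rewrite !mxE eqxx ki mul0r.
    by rewrite !mxE !eqxx mulr1n.
  under eq_bigr => k _ do rewrite mxE ii mulrBl.
  rewrite sumrB (bigD1 i) //= eqxx mul1r big1 ?addr0 => [|k /negPf ki]; last first.
    by rewrite eq_sym ki mul0r.
  rewrite (bigD1 i0) //= eqxx mulr1n big1 ?addr0 => [|k /negPf ki]; last by rewrite ki mul0r.
  by rewrite !mxE.
have : u (\det (E *m B)) <= c.
  apply: hc => i; rewrite rowE; case: ifP => [_|_]; first exact: submodule_scale_sub.
  have [Obi Mbi] := bE i.
  have -> : row i B - (b i * e) *: row i0 B = (row i B - b i *: z)
     - (b i * e) *: (row i0 B - b i0 *: z) + b i *: ((1 - e * b i0) *: z).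
    by apply/rowP => j; rewrite !mxE; ring.
  apply: (subgrpD mM.1).
    by apply: mM.1.2 => //; apply: mM.2 => //; exact: aiM.
  by apply: mM.2 => //; case: ((annP Oeb).2 ueb).
by rewrite det_mulmx detE absvalM ler_pdivlMr // mulrC.
Qed.

Lemma max_det_same c : 0 < c -> max_det u M c -> max_det u M1 (c / u pi).
Proof.
have [l pl hu] := finite_padic fu.
have /andP[p0 p1] := uniformizer_bounds tpi; have [_ [Opi upi] _] := tpi.
move=> c0 [[A MA Ac] hM]; have le := max_det_same_le hM (ltW c0).
split; last exact: le.
have dA : \det A != 0 by apply/eqP => h; move: c0; rewrite -Ac h absval0 ltxx.
have uA : A \in unitmx by rewrite unitmxE unitfE.
pose be := z *m invmx A.
have zE : z = be *m A by rewrite mulmxKV.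
(* Otherwise a multiplier of value 1 at [u] would make the coordinates of [z] integral and so
   annihilate [z] modulo [M]. Replacing row [j] of an optimal [A] by [z] then gains at least
   [1 / u pi], by discreteness of the values. *)
have [j hj] : exists j, 1 < u (be 0 j).
  apply: contrapT => h; have hb j : u (be 0 j) <= 1.
    by rewrite leNgt; apply/negP => hj; apply: h; exists j.
  have [s [Os us sb]] := localize pl hu tpi hb.
  have : annihilator M z s.
    split=> //; rewrite zE mulmx_sum_row scaler_sumr.
    apply: big_ind => [|x y|i _]; [exact: mM.1.1|exact: subgrpD mM.1|].
    by rewrite scalerA; apply: mM.2.
  by move/(annP Os).1; rewrite us ltxx.
pose A' := (\matrix_(a, i) (if a == j then be 0 i else (a == i)%:R)) *m A.
have dA' : \det A' = be 0 j * \det A by rewrite det_mulmx det_row_replace.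
exists A'.
  move=> i; rewrite row_mul; have [->|ij] := eqVneq i j.
    have -> : row j (\matrix_(a, i) (if a == j then be 0 i else (a == i)%:R)) = be.
      by apply/rowP => k; rewrite !mxE eqxx.
    by rewrite -zE; apply: add_cyclic_gen.
  have -> : row i (\matrix_(a, i) (if a == j then be 0 i else (a == i)%:R)) = row i 1%:M.
    by apply/rowP => k; rewrite !mxE (negPf ij).
  by rewrite -row_mul mul1mx; apply: add_cyclic_sub.
apply/eqP; rewrite eq_le; apply/andP; split.
  apply: le => i; rewrite row_mul; have [->|ij] := eqVneq i j.
    have -> : row j (\matrix_(a, i) (if a == j then be 0 i else (a == i)%:R)) = be.
      by apply/rowP => k; rewrite !mxE eqxx.
    by rewrite -zE; apply: add_cyclic_gen.
  have -> : row i (\matrix_(a, i) (if a == j then be 0 i else (a == i)%:R)) = row i 1%:M.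
    by apply/rowP => k; rewrite !mxE (negPf ij).
  by rewrite -row_mul mul1mx; apply: add_cyclic_sub.
have be0 : 0 < u (be 0 j) by apply: lt_trans hj.
have : u (be 0 j)^-1 <= u pi.
  by apply: (value_discrete pl hu tpi); rewrite absvalV invf_lt1.
rewrite absvalV dA' absvalM Ac mulrC => h; rewrite ler_pM2r //.
by rewrite -[leRHS]invrK lef_pV2 ?posrE ?invr_gt0.
Qed.

End Step.

Lemma index_gt1 M M' k : is_submodule M -> is_submodule M' -> (forall x, M x -> M' x) ->
  (exists2 x, M' x & ~ M x) -> has_index M' M k -> (1 < k)%N.
Proof.
move=> mM mM' MM' [x M'x nMx] hk; rewrite ltnNge; apply/negP => k1.
case: k k1 hk => [_ [r [_ /(_ x M'x)[[]]]] //|[_ hk|//]].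
by apply: nMx; apply: (index1 mM'.1 mM.1 MM' hk).
Qed.

(** In each step the factor [1 / u pi], raised to the local degree, is the residue cardinality [q]
    by [padic_local_degree], and this is also the index of [M] in [M + O z]. *)
Lemma index_finite_product M L (c : place R K -> R) k : is_submodule M ->
  is_submodule L -> (forall x, M x -> L x) -> has_index L M k ->
  (forall v, fin v -> 0 < c v /\ max_det v M (c v)) ->
  exists c', (forall v, fin v -> 0 < c' v /\ max_det v L (c' v)) /\
             finite_product (fun v => c' v / c v) k%:R.
Proof.
elim/ltn_ind: k M c => k IH M c mM mL ML hk hc.
have [[x Lx nMx]|eqML] := pselect (exists2 x, L x & ~ M x); last first.
  have LM x : L x -> M x by move=> Lx; apply: contrapT => nMx; apply: eqML; exists x.
  have h1 : has_index L M 1.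
    exists (fun _ => 0); split=> [_|x Lx]; first exact: mL.1.1.
    by exists ord0; split=> [|i _]; rewrite ?subr0 ?ord1 //; exact: LM.
  rewrite (index_uniq mL.1 mM.1 ML hk h1); exists c; split.
    move=> v /hc[c0 [[A MA Ac] hA]]; split=> //; split; first by exists A => // i; exact: ML.
    by move=> B LB; apply: hA => i; apply: LM.
  by apply: finite_product1 => v /hc[c0 _]; rewrite divff // lt0r_neq0.
have [z [Lz nMz mz]] := annihilator_maxideal mM mL ML hk (ex_intro2 _ _ x Lx nMx).
have [u [fu hu]] := maxideal_place R mz.
have [l pl lu] := finite_padic fu.
have [t [pi tpi]] := place_uniformizer pl lu.
have annP a : O a -> (annihilator M z a <-> u a < 1) by exact: hu.
have mM1 := add_cyclic_submodule z mM.
have M1L := add_cyclic_min mL ML Lz.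
have MM1 := @add_cyclic_sub _ _ M z.
have [q _ hq] := index_le mM1.1 M1L MM1 hk.
have [k1 hk1] := index_coarse mM1.1 MM1 hk.
have q1 : (1 < q)%N by apply: (index_gt1 mM mM1 MM1 _ hq); exists z => //; exact: add_cyclic_gen.
have kE : k = (k1 * q)%N.
  apply: (index_uniq mL.1 mM.1 ML hk).
  exact: (index_mul mM1.1 mM.1 M1L MM1 mL.1 hk1 hq).
have k1_gt0 : (0 < k1)%N.
  by case: hk1 => r [_ /(_ x Lx)[i _]]; apply: leq_ltn_trans (ltn_ord i).
have lt : (k1 < k)%N by rewrite kE ltn_Pmulr.
pose c1 v := if v == u then c v / u pi else c v.
have /andP[p0 p1] := uniformizer_bounds tpi.
have hc1 v : fin v -> 0 < c1 v /\ max_det v (add_cyclic M z) (c1 v).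
  move=> fv; rewrite /c1; have [c0 mc] := hc v fv; case: eqP => [vu|vu].
    rewrite vu in mc c0 *; split; first by rewrite divr_gt0.
    exact: (max_det_same fu mM tpi annP).
  by split=> //; exact: (max_det_other fu mM annP).
have [c' [hc' fp]] := IH k1 lt _ c1 mM1 mL M1L hk1 hc1.
exists c'; split=> //.
have hqp : has_index O (place_ideal u) q.
  have [r [Ar rU]] := index_annihilator mM hq; exists r; split=> // b Ob.
  have [i [[Oi hi] iU]] := rU b Ob; exists i; split.
    by split=> //; apply/annP.
  by move=> j [Oj hj]; apply: iU; apply/(annP _ Oj).
have e := padic_local_degree pl lu tpi hqp.
have := finite_productM fp (finite_product_at (u pi)^-1 fu).
rewrite exprVn e invrK -natrM -kE; apply: finite_product_eq => v fv.
have [c0 _] := hc v fv; rewrite /c1; case: eqP => [->|_]; last by rewrite mulr1.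
by rewrite invfM invrK -!mulrA mulfV ?mulr1 // lt0r_neq0.
Qed.

End Chain.

(** * Finite part of the height of a subspace as an index *)

Section LatticeIndex.
Variables (R : realType) (K : fieldExtType rat).
Local Notation d := (degree K).
Local Notation O := (@algebraic_integer K).
Local Notation fin v := (~ archimedean v).
Implicit Types v : place R K.

Definition sup_abs n v (x : 'rV[K]_n) : R := \big[Num.max/0]_(i < n) v (x 0 i).

Lemma sup_abs_ge n v (x : 'rV[K]_n) i : v (x 0 i) <= sup_abs v x.
Proof. exact: le_bigmax. Qed.

Lemma sup_abs_ge0 n v (x : 'rV[K]_n) : 0 <= sup_abs v x.
Proof. exact: bigmax_ge_id. Qed.

Lemma sup_abs_le n v (x : 'rV[K]_n) (M : R) : 0 <= M -> (forall i, v (x 0 i) <= M) ->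
  sup_abs v x <= M.
Proof. by move=> M0 h; apply: bigmax_le. Qed.

Lemma sup_abs_gt0 n v (x : 'rV[K]_n) : x != 0 -> 0 < sup_abs v x.
Proof.
move=> /rV0Pn[i xi]; apply: lt_le_trans (sup_abs_ge v x i).
exact: absval_gt0.
Qed.

Lemma sup_abs_attained n v (x : 'rV[K]_n) : x != 0 -> exists i, v (x 0 i) = sup_abs v x.
Proof.
move=> x0; have [i0 _] := rV0Pn _ x0.
have [i _ iE] := @Order.TotalTheory.eq_bigmax _ _ _ (0 : R) i0 xpredT
  (fun i => v (x 0 i)) erefl (fun i _ => absval_ge0 v _).
by exists i; rewrite -iE.
Qed.

Lemma det_ai n (A : 'M[K]_n) : (forall i j, O (A i j)) -> O (\det A).
Proof.
move=> OA; apply: ai_sum => s _; apply: aiM.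
  by apply: aiX; apply: aiN; exact: ai1.
by apply: big_ind => [|x y|i _]; [exact: ai1|exact: aiM|].
Qed.

Section Lattice.
Variables (l N : nat) (Y : 'M[K]_(l, N)) (Z : 'M[K]_(N, l)).
Hypothesis YZ : Y *m Z = 1%:M.
Local Notation gr := (grassmann Y^T).

Lemma grassmannE k : gr 0 k = \det (colsub (tnth (enum_val k)) Y).
Proof.
rewrite mxE -[RHS]det_tr; congr (\det _).
by apply/matrixP => i j; rewrite !mxE.
Qed.

Lemma grassmann_minor (t : l.-tuple 'I_N) : t \in minor_rows N l ->
  exists k, gr 0 k = \det (colsub (tnth t) Y).
Proof. by move=> tm; exists (enum_rank_in tm t); rewrite grassmannE enum_rankK_in. Qed.

Lemma grassmann_neq0 : gr != 0.
Proof.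
apply/negP => /eqP g0; have := congr1 determinant YZ.
rewrite det1 cauchy_binet big1 => [/eqP|t tm]; first by rewrite eq_sym oner_eq0.
by have [k <-] := grassmann_minor tm; rewrite g0 mxE mul0r.
Qed.

(** Here [f] need not be increasing or injective. The Cauchy-Binet formula with a selection matrix
    avoids sorting it. *)
Lemma minor_le v (f : 'I_l -> 'I_N) : fin v ->
  v (\det (colsub f Y)) <= sup_abs v gr.
Proof.
move=> fv; have [p pp hv] := finite_padic fv.
pose S : 'M[K]_(N, l) := \matrix_(k, j) (k == f j)%:R.
have -> : colsub f Y = Y *m S.
  apply/matrixP => i j; rewrite !mxE (bigD1 (f j)) //= big1 ?addr0 => [|k /negPf kf].
    by rewrite !mxE eqxx mulr1.
  by rewrite !mxE kf mulr0.
rewrite cauchy_binet big_mkcond; apply: (padic_ultra_sum pp hv); first exact: sup_abs_ge0.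
move=> t; case: ifP => [tm|_]; last by rewrite absval0 sup_abs_ge0.
have [k <-] := grassmann_minor tm; rewrite absvalM -[leRHS]mulr1.
apply: ler_pM; rewrite ?absval_ge0 ?sup_abs_ge //.
by apply: (padic_ai pp hv); apply: det_ai => i j; rewrite !mxE; exact: ai_nat.
Qed.

Definition integral_lattice (a : 'rV[K]_l) := forall j, O ((a *m Y) 0 j).

Lemma integral_lattice_submodule : is_submodule integral_lattice.
Proof.
split; first split.
- by move=> j; rewrite mul0mx mxE; exact: ai0.
- by move=> x y hx hy j; rewrite mulmxBl !mxE; apply: aiB; [have := hx j|have := hy j]; rewrite mxE.
- by move=> a x Oa hx j; rewrite -scalemxAl mxE; apply: aiM.
Qed.

(** Let [B] be a minor of largest value. Vectors of the lattice times [B] are integral, which bounds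
    determinants by [1 / v (det B)]; the rows of the inverse of [B], rescaled by multipliers of
    value 1, attain this. *)
Lemma max_det_lattice v : fin v -> max_det v integral_lattice (sup_abs v gr)^-1.
Proof.
move=> fv; have [p pp hv] := finite_padic fv.
have g0 := sup_abs_gt0 v grassmann_neq0.
have [k kE] := sup_abs_attained v grassmann_neq0.
rewrite grassmannE in kE; set t := enum_val k in kE.
split; last first.
  move=> A hA; rewrite -[leRHS]mul1r ler_pdivlMr // -kE -absvalM -det_mulmx.
  apply: (padic_ai pp hv); apply: det_ai => i j.
  have := hA i (tnth t j); rewrite -row_mul mxE !mxE => h.
  by under eq_bigr => a _ do rewrite mxE.
set B := colsub (tnth t) Y in kE.
have dB : \det B != 0 by apply/eqP => h; move: g0; rewrite -kE h absval0 ltxx.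
have uB : B \in unitmx by rewrite unitmxE unitfE.
(* By Cramer's rule the entry is a quotient of two minors of [Y], with the largest one in the
   denominator. *)
have BY j c : v ((invmx B *m Y) j c) <= 1.
  pose f (i : 'I_l) := if i == j then c else tnth t i.
  have e : \det (colsub f Y) = \det B * (invmx B *m Y) j c.
    pose u : 'rV[K]_l := \row_i (invmx B *m Y) i c.
    have -> : colsub f Y = B *m (\matrix_(a, i) (if a == j then u 0 i else (a == i)%:R))^T.
      apply/matrixP => i a; rewrite [LHS]mxE [RHS]mxE /f; case: eqP => [->|/eqP aj].
        under eq_bigr => b _ do rewrite !mxE eqxx.
        have : (B *m (invmx B *m Y)) i c = Y i c by rewrite mulKVmx.
        by rewrite mxE => <-; apply: eq_bigr => b _; rewrite !mxE.
      rewrite (bigD1 a) //= big1 ?addr0 => [|b /negPf ba].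
        by rewrite !mxE (negPf aj) eqxx mulr1.
      by rewrite !mxE (negPf aj) eq_sym ba mulr0.
    by rewrite det_mulmx det_tr det_row_replace mxE.
  have := minor_le f fv; rewrite e absvalM -kE => h.
  have B0 : 0 < v (\det B) by rewrite kE.
  by rewrite -(ler_pM2l B0) mulr1.
have /choice[s hs] : forall j, exists s, [/\ O s, v s = 1 & forall c, O (s * (invmx B *m Y) j c)].
  move=> j; have [t0 [pi tpi]] := place_uniformizer pp hv.
  exact: (localize pp hv tpi (BY j)).
exists (diag_mx (\row_i s i) *m invmx B).
  move=> i c; rewrite row_mul -mulmxA -row_mul mxE mul_diag_mx !mxE.
  by have [_ _] := hs i; move/(_ c); rewrite mxE.
rewrite det_mulmx det_diag det_inv absvalM absvalV kE.
rewrite (_ : v _ = 1) ?mul1r //.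
apply: (big_ind (fun x => v x = 1)) => [|x y vx vy|i _]; first exact: absval1.
  by rewrite absvalM vx vy mul1r.
by rewrite mxE; case: (hs i).
Qed.

Definition multiples_vec m (a : 'rV[K]_l) := forall i, multiples m (a 0 i).

Lemma multiples_vec_submodule m : is_submodule (multiples_vec m).
Proof.
split; first split.
- by move=> i; exists 0; [exact: ai0|rewrite mxE mulr0].
- move=> x y hx hy i; have [a Oa aE] := hx i; have [b Ob bE] := hy i.
  by exists (a - b); [exact: aiB|rewrite !mxE aE bE mulrBr].
- move=> a x Oa hx i; have [b Ob bE] := hx i.
  by exists (a * b); [exact: aiM|rewrite mxE bE mulrCA].
Qed.

Lemma max_det_multiples v m : fin v -> max_det v (multiples_vec m) (v m%:R ^+ l).
Proof.
move=> fv; have [p pp hv] := finite_padic fv; split.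
  exists (m%:R *: 1%:M); last by rewrite detZ det1 mulr1 absvalX.
  move=> i j; exists ((i == j)%:R); first exact: ai_nat.
  by rewrite !mxE.
move=> A hA; have /choice[a aE] : forall i, exists a : 'I_l -> K, forall j, O (a j) /\ A i j = m%:R * a j.
  move=> i; have /choice[a aE] : forall j, exists a, O a /\ A i j = m%:R * a.
    by move=> j; have [a Oa] := hA i j; rewrite mxE; exists a.
  by exists a.
have -> : A = m%:R *: (\matrix_(i, j) a i j).
  by apply/matrixP => i j; rewrite !mxE; case: (aE i j).
rewrite detZ absvalM absvalX -[leRHS]mulr1; apply: ler_wpM2l; rewrite ?exprn_ge0 ?absval_ge0 //.
by apply: (padic_ai pp hv); apply: det_ai => i j; rewrite mxE; case: (aE i j).
Qed.

Lemma max_det_uniq v (M : 'rV[K]_l -> Prop) c c' : max_det v M c -> max_det v M c' -> c = c'.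
Proof.
move=> [[A MA <-] hA] [[B MB <-] hB]; apply/eqP; rewrite eq_le; apply/andP; split.
  exact: hB.
exact: hA.
Qed.

(** The lattice and [O^l] need not contain one another, so both are compared with [m O^l]; in [O^l]
    it has index [m ^ (l * d)] and the local determinants are 1. *)
Lemma lattice_index m k : (0 < m)%N -> (forall a, multiples_vec m a -> integral_lattice a) ->
  has_index integral_lattice (multiples_vec m) k ->
  finite_product (fun v => sup_abs v gr) ((m ^ (l * d))%:R / k%:R).
Proof.
move=> m0 sub hk.
have mK := natK_neq0 K m0.
have hm v : fin v -> 0 < v m%:R ^+ l /\ max_det v (multiples_vec m) (v m%:R ^+ l).
  by move=> fv; split; [exact/exprn_gt0/absval_gt0|exact: max_det_multiples].
have [c [hc fpc]] := index_finite_product (multiples_vec_submodule m)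
  integral_lattice_submodule sub hk hm.
pose full (a : 'rV[K]_l) := forall i, O (a 0 i).
have mfull : is_submodule full.
  split; first split.
  - by move=> i; rewrite mxE; exact: ai0.
  - by move=> x y hx hy i; rewrite !mxE; apply: aiB; [exact: hx|exact: hy].
  - by move=> a x Oa hx i; rewrite mxE; apply: aiM => //; exact: hx.
have subf a : multiples_vec m a -> full a.
  by move=> h i; apply: multiples_ai (h i).
have hf := index_vec l (index_multiples R K m0).
have [c' [hc' fpc']] := index_finite_product (multiples_vec_submodule m) mfull subf hf hm.
have := finite_productM fpc' (finite_productV fpc).
rewrite -expnM mulnC; apply: finite_product_eq => v fv.
have [c0 hcv] := hc v fv; have [c0' hcv'] := hc' v fv.
have -> : c v = (sup_abs v gr)^-1 := max_det_uniq hcv (max_det_lattice fv).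
have -> : c' v = 1.
  apply: (max_det_uniq hcv'); have := max_det_multiples 1 fv.
  rewrite absval1 expr1n => -[[A hA vA] h]; split.
    by exists A => // i j; apply: multiples_ai (hA i j).
  move=> B hB; apply: h => i j; exists (row i B 0 j); [exact: hB|by rewrite mul1r].
have [m1 _] := hm v fv.
rewrite invf_div invrK mul1r; move: (_ ^+ l) m1 => x x0.
by rewrite mulrA mulVf ?mul1r // lt0r_neq0.
Qed.

(** Inverting a nonzero maximal minor bounds the denominators of the lattice by some [E], and
    [m O^l] has finite index in [E^-1 O^l]. *)
Lemma lattice_index_exists m : (0 < m)%N ->
  (forall a, multiples_vec m a -> integral_lattice a) ->
  exists2 k, (0 < k)%N & has_index integral_lattice (multiples_vec m) k.
Proof.
move=> m0 sub.
have [i0 gi] := rV0Pn _ grassmann_neq0.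
rewrite grassmannE in gi; set t := enum_val i0 in gi.
set B := colsub (tnth t) Y in gi.
have uB : B \in unitmx by rewrite unitmxE unitfE.
have /choice[e he] : forall x : K, exists e : nat, (0 < e)%N /\ O (e%:R * x).
  by move=> x; have [e e0 Oe] := ai_multiple x; exists e.
pose E := (\prod_(i < l) \prod_(j < l) e (invmx B i j))%N.
have E0 : (0 < E)%N.
  by rewrite prodn_gt0 // => i; rewrite prodn_gt0 // => j; case: (he (invmx B i j)).
have OE i j : O (E%:R * invmx B i j).
  rewrite /E (bigD1 i) //= (bigD1 j) //= -mulnA natrM mulrAC mulrC.
  by apply: aiM; [exact: ai_nat|case: (he (invmx B i j))].
have bd a : integral_lattice a -> forall i, O (E%:R * a 0 i).
  move=> ha i; have -> : a = colsub (tnth t) (a *m Y) *m invmx B.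
    have -> : colsub (tnth t) (a *m Y) = a *m B.
      by apply/rowP => j; rewrite !mxE; apply: eq_bigr => b _; rewrite !mxE.
    by rewrite mulmxK.
  rewrite mxE mulr_sumr; apply: ai_sum => j _; rewrite mulrCA; apply: aiM => //.
  by rewrite mxE.
have hi : has_index (fun x => O (E%:R * x)) (multiples m) ((E * m) ^ d).
  have [|r [Or rU]] := @index_multiples R K (E * m); first by rewrite muln_gt0 E0.
  have EK := natK_neq0 K E0.
  exists (fun i => r i / E%:R); split=> [i|x Ox]; first by rewrite mulrC divfK.
  have [i [[y Oy yE] iU]] := rU _ Ox; exists i; split.
    exists y => //; apply: (mulfI EK); rewrite mulrBr [_ * (r i / _)]mulrC divfK // yE natrM mulrA //.
  move=> j [y' Oy' y'E]; apply: iU; exists y' => //.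
  by rewrite natrM -mulrA -y'E mulrBr [_ * (r j / _)]mulrC divfK.
have [k _ hk] := index_le integral_lattice_submodule.1 bd sub (index_vec l hi).
exists k => //; case: hk => r [_ rU].
have [i _] := rU 0 integral_lattice_submodule.1.1.
exact: leq_ltn_trans (ltn_ord i).
Qed.

End Lattice.
End LatticeIndex.

(** * The lattice of integral points of a subspace *)

Lemma pairing_exists p q : exists (f : 'I_(p * q) -> 'I_p) (g : 'I_(p * q) -> 'I_q),
  bijective (fun i => (f i, g i)).
Proof.
have e : #|{: 'I_p * 'I_q}| = (p * q)%N by rewrite card_prod !card_ord.
pose h (i : 'I_(p * q)) : 'I_p * 'I_q := enum_val (cast_ord (esym e) i).
exists (fun i => (h i).1), (fun i => (h i).2).
exists (fun x => cast_ord e (enum_rank x)) => [i|x].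
  by rewrite -surjective_pairing enum_valK cast_ordKV.
by rewrite -surjective_pairing /h cast_ordK enum_rankK.
Qed.

Lemma sum_pairing (V : nmodType) (n p q : nat) (f : 'I_n -> 'I_p) (g : 'I_n -> 'I_q)
    (F : 'I_p -> 'I_q -> V) : bijective (fun i => (f i, g i)) ->
  \sum_i F (f i) (g i) = \sum_i \sum_j F i j.
Proof. by move=> b; rewrite pair_bigA /= (reindex _ (onW_bij _ b)). Qed.

Lemma conj_fixed (R : rcfType) (z : R[i]) : (z^*)%C = z -> z = (complex.Re z)%:C%C.
Proof.
case: z => a b [] h; congr Complex.
by lra.
Qed.

Section Gram.
Variables (R : realType) (K : fieldExtType rat).
Local Notation C := R[i].
Local Notation d := (degree K).
Local Notation O := (@algebraic_integer K).
Variable s : 'I_d -> {rmorphism K -> C}.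
Hypothesis hs : all_embeddings s.
Variable kp : 'I_d -> 'I_d.
Hypothesis kpE : forall k x, s (kp k) x = ((s k x)^*)%C.
Variables (w : 'I_d -> K) (l N : nat) (Y : 'M[K]_(l, N)) (m : nat).
Hypotheses (dw : \det (conj_mx s w) != 0)
  (Dw : ratr (discriminant K) = \det (conj_mx s w) ^+ 2) (m0 : (0 < m)%N)
  (gr0 : grassmann Y^T != 0).
Local Notation n := (l * d)%N.
Variables (f : 'I_n -> 'I_l) (g : 'I_n -> 'I_d).
Hypothesis bfg : bijective (fun i => (f i, g i)).
Local Notation toR := (map_mx (ratr : rat -> R)).

(** Rational coordinates in the basis of [m O^l] formed by the [m * w t] in each of the [l] places;
    integral vectors [a] correspond to that sublattice. *)
Definition coord_row (a : 'rV[rat]_n) : 'rV[K]_l :=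
  \row_j (\sum_i (a 0 i *: (m%:R * w (g i))) *+ (f i == j)).

Definition gen (i : 'I_n) (c : 'I_N) : K := m%:R * w (g i) * Y (f i) c.

Lemma coord_rowY a c : (coord_row a *m Y) 0 c = \sum_i a 0 i *: gen i c.
Proof.
rewrite mxE; under eq_bigr => j _ do rewrite mxE mulr_suml.
rewrite exchange_big; apply: eq_bigr => i _.
rewrite (bigD1 (f i)) //= eqxx mulr1n big1 ?addr0 => [|j /negPf fj].
  by rewrite -scalerAl.
by rewrite eq_sym fj mul0r.
Qed.

Let B k (i : 'I_n) c := s k (gen i c).
(** The Gram matrix of the generators for the sum of squared moduli of all conjugates of all
    coordinates; its entries are real because conjugation permutes the embeddings. *)
Let H : 'M[C]_n := \matrix_(i, j) \sum_k \sum_c B k i c * ((B k j c)^*)%C.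
Let G : 'M[R]_n := map_mx (@complex.Re R) H.

Let HG : H = map_mx (real_complex R) G.
Proof.
apply/matrixP => i j; rewrite !mxE; apply: conj_fixed.
rewrite rmorph_sum /=; rewrite [RHS](reindex_inj (inv_inj (emb_conjK hs kpE))) /=.
apply: eq_bigr => k _; rewrite rmorph_sum /=; apply: eq_bigr => c _.
by rewrite /B !kpE rmorphM.
Qed.

Let E : 'M[C]_n := \matrix_(i, j) ((f i == f j)%:R * s (g j) (m%:R * w (g i))).
Let X k : 'M[C]_(l, N) := map_mx (s k) Y.
Let P k : 'M[C]_l := X k *m (map_mx (@conjc R) (X k))^T.
Let D : 'M[C]_n := \matrix_(i, j) ((g i == g j)%:R * P (g i) (f i) (f j)).

(** Separates the discriminant from the height: [E] has one block of conjugates of [w] for each of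
    the [l] places, [D] one Gram block of [Y] for each embedding, so [det_blocks] applies along the
    two projections of the pairing. *)
Let HE : H = E *m D *m (map_mx (@conjc R) E)^T.
Proof.
apply/matrixP => i i'; rewrite !mxE.
have e1 a : (E *m D) i a = \sum_j (f i == j)%:R * s (g a) (m%:R * w (g i)) * P (g a) j (f a).
  rewrite mxE.
  transitivity (\sum_b (fun j k => (f i == j)%:R * s k (m%:R * w (g i)) *
      ((k == g a)%:R * P k j (f a))) (f b) (g b)).
    by apply: eq_bigr => b _; rewrite !mxE.
  rewrite (@sum_pairing _ _ _ _ _ _ (fun j k => (f i == j)%:R * s k (m%:R * w (g i)) *
      ((k == g a)%:R * P k j (f a))) bfg); apply: eq_bigr => j _.
  rewrite (bigD1 (g a)) //= eqxx mul1r big1 ?addr0 // => k /negPf ->.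
  by rewrite mul0r mulr0.
transitivity (\sum_k \sum_j (f i' == j)%:R * ((s k (m%:R * w (g i')))^*)%C *
   \sum_j' (f i == j')%:R * s k (m%:R * w (g i)) * P k j' j).
  apply: eq_bigr => k _.
  rewrite (bigD1 (f i')) //= eqxx mul1r [X in _ = _ + X]big1 ?addr0; last first.
    by move=> j /negPf; rewrite eq_sym => ->; rewrite !mul0r.
  rewrite (bigD1 (f i)) //= eqxx mul1r [X in _ = _ * (_ + X)]big1 ?addr0; last first.
    by move=> j /negPf; rewrite eq_sym => ->; rewrite !mul0r.
  rewrite /P mxE !mulr_sumr; apply: eq_bigr => c _.
  by rewrite !mxE /B /gen !rmorphM /=; ring.
rewrite exchange_big -(sum_pairing _ bfg) /=; apply: eq_bigr => a _.
rewrite e1 mulrC; congr (_ * _).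
by rewrite !mxE (rmorphM (@conjc R)) /= (rmorph_nat (@conjc R)).
Qed.

Let detE : \det E = (m%:R ^+ d * \det (conj_mx s w)) ^+ l.
Proof.
have -> : E = \matrix_(i, j) ((f i == f j)%:R *
    (fun _ => m%:R *: conj_mx s w) (f i) (g i) (g j)).
  by apply/matrixP => i j; rewrite !mxE rmorphM rmorph_nat.
transitivity (\prod_(j < l) \det (m%:R *: conj_mx s w)).
  exact: (@det_blocks _ _ _ _ _ _ (fun _ => m%:R *: conj_mx s w) bfg).
by rewrite prodr_const card_ord detZ.
Qed.

Let gram k := \sum_i nm (s k (grassmann Y^T 0 i)) ^+ 2.

Let gram_gt0 k : 0 < gram k.
Proof.
have [i gi] := rV0Pn _ gr0; apply: lt_le_trans (_ : nm (s k (grassmann Y^T 0 i)) ^+ 2 <= _).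
  by rewrite exprn_gt0 // lt_neqAle nm_ge0 eq_sym nm_eq0 fmorph_eq0 gi.
by rewrite /gram (bigD1 i) //= lerDl sumr_ge0 // => j _; rewrite sqr_ge0.
Qed.

Let detP k : \det (P k) = (gram k)%:C%C.
Proof.
rewrite /P cauchy_binet /gram rmorph_sum /=.
rewrite big_enum_val; apply: eq_bigr => i _.
rewrite nm_sqr mxE -det_map_mx.
have -> : colsub (tnth (enum_val i)) (X k) = (map_mx (s k) (rowsub (tnth (enum_val i)) Y^T))^T.
  by apply/matrixP => a b; rewrite !mxE.
rewrite det_tr; congr (_ * _); rewrite -[RHS]/(conjc _) -det_map_mx.
by congr (\det _); apply/matrixP => a b; rewrite !mxE.
Qed.

Let detH : \det H = (nm (\det E) ^+ 2 * \prod_k gram k)%:C%C.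
Proof.
rewrite HE !det_mulmx det_tr det_map_mx mulrAC rmorphM /= nm_sqr; congr (_ * _).
transitivity (\prod_k \det (P k)).
  apply: (@det_blocks _ _ _ _ g f P).
  by apply: (@bij_comp _ _ _ (fun x => (x.2, x.1)) (fun i => (f i, g i))) bfg;
     exists (fun x => (x.2, x.1)) => -[].
by rewrite rmorph_prod /=; apply: eq_bigr => k _; exact: detP.
Qed.

Let detE_neq0 : \det E != 0.
Proof.
rewrite detE expf_neq0 // mulf_neq0 // expf_neq0 //.
by rewrite pnatr_eq0 -lt0n.
Qed.

Let detG : \det G = nm (\det E) ^+ 2 * \prod_k gram k.
Proof. by apply: complexI; rewrite -detH HG det_map_mx. Qed.

Let detG_gt0 : 0 < \det G.
Proof.
rewrite detG mulr_gt0 //; last by apply: prodr_gt0 => k _; exact: gram_gt0.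
by rewrite exprn_gt0 // lt_neqAle nm_ge0 eq_sym nm_eq0 detE_neq0.
Qed.

Let quad (a : 'rV[R]_n) : (a *m G *m a^T) 0 0 =
  \sum_k \sum_c nm (\sum_i (a 0 i)%:C%C * B k i c) ^+ 2.
Proof.
have cM (x : R) (y : C) : ((x%:C * y)^* = x%:C * y^*)%C.
  by case: y => u v; apply/eqP; rewrite eq_complex /=; apply/andP; split; apply/eqP; ring.
apply: complexI; rewrite mxE !rmorph_sum /=.
transitivity (\sum_k \sum_c \sum_j \sum_i ((a 0 i)%:C%C * B k i c) * ((a 0 j)%:C%C * ((B k j c)^*)%C)); last first.
  apply: eq_bigr => k _; rewrite rmorph_sum /=; apply: eq_bigr => c _.
  rewrite nm_sqr rmorph_sum /= mulr_sumr; apply: eq_bigr => j _; rewrite mulr_suml.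
  by apply: eq_bigr => i _; rewrite cM.
under [RHS]eq_bigr => k _ do rewrite exchange_big.
rewrite [RHS]exchange_big; apply: eq_bigr => j _ /=.
under [RHS]eq_bigr => k _ do rewrite exchange_big.
rewrite [RHS]exchange_big mxE [a^T j 0]mxE rmorphM rmorph_sum /= mulr_suml.
apply: eq_bigr => i _; rewrite rmorphM /=.
have -> : (G i j)%:C%C = H i j by rewrite [in RHS]HG [RHS]mxE.
rewrite mxE mulr_sumr mulr_suml; apply: eq_bigr => k _.
by rewrite mulr_sumr mulr_suml; apply: eq_bigr => c _; ring.
Qed.

Let G_sym : G^T = G.
Proof.
apply/matrixP => i j; apply: complexI; rewrite mxE.
have e a b : (G a b)%:C%C = H a b by rewrite [in RHS]HG [RHS]mxE.
rewrite -[RHS]conjc_real !e !mxE rmorph_sum /=; apply: eq_bigr => k _.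
rewrite rmorph_sum /=; apply: eq_bigr => c _.
by rewrite rmorphM /= conjcK mulrC.
Qed.

Let G_pos (a : 'rV[R]_n) : a != 0 -> 0 < (a *m G *m a^T) 0 0.
Proof.
move=> a0; rewrite lt_neqAle quad andbC; apply/andP; split.
  by apply: sumr_ge0 => k _; apply: sumr_ge0 => c _; rewrite sqr_ge0.
apply: contra_neqN a0; rewrite eq_sym psumr_eq0 => [/allP hk|k _]; last first.
  by apply: sumr_ge0 => c _; rewrite sqr_ge0.
have z k c : \sum_i (a 0 i)%:C%C * B k i c = 0.
  have := hk k (mem_index_enum k); rewrite /= psumr_eq0 => [/allP/(_ c (mem_index_enum c))|c' _].
    by rewrite /= sqrf_eq0 nm_eq0 => /eqP.
  exact: sqr_ge0.
have aH : map_mx (real_complex R) a *m H = 0.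
  apply/rowP => j; rewrite !mxE; under eq_bigr => i _ do rewrite !mxE mulr_sumr.
  rewrite exchange_big big1 // => k _ /=; under eq_bigr => i _ do rewrite mulr_sumr.
  rewrite exchange_big big1 // => c _ /=; under eq_bigr => i _ do rewrite mulrA.
  by rewrite -mulr_suml z mul0r.
have uH : H \in unitmx by rewrite unitmxE unitfE HG det_map_mx fmorph_eq0 lt0r_neq0.
have := congr1 (mulmx^~ (invmx H)) aH; rewrite /= mulmxK // mul0mx => /matrixP h.
by apply/rowP => j; apply: complexI; have := h 0 j; rewrite !mxE.
Qed.

Lemma gram_cholesky : exists2 A : 'M[R]_n, is_trig_mx A /\ (forall i, 0 < A i i) &
  (forall a : 'rV[rat]_n, \sum_j (toR a *m A) 0 j ^+ 2 =
     \sum_k \sum_c nm (s k ((coord_row a *m Y) 0 c)) ^+ 2) /\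
  \prod_j A j j = m%:R ^+ n * Num.sqrt `|ratr (discriminant K)| ^+ l *
    \prod_k Num.sqrt (\sum_i nm (s k (grassmann Y^T 0 i)) ^+ 2).
Proof.
have [A [tA pA] GA] := cholesky G_sym G_pos; exists A => //; split=> [a|].
  have -> : \sum_j (toR a *m A) 0 j ^+ 2 = (toR a *m G *m (toR a)^T) 0 0.
    rewrite GA !mulmxA -mulmxA -trmx_mul mxE; apply: eq_bigr => j _.
    by rewrite expr2 [(_^T) j 0]mxE.
  rewrite quad; apply: eq_bigr => k _; apply: eq_bigr => c _; congr (nm _ ^+ 2).
  rewrite coord_rowY rmorph_sum; apply: eq_bigr => i _.
  by rewrite emb_scale mxE ratr_complex.
have pr0 : 0 <= \prod_j A j j by apply: prodr_ge0 => j _; exact: ltW.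
have sg k : 0 <= Num.sqrt (gram k) by exact: sqrtr_ge0.
apply/eqP; rewrite -(@eqrXn2 _ 2) //; last first.
  by rewrite !mulr_ge0 ?exprn_ge0 ?sqrtr_ge0 ?ler0n //; apply: prodr_ge0 => k _; exact: sg.
have <- : \det G = (\prod_j A j j) ^+ 2.
  by rewrite GA det_mulmx det_tr (det_trig tA) expr2.
have yD : nm (\det (conj_mx s w)) ^+ 2 = `|ratr (discriminant K)|.
  by rewrite -nmX -Dw nm_ratr.
have nmm : nm (m%:R : C) = m%:R by rewrite -(rmorph_nat (real_complex R)) nm_real normr_nat.
apply/eqP; rewrite detG detE nmX nmM nmX nmm !exprMn -prodrXl; congr (_ * _ * _).
- by rewrite -!exprM mulnA [(d * l)%N]mulnC.
- by rewrite -!exprM mulnC !exprM sqr_sqrtr // yD.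
- by apply: eq_bigr => k _; rewrite sqr_sqrtr // ltW // gram_gt0.
Qed.

End Gram.

Section Lattices.
Variables (R : realType) (K : fieldExtType rat).
Local Notation C := R[i].
Local Notation d := (degree K).
Local Notation O := (@algebraic_integer K).
Local Notation fin v := (~ archimedean v).
Variable s : 'I_d -> {rmorphism K -> C}.
Hypothesis hs : all_embeddings s.
Variable kp : 'I_d -> 'I_d.
Hypothesis kpE : forall k x, s (kp k) x = ((s k x)^*)%C.
Variable pl : 'I_d -> place R K.
Hypothesis pl_arch : forall k, archimedean (pl k).
Hypothesis plE : forall k x, pl k x = nm (s k x).
Local Notation toR := (map_mx (ratr : rat -> R)).

Let d0 : (0 < d)%N. Proof. by rewrite /degree adim_gt0. Qed.
Let dR0 : 0 < (d%:R : R). Proof. by rewrite ltr0n. Qed.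

Lemma powR_root (x : R) m : 0 <= x -> (x `^ (m%:R / d%:R)) ^+ d = x ^+ m.
Proof.
move=> x0; rewrite -powR_mulrn ?powR_ge0 // -powRrM divfK ?lt0r_neq0 //.
exact: powR_mulrn.
Qed.

Lemma local_heightE n (v : place R K) (x : 'rV[K]_n) : x != 0 ->
  local_height v x = sup_abs v x `^ ((local_degree v)%:R / d%:R).
Proof.
move=> x0; have e0 : 0 <= (local_degree v)%:R / d%:R :> R by rewrite divr_ge0.
have mono (a b : R) : 0 <= a -> a <= b -> a `^ ((local_degree v)%:R / d%:R) <= b `^ ((local_degree v)%:R / d%:R).
  by move=> a0 ab; apply: ge0_ler_powR => //; rewrite nnegrE // (le_trans a0).
apply/eqP; rewrite eq_le; apply/andP; split.
  apply: bigmax_le => [|i _]; first exact: powR_ge0.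
  by apply: mono; [exact: absval_ge0|exact: sup_abs_ge].
have [i <-] := sup_abs_attained v x0.
exact: (le_bigmax _ (fun i => place_norm v (x 0 i)) i).
Qed.

Lemma height2_pow n (x : 'rV[K]_n) a : x != 0 ->
  finite_product (fun v => sup_abs v x) a ->
  height2 R x ^+ d = a * \prod_k Num.sqrt (\sum_i nm (s k (x 0 i)) ^+ 2).
Proof.
move=> x0 [S [uS fS S1 <-]]; rewrite /height2 (negPf x0) exprMn; congr (_ * _).
  rewrite (@fsbigE _ _ _ _ _ S) //=.
  - rewrite -prodrXl big_seq_cond [RHS]big_seq_cond; apply: eq_big => [v|v /andP[vS _]].
      by rewrite andbT; apply: andb_idr => /fS fv; rewrite inE.
    by rewrite local_heightE // powR_root // sup_abs_ge0.
  - by move=> v /= fv nv; rewrite local_heightE // S1 // powR1.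
pose F (v : place R K) := Num.sqrt (\sum_i v (x 0 i) ^+ 2).
have e v : local_height2 v x ^+ d = F v ^+ local_degree v.
  have S0 : 0 <= \sum_i v (x 0 i) ^+ 2 by apply: sumr_ge0 => i _; rewrite sqr_ge0.
  rewrite /local_height2 /F -powR12_sqrt //.
  have -> : (local_degree v)%:R / (2 * d%:R) = 2^-1 * ((local_degree v)%:R / d%:R) :> R.
    by rewrite invfM mulrCA.
  by rewrite powRrM powR_root ?powR_ge0.
rewrite (eq_bigr (fun k => F (pl k))); last first.
  by move=> k _; congr (Num.sqrt _); apply: eq_bigr => i _; rewrite plE.
rewrite (prod_arch hs kpE pl_arch plE).
have fa := finite_arch hs kpE pl_arch plE.
rewrite !fsbig_finite //= -prodrXl; apply: eq_bigr => v _; exact: e.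
Qed.

Section Height.
Variables (n : nat) (x : 'rV[K]_n) (T : R).
Hypotheses (T1 : 1 <= T) (Ox : forall i, O (x 0 i))
  (hx : forall k i, nm (s k (x 0 i)) <= T).

Lemma height_le : height R x <= T.
Proof.
rewrite /height; case: eqP => [_|/eqP x0]; first exact: le_trans T1.
pose t (v : place R K) := T `^ ((local_degree v)%:R / d%:R).
have t1 v : 1 <= t v.
  by rewrite -(powRr0 T) /t; apply: ler_powR => //; rewrite divr_ge0.
have lh v : 0 <= local_height v x <= (if `[< archimedean v >] then t v else 1).
  rewrite local_heightE // powR_ge0 /=; case: asboolP => av.
    have [k ->] := arch_place_pl hs kpE plE av.
    apply: ge0_ler_powR; rewrite ?divr_ge0 ?nnegrE ?sup_abs_ge0 //; first exact: le_trans T1.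
    by apply: sup_abs_le => [|i]; [exact: le_trans T1|rewrite plE].
  have [l pl' hv] := finite_padic av.
  apply: le_trans (_ : _ <= 1 `^ ((local_degree v)%:R / d%:R)) _; last by rewrite powR1.
  apply: ge0_ler_powR; rewrite ?divr_ge0 ?nnegrE ?sup_abs_ge0 //.
  by apply: sup_abs_le => // i; exact: (padic_ai pl' hv).
apply: le_trans (ler_prod _ (fun v _ => lh v)) _.
rewrite -big_mkcond /=.
have fa := finite_arch hs kpE pl_arch plE.
(* Apply [prod_arch] to a constant: the local degrees at the archimedean places add up to [d]. *)
have TE : \prod_(v <- finmap.enum_fset (fset_set [set v : place R K | archimedean v]%classic)) t v = T.
  have := prod_arch hs kpE pl_arch plE (fun _ => T `^ (d%:R^-1)).
  rewrite prodr_const card_ord -powR_mulrn ?powR_ge0 // -powRrM mulVf ?lt0r_neq0 //.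
  rewrite powRr1 ?(le_trans _ T1) // fsbig_finite //= => ->; apply: eq_bigr => v _.
  by rewrite -powR_mulrn ?powR_ge0 // -powRrM mulrC.
(* The height runs over its support [S] only; archimedean places outside [S] contribute factors at
   least 1 to [T]. *)
rewrite -[leRHS]TE; set S := finite_support _ _ _; set A := finmap.enum_fset _.
have uS : uniq S by rewrite /S /finite_support unlock; exact: finmap.fset_uniq.
have uA : uniq A by exact: finmap.fset_uniq.
rewrite [leRHS](bigID (mem S)) /=.
have -> : \prod_(v <- S | `[< archimedean v >]) t v = \prod_(v <- A | v \in S) t v.
  rewrite -big_filter -[RHS]big_filter; apply: perm_big; apply: uniq_perm; rewrite ?filter_uniq //.
  move=> v; rewrite !mem_filter andbC; congr (_ && _).
  by rewrite in_fset_set // in_setE.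
rewrite ler_peMr //; first by apply: prodr_ge0 => v _; rewrite (le_trans _ (t1 v)).
by rewrite big_seq_cond; apply: (big_ind (fun y => 1 <= y)) => // a b a1 b1; exact: mulr_ege1.
Qed.

End Height.
Definition integral_point N (x : 'rV[K]_N) := forall c, O (x 0 c).

Section Subspace.
Variables (N : nat) (V : {vspace 'rV[K]_N}).
Local Notation l := (\dim V).
Local Notation n := (l * d)%N.
Hypothesis l0 : (0 < l)%N.
Local Notation Y := (basis_mx V)^T.
Local Notation absD := `|ratr (discriminant K) : R|.

Let rowY (b : 'rV[K]_l) : b *m Y = \sum_j b 0 j *: (vbasis V)`_j.
Proof.
rewrite mulmx_sum_row; apply: eq_bigr => j _; congr (_ *: _).
by apply/rowP => c; rewrite !mxE (tnth_nth 0).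
Qed.

Let rowY_mem b : b *m Y \in V.
Proof.
rewrite rowY; apply: memv_suml => j _; apply: memvZ; apply: vbasis_mem.
by rewrite mem_nth // size_tuple.
Qed.

Let rowY_surj x : x \in V -> exists b, b *m Y = x.
Proof.
move=> xV; exists (\row_j coord (vbasis V) j x).
by rewrite rowY [RHS](coord_vbasis xV); apply: eq_bigr => j _; rewrite mxE.
Qed.

Let rowY_inj (b : 'rV[K]_l) : b *m Y = 0 -> b = 0.
Proof.
rewrite rowY => h; have fr := vector.basis_free (vbasisP V).
apply/rowP => j; rewrite mxE -(coord_sum_free (fun j => b 0 j) j fr) h.
by rewrite linear0.
Qed.

Lemma basis_mx_right_inverse : exists Z, Y *m Z = 1%:M.
Proof. by exists (pinvmx Y); apply/mulmxVp/inj_row_free/rowY_inj. Qed.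

(** Packages what counting needs: [ka] parametrizes [V] by rational vectors and sends integral ones
    to integral points, [h] and [u] label the [k] cosets of these among all parameters of integral
    points, and [A] turns the archimedean norm into a sum of squares. *)
Lemma lattice_exists : exists (k : nat) (A : 'M[R]_n)
    (ka : 'rV[rat]_n -> 'rV[K]_N) (h : 'rV[rat]_n -> 'I_k) (u : 'I_k -> 'rV[rat]_n),
  [/\ (0 < k)%N, is_trig_mx A /\ (forall i, 0 < A i i),
    [/\ {morph ka : a b / a - b}, (forall a, ka a = 0 -> a = 0), (forall a, ka a \in V) &
        forall x, x \in V -> exists a, ka a = x],
    [/\ forall a, a \is a mxOver Num.int -> integral_point (ka a),
       forall a b, integral_point (ka a) -> integral_point (ka b) -> h a = h b ->
         a - b \is a mxOver Num.int,
       forall i, integral_point (ka (u i)) &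
       forall i j, u i - u j \is a mxOver Num.int -> i = j] &
    (forall a, \sum_j (toR a *m A) 0 j ^+ 2 = \sum_k \sum_c nm (s k (ka a 0 c)) ^+ 2) /\
    k%:R / \prod_j A j j = (Num.sqrt absD ^+ l * subspace_height R V ^+ d)^-1].
Proof.
have [Z YZ] := basis_mx_right_inverse.
have [w [[Ow hw] dw Dw]] := discriminant_basis hs.
have [f [g bfg]] := pairing_exists l d.
have [m m0 sub] : exists2 m, (0 < m)%N &
    forall b : 'rV[K]_l, multiples_vec m b -> integral_lattice Y b.
  have /choice[e he] : forall x : K, exists e : nat, (0 < e)%N /\ O (e%:R * x).
    by move=> x; have [e e0 Oe] := ai_multiple x; exists e.
  exists (\prod_(i < l) \prod_(j < N) e (Y i j))%N.
    by rewrite prodn_gt0 // => i; rewrite prodn_gt0 // => j; case: (he (Y i j)).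
  move=> b hb c; rewrite mxE; apply: ai_sum => i _; have [y Oy ->] := hb i.
  rewrite (bigD1 i) //= (bigD1 c) //= -mulnA natrM -mulrA mulrAC; apply: aiM.
    by case: (he (Y i c)).
  by apply: aiM => //; exact: ai_nat.
have mK := natK_neq0 K m0.
have gr0 := grassmann_neq0 YZ.
have [k k0 hk] := lattice_index_exists R YZ m0 sub.
have fp := lattice_index R YZ m0 sub hk.
have [A [tA pA] [normA volA]] := gram_cholesky hs kpE dw Dw m0 gr0 bfg.
have [phi phiK Kphi] := bfg.
pose cr := @coord_row K w l m f g.
have crE (c : 'I_l -> 'I_d -> rat) j :
    cr (\row_i c (f i) (g i)) 0 j = m%:R * \sum_t c j t *: w t.
  rewrite mxE.
  transitivity (\sum_i (fun j' t => (c j' t *: (m%:R * w t)) *+ (j' == j)) (f i) (g i)).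
    by apply: eq_bigr => i _; rewrite mxE.
  rewrite (@sum_pairing _ _ _ _ _ _ (fun j' t => (c j' t *: (m%:R * w t)) *+ (j' == j)) bfg).
  rewrite (bigD1 j) //= [X in _ + X]big1 ?addr0 => [|j' /negPf jj]; last first.
    by rewrite big1 // => t _; rewrite jj.
  by rewrite mulr_sumr; apply: eq_bigr => t _; rewrite eqxx mulr1n scalerAr.
have crA a j : cr a 0 j = m%:R * \sum_t a 0 (phi (j, t)) *: w t.
  rewrite -(crE (fun j t => a 0 (phi (j, t)))); congr (cr _ 0 j).
  by apply/rowP => i; rewrite mxE phiK.
have crB : {morph cr : a b / a - b}.
  move=> a b; apply/rowP => j; rewrite !mxE -sumrB; apply: eq_bigr => i _.
  by rewrite !mxE scalerBl mulrnBl.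
have cr_inj a : cr a = 0 -> a = 0.
  move=> h; apply/rowP => i; rewrite mxE.
  have := congr1 (fun b : 'rV_l => b 0 (f i)) h; rewrite crA mxE => /eqP.
  rewrite mulf_eq0 (negPf mK) /= => /eqP e.
  have : \row_t a 0 (phi (f i, t)) = 0.
    apply: (conj_mx_free dw); rewrite -[RHS]e; apply: eq_bigr => t _; by rewrite mxE.
  by move=> /rowP/(_ (g i)); rewrite !mxE phiK.
have cr_surj b : exists a, cr a = b.
  have /choice[c cE] : forall j, exists c : 'rV[rat]_d, b 0 j / m%:R = \sum_t c 0 t *: w t.
    by move=> j; apply: basis_expand dw.
  exists (\row_i (fun j t => c j 0 t) (f i) (g i)); apply/rowP => j.
  by rewrite (crE (fun j t => c j 0 t)) -cE mulrC divfK.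
have cr_int a : a \is a mxOver Num.int -> multiples_vec m (cr a).
  move=> /mxOverP ai j; rewrite crA; exists (\sum_t a 0 (phi (j, t)) *: w t) => //.
  apply: ai_sum => t _; have /intrP[z ->] := ai 0 (phi (j, t)).
  by rewrite scaler_int -mulrzr; apply: aiM => //; exact: ai_int.
have int_cr a : multiples_vec m (cr a) -> a \is a mxOver Num.int.
  move=> ha; apply/mxOverP => i0 i; rewrite [i0]ord1.
  have [y Oy] := ha (f i); rewrite crA => /(mulfI mK) yE.
  have [z [zE _]] := hw y Oy.
  have : (\row_t (a 0 (phi (f i, t)) - (z t)%:~R)) = 0 :> 'rV[rat]_d.
    apply: (conj_mx_free dw); under eq_bigr => t _ do rewrite mxE scalerBl scaler_int.
    by rewrite sumrB yE zE subrr.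
  move=> /rowP/(_ (g i)); rewrite !mxE phiK => /eqP; rewrite subr_eq0 => /eqP ->.
  exact: intr_int.
have [r [Or rU]] := hk.
have /choice[u uE] : forall i, exists a, cr a = r i by move=> i; exact: cr_surj.
have /choice[h hE] : forall a, exists i, integral_lattice Y (cr a) -> multiples_vec m (cr a - r i).
  move=> a; have [/rU[i [iP _]]|na] := pselect (integral_lattice Y (cr a)); first by exists i.
  by exists (Ordinal k0).
have msub := multiples_vec_submodule K l m.
exists k, A, (fun a => cr a *m Y), h, u; split=> //.
- split=> [a b|a /rowY_inj/cr_inj //|a|x /rowY_surj[b <-]].
  + by rewrite crB mulmxBl.
  + exact: rowY_mem.
  + by have [a <-] := cr_surj b; exists a.
- split=> [a /cr_int/sub //|a b Oa Ob hab|i|i j /cr_int hij].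
  + apply: int_cr; rewrite crB.
    have -> : cr a - cr b = (cr a - r (h a)) - (cr b - r (h b)).
      by rewrite hab opprB addrA subrK.
    by apply: msub.1.2; apply: hE.
  + by rewrite uE; exact: Or.
  + have [i' [_ iU]] := rU _ (Or i).
    rewrite -(iU i) ?subrr; last exact: msub.1.1.
    by apply: iU; rewrite -!uE -crB.
split=> //.
have hV : subspace_height R V ^+ d = (m ^ n)%:R / k%:R *
    \prod_k Num.sqrt (\sum_i nm (s k (grassmann Y^T 0 i)) ^+ 2).
  have := height2_pow gr0 fp; rewrite trmxK => <- //.
rewrite hV volA natrX.
set p := \prod_k _; set x := m%:R ^+ n; set y := _ ^+ l; set z := k%:R.
by rewrite !invfM invrK; ring.
Qed.

Section Points.
Variables (S : seq 'rV[K]_N) (T : R).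
Hypotheses (uS : uniq S) (SV : forall x, x \in S -> x \in V)
  (OS : forall x, x \in S -> integral_point x) (T0 : 0 < T)
  (hT : forall x k c, x \in S -> nm (s k (x 0 c)) <= T).

(** A point has [N * d] conjugate coordinates of modulus at most [T], hence norm at most
    [sqrt (N d) T]; this is the radius passed to [full_count]. *)
Lemma points_upper : (size S)%:R <= (4 * (Num.sqrt (N * d)%:R * T)) ^+ n /
     (Num.sqrt absD ^+ l * subspace_height R V ^+ d) \/
   (size S <= (Num.truncn (2 * T)).+1 ^ n.-1)%N.
Proof.
have [k [A [ka [h [u [k0 [tA pA] [kaB ka_inj kaV ka_surj] [ka_int hL Ou uI] [normA volA]]]]]]] := lattice_exists.
have n0 : (0 < n)%N by rewrite muln_gt0 l0.
have ka0 : ka 0 = 0 by rewrite -(subrr 0) kaB subrr.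
have kaI : injective ka.
  by move=> a b e; apply/eqP; rewrite -subr_eq0; apply/eqP/ka_inj; rewrite kaB e subrr.
have kaN a : ka (- a) = - ka a by rewrite -sub0r kaB ka0 sub0r.
have kaD a b : ka (a + b) = ka a + ka b by rewrite -[b]opprK kaB kaN !opprK.
have kaM a m : ka (m%:R *: a) = m%:R *: ka a.
  rewrite !scaler_nat; elim: m => [|m IH]; first by rewrite !mulr0n ka0.
  by rewrite !mulrS kaD IH.
have /choice[inv invE] : forall x, exists a, x \in S -> ka a = x.
  move=> x; case: (boolP (x \in S)) => [/SV/ka_surj[a aE]|_]; first by exists a.
  by exists 0.
pose L a := integral_point (ka a).
pose S' := map inv S.
have uS' : uniq S'.
  rewrite map_inj_in_uniq // => x y xS yS e.
  by rewrite -(invE x xS) -(invE y yS) e.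
have S'S a : a \in S' -> ka a \in S by move=> /mapP[x xS ->]; rewrite invE.
have LS' a : a \in S' -> L a by move=> /S'S/OS.
have L0 : L 0 by move=> c; rewrite ka0 mxE; exact: ai0.
have LB a b : L a -> L b -> L (a - b).
  by move=> La Lb c; rewrite kaB !mxE; apply: aiB; [exact: La|exact: Lb].
have szE : size S = size S' by rewrite size_map.
pose M : 'M[rat]_(size S', n) := \matrix_(i, j) (tnth (in_tuple S') i) 0 j.
have [rkM|rkM] := eqVneq (\rank M) n.
  left; rewrite szE -volA.
  have N0 : (0 < N)%N by apply: leq_trans l0 _; have := dimvS (subvf V); rewrite dimvf /dim /= mul1n.
  have r0 : 0 < Num.sqrt (N * d)%:R * T :> R.
    by rewrite mulr_gt0 // sqrtr_gt0 ltr0n muln_gt0 N0.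
  rewrite mulrCA mulrA.
  apply: (@full_count R n k A tA pA L h L0 LB hL S' uS' LS' _ r0 rkM) => a aS.
  rewrite normA exprMn sqr_sqrtr ?ler0n //.
  apply: (@le_trans _ _ (\sum_(k < d) \sum_(c < N) T ^+ 2)).
    apply: ler_sum => i _; apply: ler_sum => c _.
    by rewrite ler_pXn2r ?nnegrE ?nm_ge0 ?(ltW T0) //; apply: hT; apply: S'S.
  by rewrite !sumr_const !card_ord -mulrnA mulr_natl mulnC.
right; rewrite szE.
have ltM : (\rank M < n)%N by rewrite ltn_neqAle rkM rank_leq_col.
(* The modulus exceeds [2 T], so the quotient [z] of a difference has all conjugates below 1 and
   vanishes by [ai_small]. *)
apply: (deficient_count tA L0 LB uS' LS' _ n0 ltM) => // a b z aS bS Lz e.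
apply: ka_inj; apply/rowP => c; rewrite mxE; apply: (ai_small hs) => [|i]; first exact: Lz.
have := congr1 (fun x : 'rV_N => nm (s i (x 0 c))) (congr1 ka e).
rewrite kaB kaM !mxE rmorphB rmorphM rmorph_nat nmM => e2.
have := hT i c (S'S a aS); have := hT i c (S'S b bS).
have := nmD (s i (ka a 0 c)) (- s i (ka b 0 c)); rewrite e2 nmN.
have -> : nm ((Num.truncn (2 * T)).+1%:R : C) = (Num.truncn (2 * T)).+1%:R.
  by rewrite -(rmorph_nat (real_complex R)) nm_real normr_nat.
have := truncnS_gt (2 * T); move: ((Num.truncn (2 * T)).+1%:R : R) => q hq h1 h2 h3.
have q0 : 0 < q by apply: lt_trans hq; rewrite mulr_gt0.
rewrite -(ltr_pM2l q0) mulr1; apply: le_lt_trans h1 _; apply: le_lt_trans (lerD h3 h2) _.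
by rewrite -mulr2n -mulr_natl.
Qed.

End Points.

(** The cube of half-width [T / sqrt n] lies in the ball of radius [T], and the norm bounds every
    single conjugate. *)
Lemma points_lower (T : R) : 0 < T -> exists S : seq 'rV[K]_N,
  [/\ uniq S, (forall x, x \in S -> x \in V), (forall x, x \in S -> integral_point x),
    (forall x k c, x \in S -> nm (s k (x 0 c)) <= T) &
    (T / Num.sqrt n%:R) ^+ n / (Num.sqrt absD ^+ l * subspace_height R V ^+ d)
      <= 2 * (size S)%:R].
Proof.
move=> T0.
have [k [A [ka [h [u [k0 [tA pA] [kaB ka_inj kaV ka_surj] [ka_int hL Ou uI] [normA volA]]]]]]] := lattice_exists.
have n0 : (0 < n)%N by rewrite muln_gt0 l0.
have kaI : injective ka.
  by move=> a b e; apply/eqP; rewrite -subr_eq0; apply/eqP/ka_inj; rewrite kaB e subrr.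
pose L a := integral_point (ka a).
have LB a b : L a -> L b -> L (a - b).
  by move=> La Lb c; rewrite kaB !mxE; apply: aiB; [exact: La|exact: Lb].
have sg0 : 0 < T / Num.sqrt n%:R by rewrite divr_gt0 // sqrtr_gt0 ltr0n.
have [S [uS LS hS szS]] := @many_points R n k A u tA pA uI L _ LB Ou ka_int n0 k0 sg0.
exists (map ka S); split.
- by rewrite map_inj_uniq.
- by move=> _ /mapP[a _ ->].
- by move=> _ /mapP[a aS ->]; exact: LS.
- move=> _ i c /mapP[a aS ->].
  rewrite -(@ler_pXn2r _ 2) ?nnegrE ?nm_ge0 ?(ltW T0) //.
  apply: (@le_trans _ _ (\sum_k \sum_c nm (s k (ka a 0 c)) ^+ 2)).
    rewrite (bigD1 i) //= (bigD1 c) //= -addrA lerDl addr_ge0 ?sumr_ge0 // => j _.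
      by rewrite sqr_ge0.
    by apply: sumr_ge0 => c' _; rewrite sqr_ge0.
  rewrite -normA; apply: (@le_trans _ _ (\sum_(j < n) (T / Num.sqrt n%:R) ^+ 2)).
    apply: ler_sum => j _; rewrite -real_normK ?num_real // ler_pXn2r ?nnegrE ?(ltW sg0) //.
    exact: hS.
  rewrite sumr_const card_ord exprMn exprVn sqr_sqrtr ?ler0n // -[leLHS]mulr_natr divfK //.
  by rewrite pnatr_eq0 -lt0n.
- by rewrite size_map -volA mulrCA mulrA.
Qed.

End Subspace.
End Lattices.

(** * Comparison of the counts *)

(** Explains the binomial coefficient of [const2]: its square root, together with [sqrt (l d)],
    replaces the power of [sqrt (N d)] coming from the radius. *)
Lemma expn_le_binomial n k : (k <= n)%N -> (n ^ k <= k ^ k * 'C(n, k))%N.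
Proof.
elim: k n => [|k IH] [|n] // kn; rewrite ltnS in kn.
rewrite !expnS [(k.+1 * _)%N]mulnC -mulnA -mul_bin_diag mulnCA leq_mul2l /=.
have [k0|k0] := posnP k; first by rewrite k0 !expn0 mul1n bin0.
have h1 : (n.+1 ^ k * k ^ k <= k.+1 ^ k * n ^ k)%N.
  by rewrite -!expnMn leq_exp2r //; nia.
have kk : (0 < k ^ k)%N by rewrite expn_gt0 k0.
rewrite -(leq_pmul2r kk); apply: leq_trans h1 _.
by rewrite -mulnA leq_mul2l; apply/orP; right; rewrite mulnC; exact: IH.
Qed.

Lemma exprD_ge (R : realDomainType) (x y : R) k : (0 < k)%N -> 0 <= x -> 0 <= y ->
  x ^+ k + y ^+ k <= (x + y) ^+ k.
Proof.
case: k => // k _ x0 y0; elim: k => [|k IH]; first by rewrite !expr1.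
rewrite [leRHS]exprS; apply: (@le_trans _ _ ((x + y) * (x ^+ k.+1 + y ^+ k.+1))).
  rewrite [x ^+ k.+2]exprS [y ^+ k.+2]exprS.
  have h1 : 0 <= x * y ^+ k.+1 by rewrite mulr_ge0 ?exprn_ge0.
  have h2 : 0 <= y * x ^+ k.+1 by rewrite mulr_ge0 ?exprn_ge0.
  by rewrite mulrDl !mulrDr; lra.
by rewrite ler_wpM2l ?addr_ge0.
Qed.

(** Superadditivity of [k]-th powers gives [(a + 1)^k (b^k + c^k) <= T^k]. Multiplied by [T], the
    first term dominates as it stands; in the second, [T >= (a + 1) c] supplies the missing [c], and
    [a + 1 > a] the strictness. *)
Lemma threshold (R : realFieldType) (a b c T : R) k : (0 < k)%N -> 0 <= a -> 0 <= b ->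
  0 < c -> (a + 1) * (b + c) <= T -> a ^+ k * (b ^+ k * T + c ^+ k.+1) < T ^+ k.+1.
Proof.
move=> k0 a0 b0 c0 hT.
have a1 : 0 < a + 1 by lra.
have bc0 : 0 < b + c by lra.
have T0 : 0 < T by apply: lt_le_trans hT; rewrite mulr_gt0.
have hTk : (a + 1) ^+ k * (b ^+ k + c ^+ k) <= T ^+ k.
  apply: (@le_trans _ _ (((a + 1) * (b + c)) ^+ k)).
    rewrite exprMn ler_pM2l ?exprn_gt0 //; apply: exprD_ge => //; exact: ltW.
  by rewrite ler_pXn2r ?nnegrE ?mulr_ge0 ?(ltW a1) ?(ltW bc0) ?(ltW T0).
have ak : a ^+ k <= (a + 1) ^+ k by rewrite ler_pXn2r ?nnegrE ?(ltW a1) //; lra.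
rewrite [T ^+ _]exprS; apply: lt_le_trans (ler_wpM2l (ltW T0) hTk).
rewrite mulrDr [X in _ < T * X]mulrDr [X in _ < X]mulrDr.
apply: ler_ltD.
  by rewrite mulrA mulrC ler_wpM2l ?(ltW T0) // ler_wpM2r ?exprn_ge0.
apply: (@lt_le_trans _ _ (((a + 1) * c) * ((a + 1) ^+ k * c ^+ k))); last first.
  rewrite ler_wpM2r ?mulr_ge0 ?exprn_ge0 ?(ltW a1) ?(ltW c0) //.
  by apply: le_trans hT; rewrite ler_pM2l //; lra.
have -> : (a + 1) * c * ((a + 1) ^+ k * c ^+ k) = (a + 1) ^+ k.+1 * c ^+ k.+1.
  by rewrite !exprS; ring.
rewrite ltr_pM2r ?exprn_gt0 //; apply: (@lt_le_trans _ _ ((a + 1) ^+ k)).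
  by rewrite ltr_pXn2r ?nnegrE ?(ltW a1) //; lra.
by rewrite exprS ler_peMl ?exprn_ge0 ?(ltW a1) //; lra.
Qed.

Lemma full_count_combine (R : realFieldType) (Y X x y q c e t u T D g : R) :
  Y * (x * y) <= X * e -> q <= y * c -> t <= u * T -> 0 < D -> 0 < g ->
  0 <= Y -> 0 <= x -> 0 <= y -> 0 <= q -> 0 <= c -> 0 <= t ->
  Y * (x * (q * t) / (D * g)) <= X * u * (T * (e * c / D / g)).
Proof.
move=> h1 h2 h3 D0 g0 Y0 x0 y0 q0 c0 t0.
have -> : Y * (x * (q * t) / (D * g)) = (Y * x * q) * t / (D * g) by ring.
have -> : X * u * (T * (e * c / D / g)) = (X * e * c) * (u * T) / (D * g).
  by rewrite invfM; ring.
rewrite ler_pM2r ?invr_gt0 ?mulr_gt0 //; apply: ler_pM => //.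
  by rewrite !mulr_ge0.
apply: (@le_trans _ _ (Y * (x * y) * c)); last by rewrite ler_wpM2r.
have -> : Y * (x * y) * c = Y * x * (y * c) by ring.
by rewrite ler_wpM2l // mulr_ge0.
Qed.

Lemma truncn_double (R : archiRealFieldType) (T : R) : 1 <= T ->
  (Num.truncn (2 * T)).+1%:R <= 3 * T.
Proof.
move=> T1; rewrite -natr1.
have : (Num.truncn (2 * T))%:R <= 2 * T by rewrite truncn_le mulr_ge0 // (le_trans _ T1).
by lra.
Qed.

Section Main.
Variables (R : realType) (K : fieldExtType rat).
Local Notation d := (degree K).
Local Notation r2 := (num_complex_places R K).
Local Notation absD := (`|ratr (discriminant K)| : R).

Let d0 : (0 < d)%N. Proof. by rewrite /degree adim_gt0. Qed.
Let dR0 : 0 < (d%:R : R). Proof. by rewrite ltr0n. Qed.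

Lemma complex_places_le_degree : (2 * r2 <= d)%N.
Proof.
have [s hs] := all_embeddings_exist R K.
have [kp kpE] := emb_conj_exists hs.
have /choice[pl plP] := emb_place_exists s.
exact: (complex_places_le hs kpE (fun k => (plP k).1) (fun k => (plP k).2)).
Qed.

Lemma absD_gt0 : 0 < absD.
Proof.
have [s hs] := all_embeddings_exist R K.
have [w [_ dw Dw]] := discriminant_basis hs.
by rewrite -nm_ratr Dw nmX exprn_gt0 // lt_neqAle nm_ge0 eq_sym nm_eq0 dw.
Qed.

(** Nonvanishing is read off the covolume identity: a zero height would annihilate the nonzero
    quotient of the index by the diagonal product. *)
Lemma subspace_height_gt0 N (V : {vspace 'rV[K]_N}) : (0 < \dim V)%N ->
  0 < subspace_height R V.
Proof.
move=> l0; have [s hs] := all_embeddings_exist R K.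
have [kp kpE] := emb_conj_exists hs.
have /choice[pl plP] := emb_place_exists s.
have [k [A [ka [h [u [k0 [tA pA] _ _ [_ vol]]]]]]] :=
  lattice_exists hs kpE (fun k => (plP k).1) (fun k => (plP k).2) V.
have h0 : 0 <= subspace_height R V.
  rewrite /subspace_height /height2; case: ifP => // _.
  apply: mulr_ge0; apply: (big_ind (fun x => 0 <= x)) => //; try exact: mulr_ge0.
    by move=> v _; apply: bigmax_ge_id.
  by move=> v _; apply: powR_ge0.
rewrite lt_neqAle h0 andbT eq_sym; apply/eqP => H0; move: vol.
rewrite H0 expr0n (gtn_eqF d0) mulr0 invr0 => /eqP; rewrite mulf_eq0 invr_eq0.
rewrite pnatr_eq0 -[k == 0%N]negbK -lt0n k0 /=; apply/negP.
by apply/prodf_neq0 => j _; rewrite lt0r_neq0.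
Qed.

Lemma powR_half (x : R) n : 0 <= x -> x `^ (n%:R / 2) = Num.sqrt x ^+ n.
Proof.
by move=> x0; rewrite mulrC powRrM powR12_sqrt // powR_mulrn // sqrtr_ge0.
Qed.

Lemma powR_invK (x : R) k : (0 < k)%N -> 0 <= x -> (x `^ (1 / k%:R)) ^+ k = x.
Proof.
move=> k0 x0; rewrite -powR_mulrn ?powR_ge0 // -powRrM divfK ?pnatr_eq0 -?lt0n //.
exact: powRr1.
Qed.

Lemma const1_pow w : const1 R K w ^+ d =
  2 ^+ (w * (2 * d - r2)).+1 * (w * d)%:R ^+ (w * d) * Num.sqrt absD ^+ w.
Proof.
have r2d := complex_places_le_degree.
have eE : w%:R * (2 * d%:R - r2%:R) + 1 = (w * (2 * d - r2)).+1%:R :> R.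
  have r2d' : (r2 <= 2 * d)%N by lia.
  by rewrite -[RHS]natr1 natrM natrB // natrM.
have half (x : R) n : 0 <= x -> (x `^ (n%:R / (2 * d%:R))) ^+ d = Num.sqrt x ^+ n.
  move=> x0; rewrite -powR_mulrn ?powR_ge0 // -powRrM invfM [_^-1 * _]mulrC mulrA mulrAC.
  by rewrite divfK ?lt0r_neq0 // powR_half.
rewrite /const1 eE !exprMn !half // -[(w * d)%N]/(w * d)%N; congr (_ * _ * _).
  have -> : (4 : R) = 2 ^+ 2 by rewrite -natrX.
  by rewrite sqrtr_sqr ger0_norm.
by rewrite natrM exprMn !exprM.
Qed.

Lemma const2E N l : const2 R K N l =
  2 ^+ (l * r2) * Num.sqrt 'C(N * d, l * d)%:R / Num.sqrt absD ^+ l.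
Proof. by rewrite /const2 powR_half ?normr_ge0 // mul1r powR12_sqrt // ler0n. Qed.

(** Half of [(w d)^(w d)] pays for the cube inscribed in the ball, the other half for [sqrt (l d)].
    The powers of 2 compare because [(w - l) (2 d - r2)] is nonnegative. *)
Lemma full_constants w l : (0 < l <= w)%N ->
  2 * Num.sqrt (w * d)%:R ^+ (w * d) * (4 ^+ (l * d) * Num.sqrt (l * d)%:R ^+ (l * d))
  <= 2 ^+ (w * (2 * d - r2)).+1 * (w * d)%:R ^+ (w * d) * 2 ^+ (l * r2) :> R.
Proof.
move=> /andP[l0 lw]; have r2d := complex_places_le_degree.
set p := Num.sqrt _; have p1 : 1 <= p by rewrite -sqrtr1 ler_sqrt // ler1n; nia.
have -> : (w * d)%:R ^+ (w * d) = p ^+ (w * d) * p ^+ (w * d).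
  by rewrite -exprMn -expr2 sqr_sqrtr // ler0n.
have h1 : Num.sqrt (l * d)%:R ^+ (l * d) <= p ^+ (w * d).
  apply: (@le_trans _ _ (p ^+ (l * d))).
    by apply: lerXn2r; rewrite ?nnegrE ?sqrtr_ge0 // ler_sqrt ?ler0n // ler_nat leq_mul2r lw orbT.
  by apply: ler_weXn2l => //; rewrite leq_mul2r lw orbT.
have h2 : 4 ^+ (l * d) <= 2 ^+ (w * (2 * d - r2)) * 2 ^+ (l * r2) :> R.
  have -> : (4 : R) = 2 ^+ 2 by rewrite -natrX.
  by rewrite -exprM -exprD ler_weXn2l ?ler1n //; nia.
rewrite exprS; set x := 4 ^+ _ in h2 *; set y := Num.sqrt _ ^+ _ in h1 *.
set P := p ^+ (w * d) in h1 *; set u := 2 ^+ _ in h2 *; set v := 2 ^+ _ in h2 *.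
have P0 : 0 <= P by rewrite exprn_ge0 // (le_trans _ p1).
have x0 : 0 <= x by rewrite exprn_ge0.
have y0 : 0 <= y by rewrite exprn_ge0 ?sqrtr_ge0.
have -> : 2 * P * (x * y) = 2 * P * x * y by ring.
have -> : 2 * u * (P * P) * v = 2 * P * (u * v) * P by ring.
apply: ler_pM => //; first by rewrite !mulr_ge0.
by rewrite ler_wpM2l // mulr_ge0.
Qed.

(** The 3 comes from [truncn (2 T) + 1 <= 3 T]. After squaring, [2 r2 <= d] and [w d >= 2] leave
    [9^(w d) <= 8^(w d) 2^(w d)]. *)
Lemma deficient_constants w q : (1 < w)%N -> (q <= w * d)%N ->
  2 * Num.sqrt (w * d)%:R ^+ (w * d) * 3 ^+ q
  <= 2 ^+ (w * (2 * d - r2)).+1 * (w * d)%:R ^+ (w * d) :> R.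
Proof.
move=> w1 qn; have r2d := complex_places_le_degree.
set p := Num.sqrt _; have p0 : 0 <= p by exact: sqrtr_ge0.
have pp : p ^+ 2 = (w * d)%:R by rewrite sqr_sqrtr // ler0n.
have -> : (w * d)%:R ^+ (w * d) = p ^+ (w * d) * p ^+ (w * d).
  by rewrite -exprMn -expr2 pp.
suff h : 3 ^+ q <= 2 ^+ (w * (2 * d - r2)) * p ^+ (w * d) :> R.
  rewrite exprS; set P := p ^+ _ in h *; set u := 2 ^+ _ in h *.
  have P0 : 0 <= P by rewrite exprn_ge0.
  have -> : 2 * u * (P * P) = 2 * P * (u * P) by ring.
  by rewrite ler_wpM2l // mulr_ge0.
rewrite -(@ler_pXn2r _ 2) ?nnegrE ?mulr_ge0 ?exprn_ge0 //.
rewrite exprMn -!exprM [(w * d * 2)%N]mulnC [p ^+ _]exprM pp -!natrX -natrM ler_nat.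
apply: (@leq_trans (2 ^ (3 * (w * d)) * 2 ^ (w * d))).
  rewrite -expnD; have -> : (3 * (w * d) + w * d = 4 * (w * d))%N by lia.
  rewrite mulnC expnM [X in (_ <= X)%N]expnM; apply: (@leq_trans ((3 ^ 2) ^ (w * d))).
    by rewrite leq_exp2l.
  by rewrite leq_exp2r //; nia.
apply: leq_mul; first by rewrite leq_exp2l //; nia.
by rewrite leq_exp2r //; nia.
Qed.

Section Count.
Variables (N M : nat) (W : {vspace 'rV[K]_N}) (s : nat) (V : 'I_M -> {vspace 'rV[K]_N}).
Local Notation w := (\dim W).
Hypotheses (hs : (1 <= s < w)%N) (hM : (1 <= M)%N)
  (hV : forall i, (1 <= \dim (V i))%N) (hVs : forall i, (\dim (V i) <= s)%N).

Let k := ((w - s) * d)%N.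
Let a : R := (const1 R K w * subspace_height R W) `^ (1 / (w%:R - s%:R)).
Let sumC : R := \sum_(i < M) const2 R K N (\dim (V i)) / subspace_height R (V i) ^+ d.

Let w0 : (0 < w)%N. Proof. by case/andP: hs => _; apply: leq_ltn_trans. Qed.
Let k0 : (0 < k)%N. Proof. by rewrite muln_gt0 d0 subn_gt0; case/andP: hs => _ ->. Qed.

Let HW := subspace_height_gt0 w0.

Let apow : a ^+ k = const1 R K w ^+ d * subspace_height R W ^+ d.
Proof.
have ws : (0 < w - s)%N by rewrite subn_gt0; case/andP: hs.
rewrite /a -natrB; last by case/andP: hs => _ /ltnW.
rewrite /k exprM powR_invK // ?exprMn //.
by rewrite mulr_ge0 ?(ltW HW) // /const1 !mulr_ge0 ?exprn_ge0 ?powR_ge0 // mulr_ge0.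
Qed.

Let const2_ge0 l : 0 <= const2 R K N l.
Proof. by rewrite const2E divr_ge0 ?mulr_ge0 ?exprn_ge0 ?sqrtr_ge0. Qed.

Let sumC_ge0 : 0 <= sumC.
Proof.
apply: sumr_ge0 => i _; rewrite divr_ge0 // exprn_ge0 // ltW //.
exact: subspace_height_gt0.
Qed.

Lemma bound1E : bound1 R W s V =
  (a + 1) * (sumC `^ (1 / k%:R) + M%:R `^ (1 / k.+1%:R)).
Proof.
have e : (w%:R - s%:R) * d%:R = k%:R :> R.
  by rewrite -natrB ?natrM //; case/andP: hs => _ /ltnW.
by rewrite /bound1 e natr1.
Qed.

Lemma bound1_ge1 : 1 <= bound1 R W s V.
Proof.
rewrite bound1E; have a0 : 0 <= a by exact: powR_ge0.
have b0 : 0 <= sumC `^ (1 / k%:R) by exact: powR_ge0.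
have c1 : 1 <= M%:R `^ (1 / k.+1%:R) :> R.
  apply: (@le_trans _ _ (M%:R `^ 0)); first by rewrite powRr0.
  by apply: ler_powR; rewrite ?ler1n // divr_ge0.
by rewrite -[leLHS]mulr1; apply: ler_pM => //; lra.
Qed.

Variables (T : R) (P : seq 'rV[K]_N) (Q : 'I_M -> seq 'rV[K]_N).
Hypothesis (hT : bound1 R W s V <= T).

Let QW := Num.sqrt absD ^+ w * subspace_height R W ^+ d.

Hypothesis lower : (T / Num.sqrt (w * d)%:R) ^+ (w * d) / QW <= 2 * (size P)%:R.
Hypothesis upper : forall i,
  (size (Q i))%:R <= (4 * (Num.sqrt (N * d)%:R * T)) ^+ (\dim (V i) * d) /
     (Num.sqrt absD ^+ \dim (V i) * subspace_height R (V i) ^+ d) \/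
  (size (Q i) <= (Num.truncn (2 * T)).+1 ^ (\dim (V i) * d).-1)%N.

Let T1 : 1 <= T. Proof. exact: le_trans bound1_ge1 hT. Qed.
Let T0 : 0 < T. Proof. exact: lt_le_trans T1. Qed.
Let rD0 : 0 < Num.sqrt absD. Proof. by rewrite sqrtr_gt0 absD_gt0. Qed.

Let QW0 : 0 < QW. Proof. by rewrite mulr_gt0 // exprn_gt0. Qed.

Let factor : 0 <= 2 * Num.sqrt (w * d)%:R ^+ (w * d) * QW :> R.
Proof.
by apply: mulr_ge0 (ltW QW0); apply: mulr_ge0.
Qed.

Let dimN i : (\dim (V i) <= N)%N.
Proof. by have := dimvS (subvf (V i)); rewrite dimvf /dim /= mul1n. Qed.

(** The two cases of [upper] yield the two summands: the spanning one the term with the height of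
    [V i], the deficient one the 1. Both are then simply added. *)
Let single i : 2 * Num.sqrt (w * d)%:R ^+ (w * d) * QW * (size (Q i))%:R <=
  a ^+ k * T ^+ (s * d).-1 * (T * (const2 R K N (\dim (V i)) / subspace_height R (V i) ^+ d) + 1).
Proof.
have /andP[s1 sw] := hs; have li := hV i; have ls := hVs i.
have Hi : 0 < subspace_height R (V i) ^+ d by rewrite exprn_gt0 // subspace_height_gt0.
have sd0 : (0 < s * d)%N by rewrite muln_gt0 s1.
rewrite apow const1_pow /QW; set l := \dim (V i) in li ls Hi *.
set X := 2 ^+ _.+1 * (w * d)%:R ^+ (w * d).
set Y := 2 * _ ^+ (w * d).
have X0 : 0 <= X by rewrite mulr_ge0 ?exprn_ge0.
have Y0 : 0 <= Y by rewrite mulr_ge0 ?exprn_ge0 ?sqrtr_ge0.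
have T1' m n : (m <= n)%N -> T ^+ m <= T ^+ n by move=> mn; rewrite ler_weXn2l.
rewrite [X * _ * _]mulrAC mulrA [leLHS]mulrAC [Y * _ * _]mulrAC.
set z := Num.sqrt absD ^+ w; set h := subspace_height R W ^+ d.
have z0 : 0 < z by rewrite exprn_gt0.
have h0 : 0 < h by rewrite exprn_gt0.
suff H : Y * (size (Q i))%:R <= X * T ^+ (s * d).-1 * (T * (const2 R K N l / subspace_height R (V i) ^+ d) + 1).
  have := ler_wpM2r (mulr_ge0 (ltW z0) (ltW h0)) H; rewrite [leLHS]mulrA.
  have e (b t x y u : R) : x * t * b * (y * u) = x * u * y * t * b by ring.
  by rewrite e.
case: (upper i) => [hi|hi].
  apply: (@le_trans _ _ (X * T ^+ (s * d).-1 * (T * (const2 R K N l / subspace_height R (V i) ^+ d)))); last first.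
    by rewrite ler_wpM2l ?mulr_ge0 ?exprn_ge0 ?(ltW T0) // lerDl.
  apply: le_trans (ler_wpM2l Y0 hi) _.
  rewrite -/l const2E; set c := Num.sqrt 'C(_, _)%:R; set D := Num.sqrt absD ^+ l.
  have D0 : 0 < D by rewrite exprn_gt0.
  have c0 : 0 <= c by rewrite sqrtr_ge0.
  rewrite !exprMn.
  have hN : Num.sqrt (N * d)%:R ^+ (l * d) <= Num.sqrt (l * d)%:R ^+ (l * d) * c :> R.
    rewrite -(@ler_pXn2r _ 2) ?nnegrE ?mulr_ge0 ?exprn_ge0 ?sqrtr_ge0 //.
    have sq (x : R) n : 0 <= x -> Num.sqrt x ^+ n ^+ 2 = x ^+ n.
      by move=> x0; rewrite exprAC sqr_sqrtr.
    rewrite exprMn !sq ?ler0n // sqr_sqrtr ?ler0n //.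
    rewrite -!natrX -natrM ler_nat; apply: expn_le_binomial.
    by rewrite leq_mul2r dimN orbT.
  have hF := @full_constants w l.
  rewrite li (ltnW (leq_ltn_trans ls sw)) in hF; have {}hF := hF isT; rewrite -/Y -/X in hF.
  have hT' : T ^+ (l * d) <= T ^+ (s * d).-1 * T.
    by rewrite -exprSr prednK //; apply: T1'; rewrite leq_mul2r ls orbT.
  set x4 := 4 ^+ _ in hF *; set y := Num.sqrt _ ^+ _ in hF hN *.
  set q := Num.sqrt _ ^+ _ in hN *; set g := _ ^+ d in Hi *.
  apply: (@full_count_combine R Y X x4 y q c (2 ^+ (l * r2)) _ _ T D g) => //;
    rewrite ?exprn_ge0 ?sqrtr_ge0 //; exact: ltW.
apply: (@le_trans _ _ (X * T ^+ (s * d).-1 * 1)); last first.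
  rewrite ler_wpM2l ?mulr_ge0 ?exprn_ge0 ?(ltW T0) // lerDr.
  by rewrite mulr_ge0 ?divr_ge0 ?(ltW T0) ?(ltW Hi).
rewrite mulr1.
have hq : (size (Q i))%:R <= (3 * T) ^+ (s * d).-1.
  apply: (@le_trans _ _ ((Num.truncn (2 * T)).+1%:R ^+ (l * d).-1)).
    by rewrite -natrX ler_nat.
  have ht := truncn_double T1.
  apply: (@le_trans _ _ ((3 * T) ^+ (l * d).-1)).
    by apply: lerXn2r; rewrite ?nnegrE ?mulr_ge0 ?(ltW T0) // ler0n.
  apply: ler_weXn2l; first by apply: le_trans T1 _; rewrite ler_peMl ?(ltW T0) // ler1n.
  by rewrite -!subn1 leq_sub2r // leq_mul.
apply: le_trans (ler_wpM2l Y0 hq) _.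
rewrite exprMn mulrA ler_wpM2r ?exprn_ge0 ?(ltW T0) //.
apply: deficient_constants; first exact: leq_ltn_trans s1 sw.
by apply: leq_trans (leq_pred _) _; rewrite leq_mul2r (ltnW sw) orbT.
Qed.

Lemma count_contradiction : (size P <= \sum_i size (Q i))%N -> False.
Proof.
move=> hP; have /andP[s1 sw] := hs.
have sd0 : (0 < s * d)%N by rewrite muln_gt0 s1.
(* Dividing by [T ^+ (s * d).-1] leaves [T ^+ k.+1] on the left, the exponent in [threshold]. *)
have wE : (w * d = (s * d).-1 + k.+1)%N.
  by rewrite addnS -addSn prednK // /k -mulnDl subnKC // ltnW.
have p0 : 0 < Num.sqrt (w * d)%:R :> R by rewrite sqrtr_gt0 ltr0n muln_gt0 w0.
have : T ^+ (w * d) <= \sum_i a ^+ k * T ^+ (s * d).-1 *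
   (T * (const2 R K N (\dim (V i)) / subspace_height R (V i) ^+ d) + 1).
  apply: le_trans (ler_sum _ (fun i _ => single i)).
  rewrite -mulr_sumr -natr_sum.
  apply: (@le_trans _ _ (2 * Num.sqrt (w * d)%:R ^+ (w * d) * QW * (size P)%:R)); last first.
    by apply: ler_wpM2l; [exact: factor|rewrite ler_nat].
  have h := lower; rewrite expr_div_n ler_pdivrMr // ler_pdivrMr ?exprn_gt0 // in h.
  have e (x y u : R) : 2 * x * y * u = 2 * u * y * x by ring.
  by rewrite e in h.
rewrite -mulr_sumr big_split /= -mulr_sumr -/sumC sumr_const card_ord wE exprD.
rewrite [a ^+ k * _]mulrC -mulrA ler_pM2l ?exprn_gt0 // leNgt => /negP; apply.
have hT' := hT; rewrite bound1E in hT'.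
have e1 := powR_invK k0 sumC_ge0; have e2 := powR_invK (ltn0Sn k) (ler0n R M).
have b0 : 0 <= sumC `^ (1 / k%:R) := powR_ge0 _ _.
have c0 : 0 < M%:R `^ (1 / k.+1%:R) :> R by rewrite powR_gt0 // ltr0n.
have := threshold k0 (powR_ge0 _ _ : 0 <= a) b0 c0 hT'.
by rewrite e1 e2 [sumC * T]mulrC.
Qed.

End Count.
End Main.

Theorem theorem3p1 (R : realType) (K : fieldExtType rat) (N : nat)
    (W : {vspace 'rV[K]_N}) (s M : nat) (V : 'I_M -> {vspace 'rV[K]_N})
    (hN : (2 <= N)%N)
    (hW : (1 <= \dim W <= N)%N)
    (hs : (1 <= s < \dim W)%N)
    (hM : (1 <= M)%N)
    (hV : forall i, (1 <= \dim (V i))%N)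
    (hVs : (\max_(i < M) \dim (V i) <= s)%N) :
  exists x : 'rV[K]_N,
    [/\ x \in W,
        forall i, x \notin V i
      & height R x <= Num.max (bound1 R W s V) (bound2 R W)].
Proof.
have [sg hsg] := all_embeddings_exist R K.
have [kp kpE] := emb_conj_exists hsg.
have /choice[pl plP] := emb_place_exists sg.
have plA k := (plP k).1; have plE k := (plP k).2.
have hVs' i : (\dim (V i) <= s)%N.
  exact: leq_trans (leq_bigmax (F := fun i => \dim (V i)) i) hVs.
set T := Num.max _ _.
have hT : bound1 R W s V <= T by rewrite le_max lexx.
have T1 : 1 <= T by apply: le_trans hT; exact: bound1_ge1.
have T0 : 0 < T by exact: lt_le_trans T1.
have w0 : (0 < \dim W)%N by case/andP: hW.
have [P [uP PW OP hP lowP]] := points_lower hsg kpE plA plE w0 T0.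
apply: contrapT => none.
have cover x : x \in P -> exists i, x \in V i.
  move=> xP; apply: contrapT => h; apply: none; exists x; split; first exact: PW.
    by move=> i; apply/negP => xV; apply: h; exists i.
  by apply: (height_le hsg kpE plA plE T1) => [c|k c]; [exact: OP|exact: hP].
pose Q i := [seq x <- P | x \in V i].
apply: (@count_contradiction R K N M W s V hs hM hV hVs' T P Q hT lowP).
  move=> i; apply: (points_upper hsg kpE plA plE (hV i)) => //.
  - exact: filter_uniq.
  - by move=> x; rewrite mem_filter => /andP[].
  - by move=> x; rewrite mem_filter => /andP[_ /OP].
  - by move=> x k c; rewrite mem_filter => /andP[_ /hP].
rewrite -[size P]sum1_size big_seq.
apply: (@leq_trans (\sum_(x <- P | x \in P) \sum_(i < M) (x \in V i))).
  apply: leq_sum => x /cover[i xi]; rewrite (bigD1 i) //= xi; lia.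
rewrite -big_seq exchange_big; apply: leq_sum => i _ /=.
rewrite size_filter -sum1_count [X in (_ <= X)%N]big_mkcond /=; apply: leq_sum => x _.
by case: (x \in V i).
Qed.
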